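(* Let $d\ge 1$, let $H_0,H_1,\dots,H_d\in(\frac12,1)$ satisfy $2H_0+\sum_{i=1}^d H_i>d+1$, and fix $t>0$ and $x\in\mathbb{R}^d$. Then, for every $\lambda\in\mathbb{R}$, $$E\exp\left(\lambda\int_0^t\int_{\mathbb{R}^d}\delta(B^x_{t-r}-y)\,W(dr,dy)\right)<\infty ,$$ where the expectation is taken with respect to both $W$ and $B$.
   Context: $W=\{W(t,x):t\ge0,x\in\mathbb{R}^d\}$ is a zero-mean Gaussian random field (fractional Brownian sheet) with covariance $E(W(t,x)W(s,y))=R_{H_0}(s,t)\prod_{i=1}^dR_{H_i}(x_i,y_i)$, where $R_H(s,t)=\frac12(|t|^{2H}+|s|^{2H}-|t-s|^{2H})$. Set $\alpha_H=\prod_{i=0}^dH_i(2H_i-1)$. $\mathcal{H}$ is the Hilbert space obtained by completing the linear span of the indicators of rectangles $(s,t]\times(x,y]\subset\mathbb{R}_+\times\mathbb{R}^d$ for the inner product $$\langle\phi,\psi\rangle_{\mathcal{H}}=\alpha_H\int_{\mathbb{R}_+^2\times\mathbb{R}^{2d}}\phi(s,x)\psi(t,y)|s-t|^{2H_0-2}\prod_{i=1}^d|x_i-y_i|^{2H_i-2}\,ds\,dt\,dx\,dy;$$ it contains every measurable $\phi$ for which this integral with $\phi=\psi$ replaced by $|\phi|$ is finite. The map sending the indicator of a rectangle to the rectangular increment of $W$ over it extends to a linear isometry $\phi\mapsto W(\phi)=\int_0^\infty\int_{\mathbb{R}^d}\phi(t,x)W(dt,dx)$ from $\mathcal{H}$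 into $L^2$. $B=(B^1,\dots,B^d)$ is a standard $d$-dimensional Brownian motion started at $0$, independent of $W$, and $B^x_t=B_t+x$. Let $p_\varepsilon(x)=(2\pi\varepsilon)^{-d/2}e^{-|x|^2/(2\varepsilon)}$ and $\varphi_\delta(r)=\frac1\delta I_{[0,\delta]}(r)$. The random variable $V_{t,x}=\int_0^t\int_{\mathbb{R}^d}\delta(B^x_{t-r}-y)W(dr,dy)$ is defined as the limit in $L^2$ (on the joint probability space), as $\varepsilon,\delta\downarrow0$, of $V^{\varepsilon,\delta}_{t,x}=\int_0^t\int_{\mathbb{R}^d}A^{\varepsilon,\delta}_{t,x}(r,y)W(dr,dy)$ with $A^{\varepsilon,\delta}_{t,x}(r,y)=\int_0^t\varphi_\delta(t-s-r)p_\varepsilon(B^x_s-y)\,ds$, the integral with respect to $W$ being taken for fixed $B$. This limit exists under the hypothesis $2H_0+\sum_{i=1}^dH_i>d+1$; conditionally on $B$ it is centered Gaussian with variance $\alpha_H\int_0^t\int_0^t|r-s|^{2H_0-2}\prod_{i=1}^d|B^i_r-B^i_s|^{2H_i-2}\,dr\,ds$. *)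

(* Defs.v *)
From HB Require Import structures.
From mathcomp Require Import all_boot all_order all_algebra.
From mathcomp Require Import all_classical all_reals all_analysis.

Set Implicit Arguments.
Unset Strict Implicit.
Unset Printing Implicit Defensive.

Import Order.TTheory GRing.Theory Num.Theory.
Import numFieldNormedType.Exports.

Local Open Scope ring_scope.
Local Open Scope classical_set_scope.

Section sigma_finite_product.
Context d1 d2 (T1 : measurableType d1) (T2 : measurableType d2) (R : realType).
Variables (m1 : {sigma_finite_measure set T1 -> \bar R})
          (m2 : {sigma_finite_measure set T2 -> \bar R}).

(* The library's sigma-finite instance on [m1 \x m2] is only found when m1 and
   m2 are subprobabilities, hence this copy of the product. *)
Definition sfprod : set (T1 * T2)%type -> \bar R := (m1 \x m2)%E.

HB.instance Definition _ := Measure.on sfprod.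

Let sfprod_sigma_finite : sigma_finite setT sfprod.
Proof.
have /sigma_finiteP[F [TF ndF Foo]] := sigma_finiteT m1.
have /sigma_finiteP[G [TG ndG Goo]] := sigma_finiteT m2.
exists (fun n => F n `*` G n).
  rewrite -setXTT TF TG predeqE => -[x y]; split.
    move=> [/= [n _ Fnx] [k _ Gky]]; exists (maxn n k) => //; split.
    - by move: x Fnx; exact/subsetPset/ndF/leq_maxl.
    - by move: y Gky; exact/subsetPset/ndG/leq_maxr.
  by move=> [n _ []/= ? ?]; split; exists n.
move=> k; have [? ?] := Foo k; have [? ?] := Goo k.
split; first exact: measurableX.
by rewrite /sfprod product_measure1E// lte_mul_pinfty// ge0_fin_numE.
Qed.

HB.instance Definition _ := Measure_isSigmaFinite.Build _ _ _ sfprod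
  sfprod_sigma_finite.

End sigma_finite_product.

Section lebesgue_tuple.
Context (R : realType).

Definition cons_pair n (p : measurableTypeR R * n.-tuple (measurableTypeR R)) :
  n.+1.-tuple (measurableTypeR R) := [tuple of p.1 :: p.2].

Lemma measurable_cons_pair n : measurable_fun setT (@cons_pair n).
Proof. exact: measurable_cons. Qed.

Section step.
Variables (n : nat)
  (m : {sigma_finite_measure set (n.-tuple (measurableTypeR R)) -> \bar R}).

Definition lebesgue_cons : set (n.+1.-tuple (measurableTypeR R)) -> \bar R :=
  pushforward (sfprod (@lebesgue_measure R) m) (@cons_pair n).

Let lebesgue_cons0 : lebesgue_cons set0 = 0%E.
Proof. by rewrite /lebesgue_cons /pushforward preimage_set0 measure0. Qed.

Let lebesgue_cons_ge0 A : (0 <= lebesgue_cons A)%E.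
Proof. by rewrite /lebesgue_cons /pushforward; exact: measure_ge0. Qed.

Let lebesgue_cons_sigma_additive : semi_sigma_additive lebesgue_cons.
Proof.
move=> F mF tF mUF; rewrite /lebesgue_cons /pushforward preimage_bigcup.
apply: measure_semi_sigma_additive.
- by move=> k; rewrite -[X in measurable X]setTI; exact: measurable_cons_pair.
- apply/trivIsetP => /= i j _ _ ij; rewrite -preimage_setI.
  by move/trivIsetP : tF => /(_ _ _ _ _ ij) ->//; rewrite preimage_set0.
- rewrite -preimage_bigcup -[X in measurable X]setTI.
  exact: measurable_cons_pair.
Qed.

HB.instance Definition _ := isMeasure.Build _ _ _ lebesgue_cons
  lebesgue_cons0 lebesgue_cons_ge0 lebesgue_cons_sigma_additive.

Let lebesgue_cons_sigma_finite : sigma_finite setT lebesgue_cons.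
Proof.
have [F FT Foo] := sigma_finiteT (sfprod (@lebesgue_measure R) m).
pose u (z : n.+1.-tuple (measurableTypeR R)) :
  measurableTypeR R * n.-tuple (measurableTypeR R) :=
  (tnth z ord0, [tuple of behead z]).
have uK : cancel (@cons_pair n) u.
  by case=> a b; rewrite /u /cons_pair /=; congr pair; exact: val_inj.
have mu : measurable_fun setT u.
  apply/measurable_fun_pair; [exact: measurable_tnth|exact: measurable_behead].
exists (fun k => u @^-1` F k).
  by rewrite -preimage_bigcup -FT preimage_setT.
move=> k; have [mF Flt] := Foo k; split.
  by rewrite -[X in measurable X]setTI; exact: mu.
rewrite /lebesgue_cons /pushforward -comp_preimage.
by rewrite (_ : u \o _ = id)//; apply/funext => z /=; exact: uK.
Qed.

HB.instance Definition _ := Measure_isSigmaFinite.Build _ _ _ lebesgue_cons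
  lebesgue_cons_sigma_finite.

End step.

Fixpoint lebesgue_tuple n :
    {sigma_finite_measure set (n.-tuple (measurableTypeR R)) -> \bar R} :=
  match n with
  | 0 => @dirac _ (0.-tuple (measurableTypeR R)) [tuple] R
  | n'.+1 => lebesgue_cons (lebesgue_tuple n')
  end.

Lemma lebesgue_tuple_box n (Y : 'I_n -> set (measurableTypeR R)) :
  (forall i, measurable (Y i)) ->
  lebesgue_tuple n [set x | forall i, Y i (tnth x i)] =
    (\prod_(i < n) lebesgue_measure (Y i))%E.
Proof.
elim: n Y => [|n IHn] Y mY /=.
  by rewrite big_ord0 diracE mem_set// => -[].
rewrite big_ord_recl -(IHn (fun i => Y (lift ord0 i)))//.
rewrite -product_measure1E//; last first.
  rewrite (_ : [set _ | _] =
    \bigcap_(i in [set: 'I_n]) ((@tnth _ _)^~ i @^-1` Y (lift ord0 i))).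
    apply: fin_bigcap_measurable => [|i _]; first exact: finite_finset.
    by rewrite -[X in measurable X]setTI; exact: measurable_tnth.
  by apply/seteqP; split => z /= h i; [move=> _|]; exact: h.
rewrite /lebesgue_cons /pushforward /sfprod; congr (_ _).
apply/seteqP; split => -[a b] /=.
  by move=> h; split => [|i]; [exact: (h ord0)|have := h (lift ord0 i); rewrite tnthS].
by move=> [h0 h] i; case: (unliftP ord0 i) => [j|] -> //; rewrite tnthS.
Qed.

End lebesgue_tuple.

Section laws.
Context {disp} {Omega : measurableType disp} {R : realType}
  (P : probability Omega R).

(* [normal_prob m 0] is a junk value of the library, so the degenerate case
   is the Dirac mass at the mean. *)
Definition gaussian_law (m s : R) (Y : set R) : \bar R :=
  if s == 0 then \d_m Y else normal_prob m s Y.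

Definition gaussian_rv (X : Omega -> R) : Prop :=
  exists m s : R, 0 <= s /\
    forall Y : set R, measurable Y -> P (X @^-1` Y) = gaussian_law m s Y.

(* The product rule for subfamilies is the case [Y i = setT] for some i. *)
Definition mutually_independent (I : finType) (X : I -> Omega -> R) : Prop :=
  forall Y : I -> set R, (forall i, measurable (Y i)) ->
    P (\bigcap_(i in [set: I]) (X i @^-1` Y i)) =
      (\prod_(i : I) P (X i @^-1` Y i))%E.

Definition sigma_generated (I : Type) (D : set I) (X : I -> Omega -> R) :
    set (set Omega) :=
  <<s \bigcup_(i in D) preimage_set_system setT (X i) measurable >>.

Definition independent_systems (G1 G2 : set (set Omega)) : Prop :=
  forall A1 A2, G1 A1 -> G2 A2 -> P (A1 `&` A2) = (P A1 * P A2)%E.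

Definition product_system (G1 G2 : set (set Omega)) :
    set (set (Omega * Omega)) :=
  <<s [set A1 `*` A2 | A1 in G1 & A2 in G2] >>.

End laws.

Definition brownian_motion {disp} {Omega : measurableType disp} {R : realType}
    (P : probability Omega R) (d : nat) (B : 'I_d -> R -> {RV P >-> R}) : Prop :=
  [/\ {ae P, forall w, forall i, B i 0 w = 0},
      {ae P, forall w, forall i,
        {within `[0, +oo[, continuous (fun s => B i s w)}},
      forall (i : 'I_d) (s u : R), 0 <= s -> s < u ->
        forall Y : set R, measurable Y ->
          P ((fun w => B i u w - B i s w) @^-1` Y) =
            normal_prob 0 (Num.sqrt (u - s)) Y
    & forall (n : nat) (u : nat -> R), 0 <= u 0%N ->
        {homo u : j k / (j <= k)%N >-> j <= k} ->
        mutually_independent P (fun (ik : 'I_d * 'I_n) w =>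
          B ik.1 (u ik.2.+1) w - B ik.1 (u ik.2) w)].

Section fractional_sheet.
Context {R : realType} {d : nat} (H0 : R) (H : 'I_d -> R).

Local Notation spacetime := (measurableTypeR R * d.-tuple (measurableTypeR R))%type.

Definition fbm_cov (h s t : R) : R :=
  2^-1 * (`|t| `^ (2 * h) + `|s| `^ (2 * h) - `|t - s| `^ (2 * h)).

Definition alphaH : R :=
  H0 * (2 * H0 - 1) * \prod_(i < d) (H i * (2 * H i - 1)).

(* Both powers are negative; [0 `^ a = 0] for [a != 0], which only concerns a
   Lebesgue-null set. *)
Definition hkernel (p q : spacetime) : R :=
  `|(p.1 : R) - q.1| `^ (2 * H0 - 2) *
  \prod_(i < d) `|(tnth p.2 i : R) - tnth q.2 i| `^ (2 * H i - 2).

Definition lebesgue_spacetime : {sigma_finite_measure set spacetime -> \bar R} :=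
  sfprod (@lebesgue_measure R) (lebesgue_tuple R d).

Definition nonneg_times : set spacetime := [set p | 0 <= (p.1 : R)].

Definition hinner (phi psi : spacetime -> R) : \bar R :=
  (alphaH%:E *
   \int[sfprod lebesgue_spacetime lebesgue_spacetime]_(z in
       nonneg_times `*` nonneg_times)
     (phi z.1 * psi z.2 * hkernel z.1 z.2)%:E)%E.

Record rect := Rect {
  time_lo : R; time_hi : R;
  space_lo : d.-tuple R; space_hi : d.-tuple R;
  time_lo_ge0 : 0 <= time_lo;
  time_le : time_lo <= time_hi;
  space_le : forall i, tnth space_lo i <= tnth space_hi i }.

Definition rect_set (r : rect) : set spacetime :=
  [set p | (time_lo r < (p.1 : R) <= time_hi r) /\
     forall i, tnth (space_lo r) i < (tnth p.2 i : R) <= tnth (space_hi r) i].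

Record step := Step {
  step_size : nat;
  step_coef : 'I_step_size -> R;
  step_rect : 'I_step_size -> rect }.

Arguments step_coef : clear implicits.
Arguments step_rect : clear implicits.

Definition step_fun (f : step) (p : spacetime) : R :=
  \sum_(k < step_size f) step_coef f k * \1_(rect_set (step_rect f k)) p.

(* The corner of [(x, y]] whose coordinates are those of y on S and those of x
   off S. *)
Definition corner (x y : d.-tuple R) (S : {set 'I_d}) : d.-tuple R :=
  [tuple if i \in S then tnth y i else tnth x i | i < d].

Context {disp} {Omega : measurableType disp} (P : probability Omega R).

Definition increment (W : R -> d.-tuple R -> {RV P >-> R}) (r : rect)
    (w : Omega) : R :=
  \sum_(S : {set 'I_d}) (-1) ^+ #|~: S| *
    (W (time_hi r) (corner (space_lo r) (space_hi r) S) w -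
     W (time_lo r) (corner (space_lo r) (space_hi r) S) w).

Definition step_integral (W : R -> d.-tuple R -> {RV P >-> R}) (f : step)
    (w : Omega) : R :=
  \sum_(k < step_size f) step_coef f k * increment W (step_rect f k) w.

Definition fractional_brownian_sheet (W : R -> d.-tuple R -> {RV P >-> R}) :
    Prop :=
  [/\ forall (n : nat) (c s : 'I_n -> R) (x : 'I_n -> d.-tuple R),
        (forall k, 0 <= s k) ->
        gaussian_rv P (fun w => \sum_(k < n) c k * W (s k) (x k) w),
      forall s x, 0 <= s -> ('E_P[W s x] = 0)%E
    & forall s u x y, 0 <= s -> 0 <= u ->
        ('E_P[fun w => (W u x w * W s y w)%R] =
          (fbm_cov H0 s u *
           \prod_(i < d) fbm_cov (H i) (tnth x i) (tnth y i))%:E)%E].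

(* X is the value at phi of the isometric extension of
   [step_fun f |-> step_integral W f], for phi a function in the completion. *)
Definition wiener_integral (W : R -> d.-tuple R -> {RV P >-> R})
    (phi : spacetime -> R) (X : Omega -> R) : Prop :=
  [/\ measurable_fun nonneg_times phi,
      (hinner (fun p => `|phi p|%R) (fun p => `|phi p|%R) < +oo)%E,
      measurable_fun setT X
    & exists f : nat -> step,
        (fun n => hinner (fun p => step_fun (f n) p - phi p)
                         (fun p => step_fun (f n) p - phi p)) @ \oo --> 0%E /\
        (fun n => ('E_P[fun w => ((step_integral W (f n) w - X w) ^+ 2)%R])%E)
          @ \oo --> 0%E].

Definition heat_kernel (eps : R) (x : d.-tuple R) : R :=
  (2 * pi * eps) `^ (- (d%:R / 2)) *
  expR (- (\sum_(i < d) tnth x i ^+ 2) / (2 * eps)).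

Definition box_kernel (delta r : R) : R := delta^-1 * \1_(`[0, delta]) r.

(* [A^{eps,delta}_{t,x}(r,y)] along the path w of B; [tnth x i + B i s w] are
   the coordinates of [B^x_s]. *)
Definition mollified_delta (B : 'I_d -> R -> {RV P >-> R}) (t : R)
    (x : d.-tuple R) (eps delta : R) (w : Omega) (r : R) (y : d.-tuple R) : R :=
  \int[@lebesgue_measure R]_(s in `[0, t])
    (box_kernel delta (t - s - r) *
     heat_kernel eps [tuple B i s w + tnth x i - tnth y i | i < d]).

Definition sigma_sheet (W : R -> d.-tuple R -> {RV P >-> R}) :
    set (set Omega) :=
  sigma_generated [set p : R * d.-tuple R | 0 <= p.1] (fun p => W p.1 p.2).

Definition sigma_motion (B : 'I_d -> R -> {RV P >-> R}) : set (set Omega) :=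
  sigma_generated [set p : 'I_d * R | 0 <= p.2] (fun p => B p.1 p.2).

(* The integral with respect to W is taken for fixed B: [F w w'] is, for almost
   every w', the Wiener integral evaluated at w of the integrand built from the
   path [B(w')], jointly measurable in (W, B); then w' is set equal to w.  As W
   and B are independent, X does not depend, up to null sets, on the version
   F. *)
Definition regularized_integral (W : R -> d.-tuple R -> {RV P >-> R})
    (B : 'I_d -> R -> {RV P >-> R}) (t : R) (x : d.-tuple R) (eps delta : R)
    (X : Omega -> R) : Prop :=
  exists F : Omega -> Omega -> R,
    [/\ forall Y : set R, measurable Y ->
          product_system (sigma_sheet W) (sigma_motion B)
            ((fun ww => F ww.1 ww.2) @^-1` Y),
        {ae P, forall w', wiener_integral W
          (fun p => \1_(`[0, t]) (p.1 : R) *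
             mollified_delta B t x eps delta w' p.1 p.2) (F ^~ w')}
      & {ae P, forall w, X w = F w w}].

Definition delta_integral (W : R -> d.-tuple R -> {RV P >-> R})
    (B : 'I_d -> R -> {RV P >-> R}) (t : R) (x : d.-tuple R)
    (V : Omega -> R) : Prop :=
  exists Veps : R -> R -> {RV P >-> R},
    (forall eps delta, 0 < eps -> 0 < delta ->
       regularized_integral W B t x eps delta (Veps eps delta)) /\
    (fun ed : R * R => ('E_P[fun w => ((Veps ed.1 ed.2 w - V w) ^+ 2)%R])%E)
      @ filter_prod (0 : R)^'+ (0 : R)^'+ --> 0%E.

End fractional_sheet.

(* Main.v *)
(* Given B, the regularized integral is an L2 limit of centered Gaussian step
   integrals, so its exponential moments are controlled by its conditional
   variance.  Integrating a power singularity against a probability density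
   spread over a scale eta truncates the singularity at eta; hence the variance
   is at most a constant times the integral over [0,t]^2 of
     max(|r-s|,delta)^(2H_0-2) prod_i max(|B^i_r-B^i_s|,sqrt eps)^(2H_i-2),
   which is the limit of its Riemann sums of mesh h.  By Jensen's inequality the
   exponential moments of such a sum are bounded by those of h (g_1+...+g_n),
   where g_k is the kernel evaluated at the increment of B over [jh,(j+k)h].
   Since E|a+B_s|^(-b) <= C s^(-b/2) uniformly in a, the conditional mean of g_k
   given the path up to step l < k is at most C ((k-l)h)^(-gamma), where
   gamma = 2-2H_0 + sum_i (1-H_i) < 1.  Expanding exp(h (g_l+...+g_n)) along its
   first factor and iterating from the end, against the weight e^(mu k h) with mu
   large, bounds its mean uniformly in eps, delta and h.  The bound survives the
   passage to the L2 limit. *)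
From HB Require Import structures.
Require Import Defs.
From mathcomp Require Import all_boot all_order all_algebra.
From mathcomp Require Import all_classical all_reals all_analysis.
From mathcomp Require Import measurable_realfun.
From mathcomp Require Import ring lra zify.
Set Implicit Arguments.
Unset Strict Implicit.
Unset Printing Implicit Defensive.
Import Order.TTheory GRing.Theory Num.Theory.
Import numFieldNormedType.Exports.
Local Open Scope ring_scope.
Local Open Scope classical_set_scope.

(** The Hilbert space is never built. A Wiener integral only comes with step functions close to the
    integrand in the form [hinner], so bounding their variances requires
    [|f|^2 <= 2 |f - h|^2 + 2 |h|^2] for signed functions, hence positivity of the form; this is why
    the singular kernel is factored as an integral of nonnegative products. Brownian scaling turns a
    spatial singularity of order 2 - 2H_i into a temporal one of order 1 - H_i, so the hypothesis on
    the indices says exactly gamma < 1. A small value of the integral of s^(-gamma) would close the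
    iteration on a short interval only; the weight makes the discounted integral small on all of
    [0,t]. Linearizing the exponential needs every term h g_k to be at most 1, which fails for the
    bare kernel; truncation makes it true once h is small, with a threshold depending on eps and
    delta while the bound does not. Fixing B is expressed through the product of two generated
    sigma-algebras. *)

(** * Power singularities on the line *)

(* No measurability is needed, in contrast to [ge0_le_integral]. *)
Lemma ge0_le_integralT d (T : measurableType d) (R : realType) (m : {measure set T -> \bar R})
    (f g : T -> \bar R) : (forall x, 0 <= f x)%E -> (forall x, f x <= g x)%E ->
  (\int[m]_x f x <= \int[m]_x g x)%E.
Proof.
move=> f0 fg; have g0 x : (0 <= g x)%E by exact: le_trans (fg x).
rewrite !ge0_integralTE//; apply: ge_ereal_sup => _ [h hf <-].
by apply: ereal_sup_ubound; exists h => // x; exact: le_trans (fg x).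
Qed.

Lemma ge0_le_integral_in d (T : measurableType d) (R : realType) (m : {measure set T -> \bar R})
    (D : set T) (f g : T -> \bar R) :
  (forall x, D x -> 0 <= f x)%E -> (forall x, D x -> f x <= g x)%E ->
  (\int[m]_(x in D) f x <= \int[m]_(x in D) g x)%E.
Proof.
move=> f0 fg; rewrite integral_mkcond [leRHS]integral_mkcond.
by apply: ge0_le_integralT => x; rewrite !patchE; case: ifPn => // /set_mem; [exact: f0|exact: fg].
Qed.

Lemma integral_mulr_indic d (T : measurableType d) (R : realType)
    (m : {measure set T -> \bar R}) (D : set T) (f : T -> R) :
  (\int[m]_x (f x * \1_D x)%:E = \int[m]_(x in D) (f x)%:E)%E.
Proof.
rewrite [RHS]integral_mkcond; apply: eq_integral => x _.
by rewrite patchE indicE; case: (x \in D); rewrite ?mulr1 ?mulr0.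
Qed.

Section powint.
Context {R : realType}.
Local Notation mu := (@lebesgue_measure R).

(** The integrand may blow up at both ends. The fundamental theorem is applied on closed intervals
    exhausting the open one; nonnegativity gives monotone convergence on the left, continuity of [F]
    gives the limit on the right. *)
Lemma ge0_FTC2_oo (f F : R -> R) (p q : R) : p < q ->
  measurable_fun setT f -> continuous F ->
  (forall x, p < x < q -> 0 <= f x) ->
  (forall x, p < x < q -> {for x, continuous f}) ->
  (forall x, p < x < q -> is_derive x 1 F (f x)) ->
  (\int[mu]_(x in `]p, q[) (f x)%:E = (F q - F p)%:E)%E.
Proof.
move=> pq mf cF f0 cf dF.
(* The factor 1/4 keeps every [[p + e n, q - e n]] nondegenerate, even for [n = 0]. *)
pose e (n : nat) := (q - p) / 4 * n.+1%:R^-1.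
have e0 n : 0 < e n by rewrite mulr_gt0 ?invr_gt0// divr_gt0// subr_gt0.
have ele n : e n <= (q - p) / 4.
  rewrite /e ler_piMr// ?divr_ge0// ?subr_ge0 ?(ltW pq)//.
  by rewrite invf_le1// ler1n.
have ecvg : e n @[n --> \oo] --> 0.
  rewrite -[X in _ --> X](mulr0 ((q - p) / 4)).
  by apply: cvgMr; exact: cvg_harmonic.
pose G (n : nat) : set R := `[p + e n, q - e n]%classic.
have GE : \bigcup_n G n = `]p, q[%classic.
  apply/seteqP; split => x /=.
    move=> [n _]; rewrite /G/= !in_itv/= => /andP[h1 h2].
    by have := e0 n; move=> ?; apply/andP; split; lra.
  rewrite in_itv/= => /andP[px xq].
  have m0 : 0 < Num.min (x - p) (q - x) by rewrite lt_min !subr_gt0 px.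
  have /cvgrPdist_lt/(_ _ m0)[N _ HN] := ecvg.
  exists N => //; rewrite /G/= in_itv/=.
  have := HN N (leqnn N); rewrite /= sub0r normrN gtr0_norm//.
  by rewrite lt_min => /andP[? ?]; apply/andP; split; lra.
have sub n x : p + e n <= x <= q - e n -> p < x < q.
  by move=> /andP[? ?]; have := e0 n; move=> ?; apply/andP; split; lra.
have IG n : (\int[mu]_(x in G n) (f x)%:E = (F (q - e n))%:E - (F (p + e n))%:E)%E.
  have lt1 : p + e n < q - e n by have := ele n; have := e0 n; lra.
  apply: (@continuous_FTC2 _ f) => //.
  - apply: continuous_in_subspaceT => x; rewrite inE/= in_itv/= => /sub.
    exact: cf.
  - split.
    + move=> x; rewrite in_itv/= => /andP[h1 h2].
      have xx : p < x < q by apply: (@sub n); rewrite !ltW.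
      by have := dF _ xx; case.
    + exact/cvg_at_right_filter/cF.
    + exact/cvg_at_left_filter/cF.
  - move=> x; rewrite in_itv/= => /andP[h1 h2].
    have xx : p < x < q by apply: (@sub n); rewrite !ltW.
    by have := dF _ xx; case=> _ h; rewrite derive1E.
have c1 : (\int[mu]_(x in G n) (f x)%:E)%E @[n --> \oo] --> (\int[mu]_(x in `]p, q[) (f x)%:E)%E.
  rewrite -GE; apply: ge0_nondecreasing_set_cvg_integral.
  - move=> m n mn; rewrite subsetEset => x; rewrite /G/= !in_itv/=.
    have : e n <= e m.
      rewrite /e ler_pM2l ?divr_gt0 ?subr_gt0// lef_pV2 ?posrE//.
      by rewrite ler_nat ltnS.
    by move=> ? /andP[? ?]; apply/andP; split; lra.
  - by move=> i; exact: measurable_itv.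
  - by move=> i; apply/measurable_EFinP; exact: measurable_funTS.
  - move=> i x; rewrite /G/= in_itv/= => /sub h; rewrite lee_fin; exact: f0.
have c2 : (\int[mu]_(x in G n) (f x)%:E)%E @[n --> \oo] --> (F q - F p)%:E.
  under eq_fun do rewrite IG -EFinB.
  apply: cvg_EFin; first by near=> n.
  apply: cvgB; apply: continuous_cvg; try exact: cF.
    by rewrite -[X in _ --> X]subr0; apply: cvgB => //; exact: cvg_cst.
  by rewrite -[X in _ --> X]addr0; apply: cvgD => //; exact: cvg_cst.
exact: (cvg_unique _ c1 c2).
Unshelve. all: by end_near. Qed.

Lemma is_derive1_mull (c x df : R) (f : R -> R) :
  is_derive x 1 f df -> is_derive x 1 (fun y => c * f y) (c * df).
Proof. by move=> h; exact: is_deriveZ. Qed.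

Lemma near_is_derive1 (f g : R -> R) (x df : R) :
  (\forall y \near x, f y = g y) -> is_derive x 1 f df -> is_derive x 1 g df.
Proof.
move=> fg [d1 d2]; split; first exact: near_eq_derivable d1.
by rewrite -d2; apply: near_eq_derive; near=> y; apply/esym; near: y.
Unshelve. all: by end_near. Qed.

(** Odd primitive of [|x|^a] vanishing at 0, for [a > -1]. *)
Definition pow_prim (a x : R) : R :=
  if 0 <= x then (a + 1)^-1 * x `^ (a + 1) else - ((a + 1)^-1 * (- x) `^ (a + 1)).

(** Even primitive of [pow_prim a]; for [a = 2h - 2] it is a multiple of [|x|^(2h)], the building
    block of fractional covariances. *)
Definition pow_prim2 (a x : R) : R := ((a + 1) * (a + 2))^-1 * `|x| `^ (a + 2).

Lemma pow_primN (a x : R) : -1 < a -> pow_prim a (- x) = - pow_prim a x.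
Proof.
move=> a1; rewrite /pow_prim oppr_ge0.
have [x0|x0|->] := ltgtP x 0; rewrite ?opprK//.
by rewrite oppr0 powR0 ?mulr0 ?oppr0// gt_eqF//; lra.
Qed.

Lemma near0_powR (a : R) : 0 < a -> forall e : R, 0 < e -> exists2 r : R, 0 < r &
  forall x : R, `|x| < r -> `|x| `^ a < e.
Proof.
move=> a0 e e0; exists (e `^ a^-1) => [|x xr]; first exact: powR_gt0.
have [->|x0] := eqVneq `|x| 0; first by rewrite powR0// gt_eqF.
have -> : e = (e `^ a^-1) `^ a.
  by rewrite -powRrM mulVf ?gt_eqF// powRr1// ltW.
by apply: gt0_ltr_powR; rewrite ?nnegrE// ?powR_ge0.
Qed.

Lemma is_derive_pow_prim (a x : R) : -1 < a -> x != 0 ->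
  is_derive x 1 (pow_prim a) (`|x| `^ a).
Proof.
move=> a1; rewrite neq_lt => /orP[x0|x0].
- have y0 : 0 < - x by rewrite oppr_gt0.
  have : is_derive x 1 (fun y => - (a + 1)^-1 * (- y) `^ (a + 1)) (`|x| `^ a).
    have h1 := is_derive1_powR (a + 1) y0.
    have h2 : is_derive x 1 (fun y : R => - y) (- 1).
      exact: (is_deriveN (f := id)).
    have h3 : is_derive x 1 (fun y : R => (- y) `^ (a + 1))
        ((a + 1) * (- x) `^ (a + 1 - 1) * (- 1)).
      exact: (@is_derive1_comp _ (fun z => z `^ (a + 1)) (fun y => - y)).
    apply: (is_derive_eq (is_derive1_mull (- (a + 1)^-1) h3)).
    rewrite addrK ltr0_norm// /GRing.scale/= mulrN1 mulrNN mulrA mulVf ?mul1r// gt_eqF//; lra.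
  apply: near_is_derive1; near=> y; rewrite /pow_prim leNgt ifN ?mulNr// negbK.
    by near: y; exact: lt_nbhsl.
- have : is_derive x 1 (fun y => (a + 1)^-1 * y `^ (a + 1)) (`|x| `^ a).
    have h1 := is_derive1_powR (a + 1) x0.
    have h2 : is_derive x 1 (fun y => (a + 1)^-1 * y `^ (a + 1))
       ((a + 1)^-1 *: ((a + 1) * x `^ (a + 1 - 1))) by exact: is_deriveZ.
    move: h2; rewrite addrK gtr0_norm// /GRing.scale/= mulrA mulVf ?mul1r// gt_eqF//; lra.
  apply: near_is_derive1; near=> y; rewrite /pow_prim ifT// ltW//.
    by near: y; exact: lt_nbhsr.
Unshelve. all: by end_near. Qed.

Lemma norm_pow_prim (a x : R) : -1 < a -> `|pow_prim a x| = (a + 1)^-1 * `|x| `^ (a + 1).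
Proof.
move=> a1; have a0 : 0 <= (a + 1)^-1 by rewrite invr_ge0; lra.
rewrite /pow_prim; case: ifPn => x0.
  by rewrite normrM !ger0_norm// powR_ge0.
move: x0; rewrite -ltNge => x0.
by rewrite normrN normrM (ltr0_norm x0) !ger0_norm// powR_ge0.
Qed.

Lemma pow_prim0 (a : R) : -1 < a -> pow_prim a 0 = 0.
Proof.
move=> a1; apply/eqP; rewrite -normr_eq0 norm_pow_prim// normr0 powR0 ?mulr0//.
by rewrite gt_eqF//; lra.
Qed.

Lemma continuous_pow_prim (a : R) : -1 < a -> continuous (pow_prim a).
Proof.
move=> a1 x; have [->|x0] := eqVneq x 0; last first.
  by apply: differentiable_continuous; apply/derivable1_diffP; case: (is_derive_pow_prim a1 x0).
apply/cvgrPdist_lt; rewrite pow_prim0// => e e0.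
have a2 : 0 < a + 1 by lra.
have [r r0 hr] := near0_powR a2 (mulr_gt0 a2 e0).
near=> y; rewrite sub0r normrN norm_pow_prim// mulrC ltr_pdivrMr// mulrC.
apply: hr; near: y; exact: (@nbhs0_lt R R^o).
Unshelve. all: by end_near. Qed.

Lemma is_derive_pow_prim2 (a x : R) : -1 < a ->
  is_derive x 1 (pow_prim2 a) (pow_prim a x).
Proof.
move=> a1; have [->|x0] := eqVneq x 0.
  have Q0 : pow_prim2 a 0 = 0.
    by rewrite /pow_prim2 normr0 powR0 ?mulr0// gt_eqF//; lra.
  rewrite pow_prim0//.
  (* The difference quotient at 0 has modulus [|h|^(a+1) / ((a+1)(a+2))], and [a + 1 > 0]. *)
  have H : (fun h : R => h^-1 *: (pow_prim2 a (h + 0) - pow_prim2 a 0)) @ 0^' --> (0 : R).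
    apply/cvgrPdist_lt => e e0.
    have a2 : 0 < a + 1 by lra.
    have a3 : 0 < (a + 1) * (a + 2) by rewrite mulr_gt0//; lra.
    have [r r0 hr] := near0_powR a2 (mulr_gt0 a3 e0).
    near=> h.
    have h0 : h != 0 by near: h; exact: nbhs_dnbhs_neq.
    have hp : 0 < `|h| by rewrite normr_gt0.
    rewrite sub0r normrN Q0 subr0 addr0 /GRing.scale/= normrM normfV /pow_prim2.
    rewrite normrM (ger0_norm (powR_ge0 _ _)).
    have -> : `|h| `^ (a + 2) = `|h| `^ (a + 1) * `|h|.
      rewrite -{3}(powRr1 (ltW hp)) -powRD ?(gt_eqF hp) ?implybT//.
      by congr (_ `^ _); ring.
    rewrite ger0_norm ?invr_ge0 ?(ltW a3)//; set z := _ `^ _.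
    have -> : `|h|^-1 * (((a + 1) * (a + 2))^-1 * (z * `|h|)) = z / ((a + 1) * (a + 2)).
      by field; rewrite !gt_eqF//; lra.
    rewrite ltr_pdivrMr// mulrC; apply: hr.
    near: h; apply: dnbhs0_lt.
    exact: r0.
  split.
    rewrite /derivable; apply/cvg_ex; exists 0.
    by under eq_fun do rewrite /GRing.scale/= mulr1.
  rewrite /derive; apply/cvg_lim => //.
  by under eq_fun do rewrite /GRing.scale/= mulr1.
have e1 : a + 2 - 1 = a + 1 by ring.
have nz : a + 2 != 0 by rewrite gt_eqF//; lra.
have nz1 : a + 1 != 0 by rewrite gt_eqF//; lra.
move: x0; rewrite neq_lt => /orP[x0|x0].
- have y0 : 0 < - x by rewrite oppr_gt0.
  have : is_derive x 1 (fun y => ((a + 1) * (a + 2))^-1 * (- y) `^ (a + 2)) (pow_prim a x).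
    have h1 := is_derive1_powR (a + 2) y0.
    have h2 : is_derive x 1 (fun y : R => - y) (- 1).
      exact: (is_deriveN (f := id)).
    have h3 : is_derive x 1 (fun y : R => (- y) `^ (a + 2))
        ((a + 2) * (- x) `^ (a + 2 - 1) * (- 1)).
      exact: (@is_derive1_comp _ (fun z => z `^ (a + 2)) (fun y => - y)).
    apply: (is_derive_eq (is_derive1_mull ((a + 1) * (a + 2))^-1 h3)).
    rewrite e1 /GRing.scale/= /pow_prim leNgt x0/=.
    by rewrite invfM; field; rewrite nz nz1.
  apply: near_is_derive1; near=> y; rewrite /pow_prim2 ltr0_norm//.
    by near: y; exact: lt_nbhsl.
- have : is_derive x 1 (fun y => ((a + 1) * (a + 2))^-1 * y `^ (a + 2)) (pow_prim a x).
    have h1 := is_derive1_powR (a + 2) x0.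
    apply: (is_derive_eq (is_derive1_mull ((a + 1) * (a + 2))^-1 h1)).
    rewrite e1 /GRing.scale/= /pow_prim ltW//=.
    by rewrite invfM; field; rewrite nz nz1.
  apply: near_is_derive1; near=> y; rewrite /pow_prim2 gtr0_norm//.
    by near: y; exact: lt_nbhsr.
Unshelve. all: by end_near. Qed.


Lemma measurable_powR_dist (a u : R) : measurable_fun setT (fun v : R => `|v - u| `^ a).
Proof.
apply: (measurableT_comp (f := @powR R ^~ a)) => //.
by apply: (measurableT_comp (f := @Num.norm R R)) => //; exact: measurable_funB.
Qed.

Lemma measurable_powR_dist2 (a : R) :
  measurable_fun setT (fun z : R * R => `|z.1 - z.2| `^ a).
Proof.
apply: (measurableT_comp (f := @powR R ^~ a)) => //.
by apply: (measurableT_comp (f := @Num.norm R R)) => //; exact: measurable_funB.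
Qed.

Lemma is_derive_shift (f : R -> R) (u x df : R) :
  is_derive (x - u) 1 f df -> is_derive x 1 (fun v => f (v - u)) df.
Proof.
move=> h; rewrite -[df]mulr1; apply: (@is_derive1_comp _ f (fun v => v - u)) => //.
by apply: is_derive_eq; rewrite subr0.
Qed.

Lemma continuous_shift (f : R -> R) (u : R) :
  continuous f -> continuous (fun v => f (v - u)).
Proof.
move=> cf x; apply: continuous_comp; last exact: cf.
by apply: cvgB; [exact: cvg_id|exact: cvg_cst].
Qed.

(** The interval is cut at [u] when it contains it, so that each piece has the singularity at most
    at an endpoint, where [ge0_FTC2_oo] tolerates it. *)
Lemma integral_powR_dist (a u p q : R) : -1 < a -> p <= q ->
  (\int[mu]_(v in `]p, q]) (`|v - u| `^ a)%:E =
   (pow_prim a (q - u) - pow_prim a (p - u))%:E)%E.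
Proof.
move=> a1.
have mf := measurable_powR_dist a u.
have noin p' q' : p' <= q' -> (u <= p') || (q' <= u) ->
    (\int[mu]_(v in `]p', q']) (`|v - u| `^ a)%:E =
     (pow_prim a (q' - u) - pow_prim a (p' - u))%:E)%E.
  rewrite le_eqVlt => /predU1P[-> _|pq up].
    by rewrite subrr set_itvoc0 integral_set0.
  have nz x : p' < x < q' -> x - u != 0.
    move=> /andP[px xq]; move: up => /orP[h|h]; [rewrite gt_eqF//|rewrite lt_eqF//]; lra.
  rewrite -integral_itv_bndo_bndc; last first.
    by apply/measurable_EFinP; exact: measurable_funTS.
  apply: (@ge0_FTC2_oo (fun v => `|v - u| `^ a) (fun v => pow_prim a (v - u))) => //.
  - by apply: continuous_shift; exact: continuous_pow_prim.
  - move=> x /nz xu; have xu0 : 0 < `|x - u| by rewrite normr_gt0.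
    apply: (@continuous_comp _ _ _ (fun v => `|v - u|) (fun y : R => y `^ a)).
      apply: continuous_comp; last exact: norm_continuous.
      by apply: cvgB; [exact: cvg_id|exact: cvg_cst].
    apply: differentiable_continuous; apply/derivable1_diffP.
    by case: (is_derive1_powR a xu0).
  - by move=> x /nz xu; apply: is_derive_shift; exact: is_derive_pow_prim.
move=> pq; have [up|pu] := leP u p; first by apply: noin => //; rewrite up.
have [qu|uq] := leP q u; first by apply: noin => //; rewrite qu orbT.
rewrite (@itv_bndbnd_setU _ _ _ (BRight u))//; last 2 first.
  by rewrite bnd_simp ltW.
  by rewrite bnd_simp ltW.
rewrite ge0_integral_setU//=; last 2 first.
- by apply/measurable_EFinP; exact: measurable_funTS.
- apply/disj_set2P/seteqP; split=> // x [] /=.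
  by rewrite !in_itv/= => /andP[_ ?] /andP[? _]; lra.
rewrite !noin ?lexx ?orbT//; try exact: ltW.
by rewrite -EFinD; congr EFin; ring.
Qed.

Lemma integral2_powR_dist (a p q c e : R) : -1 < a -> p <= q -> c <= e ->
  (\int[mu]_(u in `]p, q]) \int[mu]_(v in `]c, e]) (`|u - v| `^ a)%:E =
   (pow_prim2 a (q - c) - pow_prim2 a (p - c)
    - pow_prim2 a (q - e) + pow_prim2 a (p - e))%:E)%E.
Proof.
move=> a1 pq ce.
have inner u : (\int[mu]_(v in `]c, e]) (`|u - v| `^ a)%:E =
    (pow_prim a (u - c) - pow_prim a (u - e))%:E)%E.
  under eq_integral do rewrite distrC.
  rewrite integral_powR_dist// -(opprB u e) -(opprB u c) !pow_primN//.
  by congr EFin; ring.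
under eq_integral do rewrite inner.
have i0 u : 0 <= pow_prim a (u - c) - pow_prim a (u - e).
  by rewrite -lee_fin -inner integral_ge0// => ? _; rewrite lee_fin powR_ge0.
have cs w : continuous (fun u => pow_prim a (u - w)).
  by apply: continuous_shift; exact: continuous_pow_prim.
have cs2 w : continuous (fun u => pow_prim2 a (u - w)).
  apply: continuous_shift => x; apply: differentiable_continuous.
  by apply/derivable1_diffP; case: (is_derive_pow_prim2 x a1).
have cd : continuous (fun u => pow_prim a (u - c) - pow_prim a (u - e)).
  by move=> x; apply: cvgB; exact: cs.
have mf : measurable_fun setT (fun u : R => pow_prim a (u - c) - pow_prim a (u - e)).
  exact: continuous_measurable_fun.
move: pq; rewrite le_eqVlt => /predU1P[->|pq].
  by rewrite set_itvoc0 integral_set0; congr EFin; ring.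
rewrite -integral_itv_bndo_bndc; last first.
  by apply/measurable_EFinP; exact: measurable_funTS.
transitivity (pow_prim2 a (q - c) - pow_prim2 a (q - e) -
    (pow_prim2 a (p - c) - pow_prim2 a (p - e)))%:E; last by congr EFin; ring.
apply: (@ge0_FTC2_oo (fun u => pow_prim a (u - c) - pow_prim a (u - e))
  (fun u => pow_prim2 a (u - c) - pow_prim2 a (u - e))) => //.
- by move=> x; apply: cvgB; exact: cs2.
- by move=> x _; exact: cd.
- move=> x _; apply: is_deriveB; apply: is_derive_shift; exact: is_derive_pow_prim2.
Qed.

Lemma powRD_gt0 (x r s : R) : 0 < x -> x `^ (r + s) = x `^ r * x `^ s.
Proof. by move=> x0; rewrite powRD// (gt_eqF x0) implybT. Qed.

Lemma powR_le_neg (b x y : R) : 0 <= b -> 0 < x -> x <= y -> y `^ (- b) <= x `^ (- b).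
Proof.
move=> b0 x0 xy; have y0 := lt_le_trans x0 xy.
rewrite !powRN lef_pV2 ?posrE ?powR_gt0//.
by apply: ge0_ler_powR => //; rewrite nnegrE ltW.
Qed.

(** The summands come from the far and the near part of the integral in [smoothing]: [(m/2)^(-b)]
    times a mass at most 1, and [2/m] times the integral of the singularity over an interval of
    radius [m/2]. *)
Definition smooth_const (b : R) : R := 2 `^ b * (1 + 2 / (1 - b)).

Lemma smooth_const_gt0 (b : R) : b < 1 -> 0 < smooth_const b.
Proof. by move=> b1; rewrite mulr_gt0 ?powR_gt0// addr_gt0// divr_gt0// subr_gt0. Qed.

(** Let [m = max(|x - y|, eta)]. Where [|r - y| >= m/2] the power is at most [(m/2)^(-b)]; elsewhere
    [rho <= 2/m], either because [rho <= 1/eta] or, by the triangle inequality, because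
    [|r - x| >= m/2]. The bounds on [rho] are the scale-free facts shared by the Gaussian density
    and the uniform density of an interval. *)
Lemma smoothing (b eta x y : R) (rho : R -> R) : 0 < b < 1 -> 0 < eta ->
  measurable_fun setT rho -> (forall r, 0 <= rho r) ->
  (\int[mu]_r (rho r)%:E <= 1)%E ->
  (forall r, rho r * `|r - x| <= 1) -> (forall r, rho r * eta <= 1) ->
  (\int[mu]_r (rho r * `|r - y| `^ (- b))%:E <=
   (smooth_const b * Num.max `|x - y| eta `^ (- b))%:E)%E.
Proof.
move=> /andP[b0 b1] eta0 mrho rho0 rho1 rhox rhoeta.
set m := Num.max _ _.
have m0 : 0 < m by rewrite /m lt_max eta0 orbT.
have b0' := ltW b0.
have bm1 : -1 < - b by lra.
set J := `]y - m / 2, y + m / 2]%classic.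
have J0 r : 0 <= `|r - y| `^ (- b) * \1_J r by rewrite mulr_ge0// powR_ge0.
have pw r : rho r * `|r - y| `^ (- b) <= (m / 2) `^ (- b) * rho r +
    2 / m * (`|r - y| `^ (- b) * \1_J r).
  have [far|near] := leP (m / 2) `|r - y|.
    rewrite mulrC -[leLHS]addr0; apply: lerD.
      by apply: ler_wpM2r => //; apply: powR_le_neg => //; lra.
    by apply: mulr_ge0; [rewrite divr_ge0// ltW|rewrite mulr_ge0// powR_ge0].
  have rJ : J r.
    move: near; rewrite /J/= in_itv/= ltr_norml => /andP[? ?].
    by apply/andP; split; lra.
  rewrite indicE mem_set// mulr1 -[leLHS]add0r; apply: lerD.
    by rewrite mulr_ge0// powR_ge0.
  apply: ler_wpM2r; first exact: powR_ge0.
  rewrite ler_pdivlMr//; have [xe|xe] := leP `|x - y| eta.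
    by rewrite /m (max_idPr xe); have := rhoeta r; lra.
  have mE : m = `|x - y| by rewrite /m (max_idPl (ltW xe)).
  have : `|x - y| <= `|r - x| + `|r - y|.
    by rewrite (distrC r x) (le_trans _ (ler_normD _ _))// subrKA.
  rewrite -mE => tri.
  have := ler_wpM2l (rho0 r) (_ : m / 2 <= `|r - x|).
  have := rhox r; move=> h1 h2; have := h2 ltac:(lra); lra.
have mJ : measurable_fun setT (\1_J : R -> R) by apply: measurable_indic; exact: measurable_itv.
have mp := measurable_powR_dist (- b) y.
apply: (@le_trans _ _ (\int[mu]_r ((m / 2) `^ (- b) * rho r +
    2 / m * (`|r - y| `^ (- b) * \1_J r))%:E)%E).
  by apply: ge0_le_integralT => r; rewrite lee_fin// mulr_ge0// powR_ge0.
under eq_integral do rewrite EFinD.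
rewrite ge0_integralD//; last 4 first.
- by move=> r _; rewrite lee_fin mulr_ge0// powR_ge0.
- by apply/measurable_EFinP; exact: measurable_funM.
- by move=> r _; rewrite lee_fin; apply: mulr_ge0; [rewrite divr_ge0// ltW|exact: J0].
- by apply/measurable_EFinP; apply: measurable_funM => //; exact: measurable_funM.
have -> : (smooth_const b * m `^ (- b))%:E =
    ((m / 2) `^ (- b) * 1 +
     2 / m * (pow_prim (- b) (y + m / 2 - y) - pow_prim (- b) (y - m / 2 - y)))%:E.
  have -> : y + m / 2 - y = m / 2 by ring.
  have -> : y - m / 2 - y = - (m / 2) by ring.
  have m2 : 0 < m / 2 by rewrite divr_gt0.
  rewrite pow_primN// /pow_prim (ltW m2) (_ : - b + 1 = 1 - b); last by ring.
  have -> : (m / 2) `^ (1 - b) = m / 2 * (m / 2) `^ (- b).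
    by rewrite powRD_gt0// powRr1// ltW.
  have -> : (m / 2) `^ (- b) = 2 `^ b * m `^ (- b).
    by rewrite powRM ?invr_ge0 ?ltW// -powR_inv1// -powRrM mulN1r opprK mulrC.
  rewrite /smooth_const; congr EFin; field.
  by rewrite (gt_eqF m0) andbT gt_eqF//; lra.
rewrite EFinD; apply: leeD.
  under eq_integral do rewrite EFinM.
  rewrite ge0_integralZl_EFin//; last 3 first.
  - by move=> r _; rewrite lee_fin.
  - exact/measurable_EFinP.
  - exact: powR_ge0.
  by rewrite EFinM lee_wpmul2l// lee_fin powR_ge0.
under eq_integral do rewrite EFinM.
rewrite ge0_integralZl_EFin//; last 2 first.
- by apply/measurable_EFinP; exact: measurable_funM.
- by rewrite divr_ge0// ltW.
rewrite integral_mulr_indic /J integral_powR_dist//; last by lra.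

Qed.

(** By concavity each term is at most the increment of [x^(1-g) / (1-g)] over its cell; in the form
    used here this is the weighted inequality [x^g y^(1-g) <= g x + (1-g) y]. *)
Lemma sum_powR_le (g h : R) (n : nat) : 0 < g < 1 -> 0 < h ->
  \sum_(1 <= m < n.+1) h * (m%:R * h) `^ (- g) <= (n%:R * h) `^ (1 - g) / (1 - g).
Proof.
move=> /andP[g0 g1] h0; have g1' : 0 < 1 - g by lra.
elim: n => [|n IH].
  by rewrite big_geq// divr_ge0 ?powR_ge0// ltW.
rewrite big_nat_recr//= -lerBrDr (le_trans IH)//.
set x := n.+1%:R * h; set y := n%:R * h.
have x0 : 0 < x by rewrite mulr_gt0.
have y0 : 0 <= y by rewrite mulr_ge0// ltW.
have xy : h = x - y by rewrite /x /y -mulrBl -natr1; ring.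
rewrite ler_pdivrMr// mulrBl divfK ?gt_eqF//.
have young : x `^ g * y `^ (1 - g) <= g * x + (1 - g) * y.
  have := @conjugate_powR _ (x `^ g) (y `^ (1 - g)) g^-1 (1 - g)^-1.
  rewrite !invr_gt0 !invrK -!powRrM !mulfV ?gt_eqF// (powRr1 (ltW x0)) (powRr1 y0).
  move=> /(_ (powR_ge0 _ _) (powR_ge0 _ _) g0 g1'); rewrite addrC subrK.
  by move=> /(_ erefl); rewrite (mulrC x) (mulrC y).
have -> : x `^ (1 - g) = x * x `^ (- g).
  by rewrite powRD_gt0// powRr1// ltW.
have xg : y `^ (1 - g) = x `^ (- g) * (x `^ g * y `^ (1 - g)).
  by rewrite mulrA -powRD_gt0// addNr powRr0 mul1r.
rewrite xg xy.
have := ler_wpM2l (powR_ge0 x (- g)) young; nra.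
Qed.

Lemma expRN_le_powR (e x : R) : 0 < e <= 1 -> 0 < x -> expR (- x) <= x `^ (- e).
Proof.
move=> /andP[e0 e1] x0; rewrite expRN powRN lef_pV2 ?posrE ?expR_gt0 ?powR_gt0//.
have [x1|x1] := leP 1 x.
  rewrite (le_trans (ler1_powR x1 e1))//.
  by rewrite (le_trans _ (expR_ge1Dx x))// lerDr.
rewrite (@le_trans _ _ 1)//; last by rewrite -expR0 ler_expR ltW.
have <- : 1 `^ e = 1 :> R by rewrite powR1.
by apply: ge0_ler_powR; rewrite ?nnegrE// ltW.
Qed.

(** Half of the slack in [g < 1] is spent: [expR (- x) <= x^(-e)] with [e = (1-g)/2] leaves the
    exponent [g + e < 1], whose sum is at most [c], and produces the factor [m^(-e)], small for
    large [m]. The choice of [m] does not depend on the mesh. *)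
Lemma sum_powR_expR_le (g t k : R) : 0 < g < 1 -> 0 < t -> 0 < k ->
  exists2 m : R, 0 < m & forall (h : R) (n : nat), 0 < h -> n%:R * h <= t ->
    \sum_(1 <= j < n.+1) h * ((j%:R * h) `^ (- g) * expR (- (m * (j%:R * h)))) <= k.
Proof.
move=> /andP[g0 g1] t0 k0; pose e := (1 - g) / 2.
have e0 : 0 < e by rewrite /e; lra.
have e1 : e <= 1 by rewrite /e; lra.
pose g' := g + e; have g'0 : 0 < g' < 1 by rewrite /g' /e; apply/andP; split; lra.
have g'1 : 0 < 1 - g' by case/andP: g'0 => *; lra.
pose c := t `^ (1 - g') / (1 - g').
have c0 : 0 < c by rewrite divr_gt0// powR_gt0.
(* Solves [m^(-e) c = k]. *)
exists ((k / c) `^ (- e^-1)); first by rewrite powR_gt0// divr_gt0.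
move=> h n h0 nh; set m := _ `^ _.
have m0 : 0 < m by rewrite powR_gt0// divr_gt0.
have me : m `^ (- e) = k / c.
  by rewrite /m -powRrM mulrNN mulVf ?gt_eqF// powRr1// ltW// divr_gt0.
have -> : k = m `^ (- e) * c by rewrite me divfK// gt_eqF.
apply: (@le_trans _ _ (m `^ (- e) * \sum_(1 <= j < n.+1) h * (j%:R * h) `^ (- g'))).
  rewrite mulr_sumr; apply: ler_sum_nat => j /andP[j1 _].
  have x0 : 0 < j%:R * h by rewrite mulr_gt0// ltr0n.
  rewrite [leRHS]mulrCA ler_pM2l//.
  have -> : (j%:R * h) `^ (- g') = (j%:R * h) `^ (- g) * (j%:R * h) `^ (- e).
    by rewrite -powRD_gt0// -opprD.
  rewrite [leRHS]mulrCA ler_wpM2l ?powR_ge0// -powRM ?(ltW m0) ?(ltW x0)//.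
  by apply: expRN_le_powR; rewrite ?e0// mulr_gt0.
rewrite ler_wpM2l ?powR_ge0// (le_trans (sum_powR_le n g'0 h0))//.
rewrite ler_wpM2r ?invr_ge0 ?(ltW g'1)//.
by apply: ge0_ler_powR; rewrite ?nnegrE ?mulr_ge0 ?ler0n ?(ltW g'1) ?(ltW h0) ?(ltW t0).
Qed.

End powint.

(** * Iterated integrals over space-time *)

Section tonelli.
Local Open Scope ereal_scope.
Context d1 d2 (T1 : measurableType d1) (T2 : measurableType d2) (R : realType).
Variables (m1 : {sigma_finite_measure set T1 -> \bar R})
          (m2 : {sigma_finite_measure set T2 -> \bar R}).

Lemma sfprod_tonelli (f : T1 * T2 -> \bar R) :
  measurable_fun setT f -> (forall z, 0 <= f z) ->
  \int[sfprod m1 m2]_z f z = \int[m1]_x \int[m2]_y f (x, y).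
Proof. by move=> mf f0; exact: fubini_tonelli1. Qed.

Lemma measurable_integral_snd (f : T1 * T2 -> \bar R) :
  measurable_fun setT f -> (forall z, 0 <= f z) ->
  measurable_fun setT (fun x => \int[m2]_y f (x, y)).
Proof. by move=> mf f0; exact: measurable_fun_fubini_tonelli_F. Qed.

Lemma measurable_integral_fst (f : T1 * T2 -> \bar R) :
  measurable_fun setT f -> (forall z, 0 <= f z) ->
  measurable_fun setT (fun y => \int[m1]_x f (x, y)).
Proof. by move=> mf f0; exact: measurable_fun_fubini_tonelli_G. Qed.

Lemma integral_sfprod_mul (f : T1 -> \bar R) (g : T2 -> \bar R) :
  measurable_fun setT f -> measurable_fun setT g ->
  (forall x, 0 <= f x) -> (forall x, 0 <= g x) ->
  \int[sfprod m1 m2]_z (f z.1 * g z.2) = \int[m1]_x f x * \int[m2]_y g y.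
Proof.
move=> mf mg f0 g0; rewrite sfprod_tonelli.
- under eq_integral do rewrite /= ge0_integralZl//.
  by rewrite ge0_integralZr// integral_ge0.
- by apply: emeasurable_funM; exact: measurableT_comp.
- by move=> z; rewrite mule_ge0.
Qed.

End tonelli.

Section tonelli2.
Local Open Scope ereal_scope.
Context d1 d2 (T1 : measurableType d1) (T2 : measurableType d2) (R : realType).
Variables (m1 : {sigma_finite_measure set T1 -> \bar R})
          (m2 : {sigma_finite_measure set T2 -> \bar R}).

Lemma integral2_sfprod_mul (f : T1 * T1 -> \bar R) (g : T2 * T2 -> \bar R) :
  measurable_fun setT f -> measurable_fun setT g ->
  (forall x, 0 <= f x) -> (forall x, 0 <= g x) ->
  \int[sfprod m1 m2]_p \int[sfprod m1 m2]_q (f (p.1, q.1) * g (p.2, q.2)) =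
  (\int[m1]_x \int[m1]_y f (x, y)) * (\int[m2]_x \int[m2]_y g (x, y)).
Proof.
move=> mf mg f0 g0.
under eq_integral => p _.
  rewrite (integral_sfprod_mul m1 m2 (f := fun y => f (p.1, y)) (g := fun y => g (p.2, y)))//; last 2 first.
    by apply: (measurableT_comp mf); exact: pair1_measurable.
    by apply: (measurableT_comp mg); exact: pair1_measurable.
  over.
rewrite (integral_sfprod_mul m1 m2 (f := fun x => \int[m1]_y f (x, y)) (g := fun x => \int[m2]_y g (x, y)))//.
- exact: measurable_integral_snd.
- exact: measurable_integral_snd.
- by move=> x; exact: integral_ge0.
- by move=> x; exact: integral_ge0.
Qed.

End tonelli2.

Section tuple_tonelli.
Local Open Scope ereal_scope.
Context {R : realType}.
Local Notation mu := (@lebesgue_measure R).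
Local Notation lt := (@lebesgue_tuple R).

Lemma integral_lebesgue_tupleS n (f : n.+1.-tuple (measurableTypeR R) -> \bar R) :
  measurable_fun setT f -> (forall z, 0 <= f z) ->
  \int[lt n.+1]_x f x = \int[sfprod mu (lt n)]_p f (cons_pair p).
Proof.
move=> mf f0; rewrite /= /lebesgue_cons.
rewrite (ge0_integral_pushforward (@measurable_cons_pair R n))//.
Qed.

Lemma measurable_tnth_pair n (i : 'I_n) :
  measurable_fun setT (fun z : n.-tuple (measurableTypeR R) * n.-tuple (measurableTypeR R) =>
    (tnth z.1 i, tnth z.2 i)).
Proof.
apply/measurable_fun_pair => /=.
  by apply: (measurableT_comp (f := (@tnth n _)^~ i)) => //; exact: measurable_tnth.
by apply: (measurableT_comp (f := (@tnth n _)^~ i)) => //; exact: measurable_tnth.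
Qed.

Lemma measurable_prod_tnth_pair n (f : 'I_n -> measurableTypeR R * measurableTypeR R -> R) :
  (forall i, measurable_fun setT (f i)) ->
  measurable_fun setT (fun z : n.-tuple (measurableTypeR R) * n.-tuple (measurableTypeR R) =>
    (\prod_(i < n) f i (tnth z.1 i, tnth z.2 i))%:E).
Proof.
move=> mf; apply/measurable_EFinP; apply: measurable_prod => i _.
by apply: (measurableT_comp (mf i)); exact: measurable_tnth_pair.
Qed.

(** The measure on tuples is an iterated product, so a product kernel integrates coordinate by
    coordinate; this brings the space-time computations down to the line. *)
Lemma integral2_lebesgue_tuple n
    (f : 'I_n -> measurableTypeR R * measurableTypeR R -> R) :
  (forall i, measurable_fun setT (f i)) -> (forall i z, (0 <= f i z)%R) ->
  \int[lt n]_x \int[lt n]_y (\prod_(i < n) f i (tnth x i, tnth y i))%:E =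
  \prod_(i < n) \int[mu]_u \int[mu]_v (f i (u, v))%:E.
Proof.
elim: n f => [|n IH] f mf f0.
  under eq_integral do under eq_integral do rewrite big_ord0.
  rewrite big_ord0 /= integral_dirac//=.
  by rewrite integral_dirac//= !diracT !mul1e.
have p0 m (g : 'I_m -> measurableTypeR R * measurableTypeR R -> R) z :
    (forall i z, (0 <= g i z)%R) ->
    0%R <= (\prod_(i < m) g i (tnth z.1 i, tnth z.2 i))%:E.
  by move=> g0; rewrite lee_fin prodr_ge0.
rewrite integral_lebesgue_tupleS; last 2 first.
- apply: (measurable_integral_snd (lt n.+1) (f := fun z => (\prod_(i < n.+1) f i (tnth z.1 i, tnth z.2 i))%:E)).
    exact: measurable_prod_tnth_pair.
  by move=> z; exact: p0.
- by move=> x; apply: integral_ge0 => y _; exact: (p0 _ _ (x, y)).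
under eq_integral => p _.
  rewrite integral_lebesgue_tupleS; last 2 first.
  - exact: (measurableT_comp (measurable_prod_tnth_pair mf) (pair1_measurable (cons_pair p))).
  - by move=> y; exact: (p0 _ _ (_, y)).
  under eq_integral => q _.
    rewrite big_ord_recl EFinM /=.
    under eq_bigr => i _ do rewrite !tnthS.
    over.
  over.
rewrite [in RHS]big_ord_recl -(IH (fun i => f (lift ord0 i)))//.
rewrite -(integral2_sfprod_mul mu (lt n) (f := EFin \o f ord0)
  (g := fun z => (\prod_(i < n) f (lift ord0 i) (tnth z.1 i, tnth z.2 i))%:E))//.
- exact/measurable_EFinP.
- exact: (measurable_prod_tnth_pair (fun i => mf (lift ord0 i))).
- by move=> z; rewrite lee_fin.
- by move=> z; exact: (p0 _ (fun i => f (lift ord0 i))).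
Qed.

Lemma integral2_lebesgue_spacetime d
    (f0 : measurableTypeR R * measurableTypeR R -> R)
    (f : 'I_d -> measurableTypeR R * measurableTypeR R -> R) :
  measurable_fun setT f0 -> (forall i, measurable_fun setT (f i)) ->
  (forall z, (0 <= f0 z)%R) -> (forall i z, (0 <= f i z)%R) ->
  \int[lebesgue_spacetime]_p \int[@lebesgue_spacetime R d]_q
     (f0 (p.1, q.1) * \prod_(i < d) f i (tnth p.2 i, tnth q.2 i))%:E =
  (\int[mu]_u \int[mu]_v (f0 (u, v))%:E) *
  \prod_(i < d) \int[mu]_u \int[mu]_v (f i (u, v))%:E.
Proof.
move=> mf0 mf f00 f0i.
rewrite -integral2_lebesgue_tuple//.
rewrite -(integral2_sfprod_mul mu (lt d) (f := EFin \o f0)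
  (g := fun z => (\prod_(i < d) f i (tnth z.1 i, tnth z.2 i))%:E))//.
- exact/measurable_EFinP.
- exact: measurable_prod_tnth_pair.
- by move=> z; rewrite lee_fin prodr_ge0.
Qed.

Lemma measurable_spacetime_pair d
    (f0 : measurableTypeR R * measurableTypeR R -> R)
    (f : 'I_d -> measurableTypeR R * measurableTypeR R -> R) :
  measurable_fun setT f0 -> (forall i, measurable_fun setT (f i)) ->
  measurable_fun setT (fun z : (measurableTypeR R * d.-tuple (measurableTypeR R)) *
     (measurableTypeR R * d.-tuple (measurableTypeR R)) =>
     (f0 (z.1.1, z.2.1) * \prod_(i < d) f i (tnth z.1.2 i, tnth z.2.2 i))%R).
Proof.
move=> mf0 mf; apply: measurable_funM.
  apply: (measurableT_comp mf0); apply/measurable_fun_pair => /=;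
  exact: measurableT_comp.
apply: measurable_prod => i _; apply: (measurableT_comp (mf i)).
by apply/measurable_fun_pair => /=;
  apply: (measurableT_comp (f := (@tnth d _)^~ i)); (try exact: measurable_tnth);
  exact: measurableT_comp.
Qed.

End tuple_tonelli.

(** * The isometry on step functions *)

Section isometry.
Context {R : realType}.
Local Notation mu := (@lebesgue_measure R).

Lemma integral_indic_mull d (T : measurableType d) (m : {measure set T -> \bar R})
    (D : set T) (f : T -> \bar R) :
  (\int[m]_x ((\1_D x)%:E * f x) = \int[m]_(x in D) f x)%E.
Proof.
rewrite [RHS]integral_mkcond; apply: eq_integral => x _.
by rewrite patchE indicE; case: (x \in D); rewrite ?mul1e ?mul0e.
Qed.

Definition box_kernel_pow (a p q c e : R) (z : R * R) : R :=
  \1_`]p, q] z.1 * \1_`]c, e] z.2 * `|z.1 - z.2| `^ a.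

Lemma measurable_indic_itv (i : interval R) :
  measurable_fun setT (\1_([set` i]) : R -> R).
Proof. by apply: measurable_indic; exact: measurable_itv. Qed.

Lemma measurable_box_kernel_pow a p q c e :
  measurable_fun setT (box_kernel_pow a p q c e).
Proof.
apply: measurable_funM; last exact: measurable_powR_dist2.
by apply: measurable_funM; apply: (measurableT_comp (measurable_indic_itv _)).
Qed.

Lemma box_kernel_pow_ge0 a p q c e z : 0 <= box_kernel_pow a p q c e z.
Proof. by rewrite !mulr_ge0// powR_ge0. Qed.

Definition box_cov (a p q c e : R) : R :=
  pow_prim2 a (q - c) - pow_prim2 a (p - c)
    - pow_prim2 a (q - e) + pow_prim2 a (p - e).

Lemma integral2_box_kernel_pow (a p q c e : R) : -1 < a -> p <= q -> c <= e ->
  (\int[mu]_u \int[mu]_v (box_kernel_pow a p q c e (u, v))%:E =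
   (box_cov a p q c e)%:E)%E.
Proof.
move=> a1 pq ce; rewrite /box_cov -(integral2_powR_dist a1 pq ce).
rewrite -[RHS]integral_indic_mull; apply: eq_integral => u _.
rewrite -[in RHS]integral_mulr_indic -ge0_integralZl_EFin//.
- by apply: eq_integral => v _; rewrite -EFinM /box_kernel_pow/= -mulrA [X in _ * X]mulrC.
- apply/measurable_EFinP; apply: measurable_funM; last exact: measurable_indic_itv.
  by under eq_fun do rewrite distrC; exact: measurable_powR_dist.
Qed.

Definition fbm_incr (h p q c e : R) : R :=
  fbm_cov h q e - fbm_cov h q c - (fbm_cov h p e - fbm_cov h p c).

(** In a mixed second difference of the covariance the terms depending on one variable cancel and
    only powers of distances remain. The factor [h (2h - 1)] reduces the denominator [(2h - 1) 2h]
    of [pow_prim2] to the 1/2 of the covariance. *)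
Lemma box_covE (h p q c e : R) : 2^-1 < h ->
  h * (2 * h - 1) * box_cov (2 * h - 2) p q c e = fbm_incr h p q c e.
Proof.
move=> h2; rewrite /box_cov /fbm_incr /fbm_cov /pow_prim2.
have -> : 2 * h - 2 + 2 = 2 * h by ring.
have -> : 2 * h - 2 + 1 = 2 * h - 1 by ring.
rewrite -!(distrC e) -!(distrC c).
by field; apply/andP; split; rewrite gt_eqF//; lra.
Qed.

End isometry.

Section step_isometry.
Context {R : realType} {d : nat} (H0 : R) (H : 'I_d -> R).
Hypothesis H0b : 2^-1 < H0 < 1.
Hypothesis Hb : forall i, 2^-1 < H i < 1.
Local Notation mu := (@lebesgue_measure R).
Local Notation spacetime := (measurableTypeR R * d.-tuple (measurableTypeR R))%type.
Local Notation lst := (@lebesgue_spacetime R d).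
Local Notation D := (@nonneg_times R d).

Definition rect_incr (r r' : @rect R d) : R :=
  fbm_incr H0 (time_lo r) (time_hi r) (time_lo r') (time_hi r') *
  \prod_(i < d) fbm_incr (H i) (tnth (space_lo r) i) (tnth (space_hi r) i)
    (tnth (space_lo r') i) (tnth (space_hi r') i).

Lemma measurable_nonneg_times : measurable D.
Proof.
pose J : set R := `[0%R, +oo[%classic.
have mJ : measurable J by exact: measurable_itv.
rewrite /nonneg_times (_ : [set p | _] = J `*` setT).
  by apply: measurableX => //; exact: mJ.
by apply/seteqP; split => z; rewrite /J/= in_itv/= andbT; [move=> h; split|case].
Qed.

Lemma measurable_hkernel :
  measurable_fun setT (fun z : spacetime * spacetime => hkernel H0 H z.1 z.2).
Proof.
apply: (@measurable_spacetime_pair R d (fun z => `|z.1 - z.2| `^ (2 * H0 - 2))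
  (fun i z => `|z.1 - z.2| `^ (2 * H i - 2))) => [|i];
exact: measurable_powR_dist2.
Qed.

Lemma hkernel_ge0 p q : 0 <= hkernel H0 H p q.
Proof. by rewrite mulr_ge0 ?powR_ge0// prodr_ge0// => i _; exact: powR_ge0. Qed.

Lemma indic_rectE (r : @rect R d) (p : spacetime) :
  \1_(rect_set r) p = \1_`]time_lo r, time_hi r] (p.1 : R) *
    \prod_(i < d) \1_`]tnth (space_lo r) i, tnth (space_hi r) i] (tnth p.2 i : R) :> R.
Proof.
rewrite !indicE; under eq_bigr do rewrite indicE.
have [pr|pr] := pselect (rect_set r p).
  rewrite mem_set//; case: pr => h1 h2.
  rewrite mem_set/=; last by rewrite in_itv.
  by rewrite mul1r big1// => i _; rewrite mem_set//= in_itv/=; exact: h2.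
rewrite memNset//.
have [h1|h1] := pselect (time_lo r < (p.1 : R) <= time_hi r); last first.
  by rewrite memNset ?mul0r//= in_itv.
have /existsNP[i hi] : ~ forall i, tnth (space_lo r) i < (tnth p.2 i : R) <= tnth (space_hi r) i.
  by move=> h2; apply: pr.
have e : (tnth p.2 i \in `]tnth (space_lo r) i, tnth (space_hi r) i]%classic) = false.
  by apply/negbTE; rewrite notin_setE/= in_itv.
by rewrite (bigD1 i)//= e mul0r mulr0.
Qed.

Lemma nonneg_times_rect (r : @rect R d) : rect_set r `<=` D.
Proof.
move=> p [/andP[h _] _]; rewrite /nonneg_times/=.
by rewrite ltW// (le_lt_trans (time_lo_ge0 r)).
Qed.

Definition rect_kernel (r r' : @rect R d) (z : spacetime * spacetime) : R :=
  \1_(rect_set r) z.1 * \1_(rect_set r') z.2 * hkernel H0 H z.1 z.2.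

Lemma rect_kernelE (r r' : @rect R d) z : rect_kernel r r' z =
  box_kernel_pow (2 * H0 - 2) (time_lo r) (time_hi r) (time_lo r') (time_hi r') (z.1.1 : R, z.2.1 : R) *
  \prod_(i < d) box_kernel_pow (2 * H i - 2) (tnth (space_lo r) i) (tnth (space_hi r) i)
     (tnth (space_lo r') i) (tnth (space_hi r') i) (tnth z.1.2 i : R, tnth z.2.2 i : R).
Proof.
rewrite /rect_kernel !indic_rectE /hkernel /box_kernel_pow /= !big_split/=.
by ring.
Qed.

Lemma measurable_rect_kernel r r' : measurable_fun setT (rect_kernel r r').
Proof.
rewrite (funext (rect_kernelE r r')).
apply: (@measurable_spacetime_pair R d
  (box_kernel_pow (2 * H0 - 2) (time_lo r) (time_hi r) (time_lo r') (time_hi r'))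
  (fun i => box_kernel_pow (2 * H i - 2) (tnth (space_lo r) i) (tnth (space_hi r) i)
     (tnth (space_lo r') i) (tnth (space_hi r') i))).
  exact: measurable_box_kernel_pow.
by move=> i; exact: measurable_box_kernel_pow.
Qed.

Lemma rect_kernel_ge0 r r' z : 0 <= rect_kernel r r' z.
Proof. by apply: mulr_ge0; [exact: mulr_ge0|exact: hkernel_ge0]. Qed.

Definition rect_cov (r r' : @rect R d) : R :=
  box_cov (2 * H0 - 2) (time_lo r) (time_hi r) (time_lo r') (time_hi r') *
  \prod_(i < d) box_cov (2 * H i - 2) (tnth (space_lo r) i) (tnth (space_hi r) i)
    (tnth (space_lo r') i) (tnth (space_hi r') i).

Lemma integral_rect_kernel r r' :
  (\int[sfprod lst lst]_z (rect_kernel r r' z)%:E = (rect_cov r r')%:E)%E.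
Proof.
rewrite sfprod_tonelli//; last 2 first.
- by apply/measurable_EFinP; exact: measurable_rect_kernel.
- by move=> z; rewrite lee_fin rect_kernel_ge0.
under eq_integral do under eq_integral do rewrite rect_kernelE.
rewrite (@integral2_lebesgue_spacetime R d
  (box_kernel_pow (2 * H0 - 2) (time_lo r) (time_hi r) (time_lo r') (time_hi r'))
  (fun i => box_kernel_pow (2 * H i - 2) (tnth (space_lo r) i) (tnth (space_hi r) i)
     (tnth (space_lo r') i) (tnth (space_hi r') i))).
- rewrite integral2_box_kernel_pow; [|by case/andP: H0b => *; lra|exact: time_le..].
  under eq_bigr => i _.
    rewrite integral2_box_kernel_pow; [|by case/andP: (Hb i) => *; lra|exact: space_le..].
    over.
  by rewrite prodEFin -EFinM.
- exact: measurable_box_kernel_pow.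
- by move=> i; exact: measurable_box_kernel_pow.
- by move=> z; exact: box_kernel_pow_ge0.
- by move=> i z; exact: box_kernel_pow_ge0.
Qed.

Lemma rect_covE r r' : alphaH H0 H * rect_cov r r' = rect_incr r r'.
Proof.
rewrite /alphaH /rect_cov /rect_incr mulrACA box_covE; last by case/andP: H0b.
congr (_ * _); rewrite -big_split/=; apply: eq_bigr => i _.
by rewrite box_covE//; case/andP: (Hb i).
Qed.

Lemma integrable_rect_kernel r r' :
  (sfprod lst lst).-integrable setT (fun z => (rect_kernel r r' z)%:E).
Proof.
apply/integrableP; split; first by apply/measurable_EFinP; exact: measurable_rect_kernel.
under eq_integral do rewrite gee0_abs ?lee_fin ?rect_kernel_ge0//.
by rewrite integral_rect_kernel ltry.
Qed.

Lemma step_kernelE (f : @step R d) (z : spacetime * spacetime) :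
  step_fun f z.1 * step_fun f z.2 * hkernel H0 H z.1 z.2 =
  \sum_(k < step_size f) \sum_(l < step_size f)
     step_coef k * step_coef l * rect_kernel (step_rect k) (step_rect l) z.
Proof.
rewrite /step_fun big_distrlr/= mulr_suml; apply: eq_bigr => k _.
rewrite mulr_suml; apply: eq_bigr => l _; rewrite /rect_kernel; ring.
Qed.

Lemma step_fun_notin (f : @step R d) p : ~ D p -> step_fun f p = 0.
Proof.
move=> nDp; rewrite /step_fun big1// => k _; rewrite indicE memNset ?mulr0//.
by move=> /nonneg_times_rect.
Qed.

(** Bilinear expansion over pairs of rectangles. The right side is also the variance of the
    corresponding combination of sheet increments, which [step_integral_variance] shows. *)
Lemma hinner_step (f : @step R d) :
  hinner H0 H (step_fun f) (step_fun f) =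
  (\sum_(k < step_size f) \sum_(l < step_size f)
     step_coef k * step_coef l * rect_incr (step_rect k) (step_rect l))%:E.
Proof.
have -> : hinner H0 H (step_fun f) (step_fun f) =
    ((alphaH H0 H)%:E * \int[sfprod lst lst]_z
      (step_fun f z.1 * step_fun f z.2 * hkernel H0 H z.1 z.2)%:E)%E.
  rewrite /hinner; congr (_ * _)%E; rewrite integral_mkcond; apply: eq_integral => z _.
  rewrite patchE; case: ifPn => //; rewrite notin_setE /= => /not_andP[|] nD.
    by rewrite step_fun_notin// !mul0r.
  by rewrite (step_fun_notin _ nD) mulr0 mul0r.
under eq_integral do rewrite step_kernelE -sumEFin.
have ik (k l : 'I_(step_size f)) : (sfprod lst lst).-integrable setT
    (fun z => (step_coef k * step_coef l * rect_kernel (step_rect k) (step_rect l) z)%:E).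
  under eq_fun do rewrite EFinM.
  by apply: integrableZl => //; exact: integrable_rect_kernel.
rewrite integral_sum//; last first.
  by move=> k; under eq_fun do rewrite -sumEFin; exact: integrable_sum.
have I2 (k : 'I_(step_size f)) : (\int[sfprod lst lst]_z (\sum_(l < step_size f)
    step_coef k * step_coef l * rect_kernel (step_rect k) (step_rect l) z)%:E =
    (\sum_(l < step_size f) step_coef k * step_coef l * rect_cov (step_rect k) (step_rect l))%:E)%E.
  under eq_integral do rewrite -sumEFin.
  rewrite integral_sum// -sumEFin; apply: eq_bigr => l _.
  under eq_integral do rewrite EFinM.
  by rewrite integralZl ?integral_rect_kernel//; exact: integrable_rect_kernel.
under eq_bigr do rewrite I2.
rewrite sumEFin -EFinM mulr_sumr; congr EFin; apply: eq_bigr => k _.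
rewrite mulr_sumr; apply: eq_bigr => l _; rewrite -rect_covE; ring.
Qed.

End step_isometry.

(** * Positivity of the covariance form *)

Section positive_kernel.
Local Open Scope ereal_scope.
Context d (T : measurableType d) (R : realType)
  (m : {sigma_finite_measure set T -> \bar R}).

(** Written without subtraction so that it holds for infinite values, and can be integrated before
    anything is known to converge. *)
Lemma amgme (a b : \bar R) : 0 <= a -> 0 <= b -> a * b + a * b <= a * a + b * b.
Proof.
case: a b => [a| |] [b| |]//= a0 b0.
- by rewrite -!EFinM -!EFinD lee_fin; have := sqr_ge0 (a - b)%R; rewrite expr2; nra.
- by rewrite mulyy addey ?leey// -EFinM.
- by rewrite mulyy addye ?leey// -EFinM.
Qed.

(** Four terms are what the expansion of a quadratic form at a combination of two functions
    produces. *)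
Lemma integral_lin4 (mu : {measure set T -> \bar R}) (F1 F2 F3 F4 : T -> R) (c1 c2 c3 c4 : R) :
  mu.-integrable setT (EFin \o F1) -> mu.-integrable setT (EFin \o F2) ->
  mu.-integrable setT (EFin \o F3) -> mu.-integrable setT (EFin \o F4) ->
  \int[mu]_z (c1 * F1 z + c2 * F2 z + c3 * F3 z + c4 * F4 z)%:E =
  (c1 * Rintegral mu setT F1 + c2 * Rintegral mu setT F2 +
   c3 * Rintegral mu setT F3 + c4 * Rintegral mu setT F4)%:E.
Proof.
move=> i1 i2 i3 i4.
have iZ c F : mu.-integrable setT (EFin \o F) -> mu.-integrable setT (fun z => (c * F z)%:E).
  by move=> h; under eq_fun do rewrite EFinM; exact: integrableZl.
have IZ c F : mu.-integrable setT (EFin \o F) ->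
    \int[mu]_z (c * F z)%:E = (c * Rintegral mu setT F)%:E.
  move=> h; under eq_integral do rewrite EFinM.
  by rewrite integralZl// EFinM /Rintegral fineK//; exact: integrable_fin_num.
under eq_integral do rewrite !EFinD.
rewrite integralD//; [|by do 2 (apply: integrableD => //; try exact: iZ)|exact: iZ].
rewrite integralD//; [|by apply: integrableD => //; exact: iZ|exact: iZ].
by rewrite integralD//; [rewrite !IZ// !EFinD|exact: iZ|exact: iZ].
Qed.

Lemma integral_amgm (mu : {measure set T -> \bar R}) (u v : T -> \bar R) :
  measurable_fun setT u -> measurable_fun setT v ->
  (forall w, 0 <= u w) -> (forall w, 0 <= v w) ->
  \int[mu]_w (u w * v w) + \int[mu]_w (u w * v w) <=
  \int[mu]_w (u w * u w) + \int[mu]_w (v w * v w).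
Proof.
move=> mu' mv u0 v0.
have uv0 w : 0 <= u w * v w by rewrite mule_ge0.
have uu0 w : 0 <= u w * u w by rewrite mule_ge0.
have vv0 w : 0 <= v w * v w by rewrite mule_ge0.
have muv : measurable_fun setT (u \* v) by exact: emeasurable_funM.
have muu : measurable_fun setT (u \* u) by exact: emeasurable_funM.
have mvv : measurable_fun setT (v \* v) by exact: emeasurable_funM.
rewrite -(ge0_integralD mu measurableT (fun w _ => uv0 w) muv (fun w _ => uv0 w) muv).
rewrite -(ge0_integralD mu measurableT (fun w _ => uu0 w) muu (fun w _ => vv0 w) mvv).
by apply: ge0_le_integralT => w; [rewrite adde_ge0|exact: amgme].
Qed.

End positive_kernel.

Section positive_kernel2.
Local Open Scope ereal_scope.
Context d (T : measurableType d) (R : realType)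
  (m : {sigma_finite_measure set T -> \bar R}).
Context dZ (Z : measurableType dZ) (mz : {sigma_finite_measure set Z -> \bar R}).
Variables (K : T * T -> R) (g : T * Z -> R).
Hypothesis mK : measurable_fun setT K.
Hypothesis K0 : forall z, (0 <= K z)%R.
Hypothesis mg : measurable_fun setT g.
Hypothesis g0 : forall z, (0 <= g z)%R.
Hypothesis KE : {ae sfprod m m, forall z,
  (K z)%:E = \int[mz]_w (g (z.1, w) * g (z.2, w))%:E}.

Local Notation mm := (sfprod m m).

Let F (a b : T -> R) (z : T * T) := (a z.1 * b z.2 * K z)%R.

Let mF (a b : T -> R) : measurable_fun setT a -> measurable_fun setT b -> measurable_fun setT (F a b).
Proof.
move=> ma mb; apply: measurable_funM => //; apply: measurable_funM.
  exact: (measurableT_comp ma).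
exact: (measurableT_comp mb).
Qed.

Let A (a : T -> R) (w : Z) := \int[m]_p (a p * g (p, w))%:E.

Let mag (a : T -> R) : measurable_fun setT a ->
  measurable_fun setT (fun z : T * Z => (a z.1 * g z)%:E).
Proof.
by move=> ma; apply/measurable_EFinP; apply: measurable_funM => //; exact: (measurableT_comp ma).
Qed.

Let mA (a : T -> R) : measurable_fun setT a -> (forall p, (0 <= a p)%R) -> measurable_fun setT (A a).
Proof.
move=> ma a0; apply: (measurable_integral_fst m (f := fun z : T * Z => (a z.1 * g z)%:E)).
  exact: mag.
by move=> z; rewrite lee_fin mulr_ge0.
Qed.

Let A0 (a : T -> R) w : (forall p, (0 <= a p)%R) -> 0 <= A a w.
Proof. by move=> a0; apply: integral_ge0 => p _; rewrite lee_fin mulr_ge0. Qed.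

(** Inserting the factorization of [K] and exchanging the integrals turns the form into the pairing
    in [L2(mz)] of the two transforms; nonnegativity makes this valid with infinite values. *)
Lemma integral_positive_kernel (a b : T -> R) :
  measurable_fun setT a -> measurable_fun setT b ->
  (forall p, (0 <= a p)%R) -> (forall p, (0 <= b p)%R) ->
  \int[mm]_z (a z.1 * b z.2 * K z)%:E =
  \int[mz]_w ((\int[m]_p (a p * g (p, w))%:E) * (\int[m]_p (b p * g (p, w))%:E)).
Proof.
move=> ma mb a0 b0.
pose G (y : (T * T) * Z) := ((a y.1.1 * g (y.1.1, y.2))%:E * (b y.1.2 * g (y.1.2, y.2))%:E).
have mG : measurable_fun setT G.
  apply: emeasurable_funM.
    apply: (measurableT_comp (mag ma) (g := fun y : (T * T) * Z => (y.1.1, y.2))).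
    apply/measurable_fun_pair => //=.
    exact: (measurableT_comp measurable_fst measurable_fst).
  apply: (measurableT_comp (mag mb) (g := fun y : (T * T) * Z => (y.1.2, y.2))).
  apply/measurable_fun_pair => //=.
  exact: (measurableT_comp measurable_snd measurable_fst).
have G0 y : 0 <= G y by rewrite mule_ge0// lee_fin mulr_ge0.
transitivity (\int[mm]_z \int[mz]_w G (z, w)).
  apply: ge0_ae_eq_integral => //.
  - by apply/measurable_EFinP; exact: mF.
  - exact: measurable_integral_snd.
  - by move=> z _; rewrite lee_fin !mulr_ge0.
  - by move=> z _; exact: integral_ge0.
  apply: filterS KE => z /= Kz _; rewrite EFinM Kz -ge0_integralZl_EFin//.
  - by apply: eq_integral => w _; rewrite /G/= -!EFinM; congr EFin; ring.
  - by move=> w _; rewrite lee_fin mulr_ge0.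
  - apply/measurable_EFinP; apply: measurable_funM.
      by apply: (measurableT_comp mg); exact: pair1_measurable.
    by apply: (measurableT_comp mg); exact: pair1_measurable.
  - exact: mulr_ge0.
have -> : \int[mm]_z \int[mz]_w G (z, w) = \int[mz]_w \int[mm]_z G (z, w).
  exact: fubini_tonelli.
apply: eq_integral => w _.
rewrite /G/= (integral_sfprod_mul m m (f := fun p => (a p * g (p, w))%:E)
  (g := fun p => (b p * g (p, w))%:E))//.
- exact: (measurableT_comp (mag ma) (pair2_measurable w)).
- exact: (measurableT_comp (mag mb) (pair2_measurable w)).
- by move=> p; rewrite lee_fin mulr_ge0.
- by move=> p; rewrite lee_fin mulr_ge0.
Qed.

(** Positivity of the form at [a - b], with the negative terms moved across so that infinite values
    are allowed. *)
Lemma positive_kernel_amgm (a b : T -> R) :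
  measurable_fun setT a -> measurable_fun setT b ->
  (forall p, (0 <= a p)%R) -> (forall p, (0 <= b p)%R) ->
  \int[mm]_z (a z.1 * b z.2 * K z)%:E + \int[mm]_z (a z.1 * b z.2 * K z)%:E <=
  \int[mm]_z (a z.1 * a z.2 * K z)%:E + \int[mm]_z (b z.1 * b z.2 * K z)%:E.
Proof.
move=> ma mb a0 b0.
rewrite (integral_positive_kernel ma mb a0 b0) (integral_positive_kernel ma ma a0 a0).
rewrite (integral_positive_kernel mb mb b0 b0).
exact: (integral_amgm mz (mA ma a0) (mA mb b0) (fun w => A0 w a0) (fun w => A0 w b0)).
Qed.

Lemma positive_kernelC (a b : T -> R) :
  measurable_fun setT a -> measurable_fun setT b ->
  (forall p, (0 <= a p)%R) -> (forall p, (0 <= b p)%R) ->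
  \int[mm]_z (a z.1 * b z.2 * K z)%:E = \int[mm]_z (b z.1 * a z.2 * K z)%:E.
Proof.
move=> ma mb a0 b0.
rewrite (integral_positive_kernel ma mb a0 b0) (integral_positive_kernel mb ma b0 a0).
by apply: eq_integral => w _; rewrite muleC.
Qed.

Definition kernel_finite (f : T -> R) :=
  measurable_fun setT f /\ \int[mm]_z (`|f z.1| * `|f z.2| * K z)%:E < +oo.

(** The mixed form of [|f|] and [|h|] is dominated by the two diagonal ones, which are finite. *)
Lemma kernel_finite_integrable (f h : T -> R) : kernel_finite f -> kernel_finite h ->
  mm.-integrable setT (EFin \o F f h).
Proof.
move=> [mf ff] [mh fh]; apply/integrableP; split.
  by apply/measurable_EFinP; exact: mF.
have n0 (e : T -> R) : measurable_fun setT e -> measurable_fun setT (fun p => `|e p|%R).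
  by move=> me; exact: (measurableT_comp (f := @Num.norm R R)).
apply: (@le_lt_trans _ _ (\int[mm]_z (`|f z.1| * `|h z.2| * K z)%:E)).
  rewrite le_eqVlt; apply/orP; left; apply/eqP; apply: eq_integral => z _ /=.
  by rewrite /F !normrM (ger0_norm (K0 z)).
apply: (@le_lt_trans _ _ (\int[mm]_z (`|f z.1| * `|h z.2| * K z)%:E + \int[mm]_z (`|f z.1| * `|h z.2| * K z)%:E)).
  by rewrite leeDl// integral_ge0// => z _; rewrite lee_fin !mulr_ge0.
apply: (@le_lt_trans _ _ _ _ _ (positive_kernel_amgm (n0 _ mf) (n0 _ mh) _ _)) => //.
exact: lte_add_pinfty.
Qed.

Let formE (f h : T -> R) : kernel_finite f -> kernel_finite h ->
  (Rintegral mm setT (F f h))%:E = \int[mm]_z (f z.1 * h z.2 * K z)%:E.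
Proof.
by move=> kf kh; rewrite /Rintegral fineK//; apply: integrable_fin_num => //; exact: kernel_finite_integrable.
Qed.

(** The factorized form is available for nonnegative functions only. The positive and negative parts
    of [f] have four finite forms, and the claim is [positive_kernel_amgm] for these parts. *)
Lemma kernel_form_ge0 (f : T -> R) : kernel_finite f ->
  0 <= \int[mm]_z (f z.1 * f z.2 * K z)%:E.
Proof.
move=> [mf ff].
pose a p := Num.max (f p) 0%R; pose b p := Num.max (- f p)%R 0%R.
have ma : measurable_fun setT a by exact: measurable_maxr.
have mb : measurable_fun setT b by apply: measurable_maxr => //; exact: (measurableT_comp (f := @GRing.opp R)).
have a0 p : (0 <= a p)%R by rewrite le_max lexx orbT.
have b0 p : (0 <= b p)%R by rewrite le_max lexx orbT.
have fab p : f p = (a p - b p)%R.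
  by rewrite /a /b; case: leP => h1; case: leP => h2; lra.
have al p : (`|a p| <= `|f p|)%R.
  by rewrite (ger0_norm (a0 p)) /a ge_max ler_norm normr_ge0.
have bl p : (`|b p| <= `|f p|)%R.
  by rewrite (ger0_norm (b0 p)) /b ge_max -normrN ler_norm normr_ge0.
have kf (c : T -> R) : measurable_fun setT c -> (forall p, (`|c p| <= `|f p|)%R) -> kernel_finite c.
  move=> mc cl; split => //; apply: le_lt_trans ff; apply: ge0_le_integralT => z.
    by rewrite lee_fin !mulr_ge0.
  by rewrite lee_fin ler_wpM2r// ler_pM.
have ka := kf _ ma al; have kb := kf _ mb bl.
have := integral_lin4 1 (-1) (-1) 1 (kernel_finite_integrable ka ka)
  (kernel_finite_integrable ka kb) (kernel_finite_integrable kb ka) (kernel_finite_integrable kb kb).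
rewrite (_ : \int[mm]_z _ = \int[mm]_z (f z.1 * f z.2 * K z)%:E); last first.
  by apply: eq_integral => z _; congr EFin; rewrite /F !fab; ring.
move=> ->; rewrite lee_fin.
have h1 := positive_kernel_amgm ma mb a0 b0.
have h2 := positive_kernelC ma mb a0 b0.
have e1 : Rintegral mm setT (F a b) = Rintegral mm setT (F b a).
  by apply: EFin_inj; rewrite !formE.
move: h1; rewrite -!formE// -!EFinD lee_fin; rewrite e1; lra.
Qed.

(** The right side minus the left side is the form at [f - 2h]. *)
Lemma kernel_form_parallelogram (f h : T -> R) : kernel_finite f -> kernel_finite h ->
  \int[mm]_z (f z.1 * f z.2 * K z)%:E <=
  2%:E * \int[mm]_z ((f z.1 - h z.1) * (f z.2 - h z.2) * K z)%:E +
  2%:E * \int[mm]_z (h z.1 * h z.2 * K z)%:E.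
Proof.
move=> kf kh.
have [mf _] := kf; have [mh _] := kh.
have iff := kernel_finite_integrable kf kf.
have ifh := kernel_finite_integrable kf kh.
have ihf := kernel_finite_integrable kh kf.
have ihh := kernel_finite_integrable kh kh.
pose e p := (f p - 2 * h p)%R.
have ke : kernel_finite e.
  have nm (c : T -> R) : measurable_fun setT c -> measurable_fun setT (fun p => `|c p|%R).
    by move=> mc; exact: (measurableT_comp (f := @Num.norm R R)).
  have kn c : kernel_finite c -> kernel_finite (fun p => `|c p|%R).
    move=> [mc fc]; split; first exact: nm.
    by under eq_integral do rewrite !normr_id.
  have me : measurable_fun setT e by apply: measurable_funB => //; exact: measurable_funM.
  split => //.
  apply: (@le_lt_trans _ _ (\int[mm]_z (1 * F (fun p => `|f p|%R) (fun p => `|f p|%R) z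
    + 2 * F (fun p => `|f p|%R) (fun p => `|h p|%R) z
    + 2 * F (fun p => `|h p|%R) (fun p => `|f p|%R) z
    + 4 * F (fun p => `|h p|%R) (fun p => `|h p|%R) z)%:E)).
    apply: ge0_le_integralT => z; first by rewrite lee_fin !mulr_ge0.
    rewrite lee_fin /F.
    have tri p : (`|e p| <= `|f p| + 2 * `|h p|)%R.
      by rewrite (le_trans (ler_normB _ _))// normrM (ger0_norm (_ : 0 <= 2)%R).
    have : (`|e z.1| * `|e z.2| <= (`|f z.1| + 2 * `|h z.1|) * (`|f z.2| + 2 * `|h z.2|))%R.
      by apply: ler_pM.
    move/(ler_wpM2r (K0 z)); lra.
  rewrite integral_lin4 ?ltry//; apply: kernel_finite_integrable; exact: kn.
have := kernel_form_ge0 ke.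
have -> : \int[mm]_z (e z.1 * e z.2 * K z)%:E = \int[mm]_z (1 * F f f z + (-2) * F f h z + (-2) * F h f z + 4 * F h h z)%:E.
  by apply: eq_integral => z _; congr EFin; rewrite /F /e; ring.
have -> : \int[mm]_z ((f z.1 - h z.1) * (f z.2 - h z.2) * K z)%:E =
    \int[mm]_z (1 * F f f z + (-1) * F f h z + (-1) * F h f z + 1 * F h h z)%:E.
  by apply: eq_integral => z _; congr EFin; rewrite /F; ring.
rewrite !integral_lin4// -!formE// -!EFinM -EFinD !lee_fin; lra.
Qed.

End positive_kernel2.

(** * Power kernels as mixtures of products *)

Section kernel_factor.
Context {R : realType}.
Local Notation mu := (@lebesgue_measure R).

(* [K] is positive semidefinite because it is an integral of products. *)
Definition kernel_factor d (T : measurableType d) (E : set (T * T)) (K : T * T -> R) :=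
  exists dZ (Z : measurableType dZ) (mz : {sigma_finite_measure set Z -> \bar R})
    (g : T * Z -> R),
    [/\ measurable_fun setT g, forall z, 0 <= g z &
      forall z, E z -> ((K z)%:E = \int[mz]_w (g (z.1, w) * g (z.2, w))%:E)%E].

Lemma kernel_factor_comp d d' (T : measurableType d) (T' : measurableType d')
    (E : set (T * T)) (K : T * T -> R) (phi : T' -> T) :
  measurable_fun setT phi -> kernel_factor E K ->
  kernel_factor (fun z => E (phi z.1, phi z.2)) (fun z => K (phi z.1, phi z.2)).
Proof.
move=> mphi [dZ [Z [mz [g [mg g0 Kg]]]]]; exists dZ, Z, mz, (fun z => g (phi z.1, z.2)).
split => // [|z Ez]; last by rewrite Kg.
apply: (measurableT_comp mg); apply/measurable_fun_pair => //=.
exact: (measurableT_comp mphi).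
Qed.

(** Schur's product theorem at the level of factors: both the factors and the auxiliary spaces are
    multiplied. *)
Lemma kernel_factor_prod d1 d2 (T1 : measurableType d1) (T2 : measurableType d2)
    (E1 : set (T1 * T1)) (K1 : T1 * T1 -> R) (E2 : set (T2 * T2)) (K2 : T2 * T2 -> R) :
  kernel_factor E1 K1 -> kernel_factor E2 K2 ->
  kernel_factor (fun z : (T1 * T2) * (T1 * T2) => E1 (z.1.1, z.2.1) /\ E2 (z.1.2, z.2.2))
    (fun z => K1 (z.1.1, z.2.1) * K2 (z.1.2, z.2.2)).
Proof.
move=> [dZ1 [Z1 [m1 [g1 [mg1 g10 Kg1]]]]] [dZ2 [Z2 [m2 [g2 [mg2 g20 Kg2]]]]].
exists _, (Z1 * Z2)%type, (sfprod m1 m2), (fun z => g1 (z.1.1, z.2.1) * g2 (z.1.2, z.2.2)).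
split => [|z|[p q] [/= E1z E2z]]; last first.
- rewrite EFinM Kg1// Kg2//= -(integral_sfprod_mul m1 m2
    (f := fun w => (g1 (p.1, w) * g1 (q.1, w))%:E) (g := fun w => (g2 (p.2, w) * g2 (q.2, w))%:E)).
  + by apply: eq_integral => w _; rewrite -EFinM; congr EFin; ring.
  + apply/measurable_EFinP; apply: measurable_funM;
    by apply: (measurableT_comp mg1); exact: pair1_measurable.
  + apply/measurable_EFinP; apply: measurable_funM;
    by apply: (measurableT_comp mg2); exact: pair1_measurable.
  + by move=> w; rewrite lee_fin mulr_ge0.
  + by move=> w; rewrite lee_fin mulr_ge0.
- by rewrite mulr_ge0.
- apply: measurable_funM.
    apply: (measurableT_comp mg1); apply/measurable_fun_pair => /=;
    exact: (measurableT_comp measurable_fst).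
  apply: (measurableT_comp mg2); apply/measurable_fun_pair => /=;
  exact: (measurableT_comp measurable_snd).
Qed.

Lemma kernel_factor_cst1 d (T : measurableType d) : kernel_factor (@setT (T * T)) (fun=> 1).
Proof.
exists _, (measurableTypeR R), (\d_(0 : measurableTypeR R)), (fun=> 1); split => // z _.
by rewrite integral_dirac//= diracT mul1e mulr1.
Qed.

Lemma kernel_factor_sub d (T : measurableType d) (E E' : set (T * T)) (K K' : T * T -> R) :
  E' `<=` E -> K =1 K' -> kernel_factor E K -> kernel_factor E' K'.
Proof.
move=> EE' KK' [dZ [Z [mz [g [mg g0 Kg]]]]]; exists dZ, Z, mz, g; split => // z /EE'.
by move/Kg; rewrite KK'.
Qed.

Lemma kernel_factor_tuple n (K : 'I_n -> R * R -> R) :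
  (forall i, @kernel_factor _ (measurableTypeR R) (fun z => z.1 <> z.2) (K i)) ->
  @kernel_factor _ (n.-tuple (measurableTypeR R)) (fun z => forall i, tnth z.1 i <> tnth z.2 i)
    (fun z => \prod_(i < n) K i (tnth z.1 i, tnth z.2 i)).
Proof.
elim: n K => [K _|n IH K kK].
  apply: kernel_factor_sub (kernel_factor_cst1 _) => // z.
  by rewrite big_ord0.
have k2 := kernel_factor_prod (kK ord0) (IH _ (fun i => kK (lift ord0 i))).
pose phi (x : n.+1.-tuple (measurableTypeR R)) : measurableTypeR R * n.-tuple (measurableTypeR R) :=
  (tnth x ord0, [tuple of behead x]).
have mphi : measurable_fun setT phi.
  by apply/measurable_fun_pair; [exact: measurable_tnth|exact: measurable_behead].
have tb (x : n.+1.-tuple (measurableTypeR R)) i : tnth [tuple of behead x] i = tnth x (lift ord0 i).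
  by rewrite [in RHS](tuple_eta x) tnthS.
apply: kernel_factor_sub (kernel_factor_comp mphi k2) => [z /= nz|z /=].
  by split => [|i]; rewrite ?tb; exact: nz.
rewrite big_ord_recl; congr (_ * _); apply: eq_bigr => i _.
by rewrite !tb.
Qed.

Lemma indic_itvE (i : interval R) (z : R) : \1_([set` i]) z = (z \in i)%:R :> R.
Proof. by rewrite indicE; congr (nat_of_bool _)%:R; apply/idP/idP => [/set_mem//|h]; exact: mem_set. Qed.

(* Overlaps of two translates of an interval are positive semidefinite; with
   q the inverse length, [|x - y|^(-b)] is a mixture of them:
   the integral over q > 0 of [q^b (1/q - |x - y|)_+] is
   [|x - y|^(-b) / (b (b + 1))]. *)
Lemma integral_overlap (b c : R) : 0 < b < 1 -> 0 < c ->
  (\int[mu]_q (\1_`]0, +oo[ q * (q `^ b * Num.max (q `^ (-1) - c) 0))%:E =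
    ((b * (b + 1))^-1 * c `^ (- b))%:E)%E.
Proof.
move=> /andP[b0 b1] c0.
have bm1 : -1 < b by lra.
have bm2 : -1 < b - 1 by lra.
have ci : 0 <= c^-1 by rewrite invr_ge0 ltW.
(* The integrand vanishes past [q = 1/c]. *)
pose J : set R := `]0, c^-1]%classic.
pose f (q : R) := q `^ b * (q `^ (-1) - c).
have f0 q : J q -> 0 <= f q.
  rewrite /J/= in_itv/= => /andP[q0 qc]; rewrite mulr_ge0 ?powR_ge0// subr_ge0.
  by rewrite (powR_inv1 (ltW q0)) -[c]invrK lef_pV2// posrE invr_gt0.
have mJ : measurable J by exact: measurable_itv.
have mf : measurable_fun setT f.
  apply: measurable_funM; first exact: measurable_powR.
  by apply: measurable_funB => //; exact: measurable_powR.
have -> : (\int[mu]_q (\1_`]0, +oo[ q * (q `^ b * Num.max (q `^ (-1) - c) 0))%:E =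
    \int[mu]_(q in J) (f q)%:E)%E.
  rewrite -[in RHS]integral_mulr_indic; apply: eq_integral => q _; congr EFin.
  have [q0|q0] := ltP 0 q; last first.
    by rewrite /J !indic_itvE !in_itv/= andbT ltNge q0 /= mul0r mulr0.
  rewrite /J !indic_itvE !in_itv/= q0 /= mul1r; have [qc|qc] := leP q c^-1.
    have Jq : J q by rewrite /J/= in_itv/= q0.
    rewrite mulr1 /f; congr (_ * _); apply/max_idPl.
    by have := f0 _ Jq; rewrite pmulr_rge0// powR_gt0.
  rewrite mulr0 (max_idPr _) ?mulr0// subr_le0 (powR_inv1 (ltW q0)) -[leRHS]invrK lef_pV2 ?posrE ?invr_gt0//.
  exact: ltW.
have dist0 a : -1 < a -> (\int[mu]_(q in J) (q `^ a)%:E = ((a + 1)^-1 * c `^ (- (a + 1)))%:E)%E.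
  move=> a1; transitivity (\int[mu]_(q in J) (`|q - 0| `^ a)%:E)%E.
    apply: eq_integral => q; rewrite inE /J/= in_itv/= => /andP[q0 _].
    by rewrite subr0 gtr0_norm.
  rewrite /J integral_powR_dist// !subr0 pow_prim0// subr0 /pow_prim ci.
  by rewrite -(powR_inv1 (ltW c0)) -powRrM mulN1r.
have e1 := dist0 _ bm2; have e2 := dist0 _ bm1.
(* The unknown integral is isolated additively: the other two are finite multiples of powers of [c],
   so it is finite as well and the identity can be solved for it. *)
have split : (\int[mu]_(q in J) (q `^ (b - 1))%:E =
    \int[mu]_(q in J) (f q)%:E + c%:E * \int[mu]_(q in J) (q `^ b)%:E)%E.
  rewrite -ge0_integralZl_EFin//; last 2 first.
  - by apply/measurable_EFinP; apply: measurable_funTS; exact: measurable_powR.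
  - exact: ltW.
  rewrite -ge0_integralD//; last 3 first.
  - by apply/measurable_EFinP; exact: measurable_funTS.
  - by move=> q _; rewrite -EFinM lee_fin mulr_ge0 ?powR_ge0// ltW.
  - apply/measurable_EFinP; apply: measurable_funM => //.
    by apply: measurable_funTS; exact: measurable_powR.
  apply: eq_integral => q; rewrite inE /J/= in_itv/= => /andP[q0 _].
  by rewrite -EFinM -EFinD; congr EFin; rewrite /f powRD_gt0//; ring.
  by move=> q _; rewrite lee_fin powR_ge0.
have I0 : (0 <= \int[mu]_(q in J) (f q)%:E)%E.
  by apply: integral_ge0 => q Jq; rewrite lee_fin f0.
move: split I0; rewrite e1 e2 -EFinM; case: (\int[mu]_(q in J) _)%E => // r.
rewrite -EFinD => -[e3] _; congr EFin; move: e3.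
rewrite subrK (_ : - (b + 1) = - b + (- 1)); last by ring.
rewrite powRD_gt0// (powR_inv1 (ltW c0)) => e3.
have {e3} -> : r = b^-1 * c `^ (- b) - c * ((b + 1)^-1 * (c `^ (- b) * c^-1)) by rewrite e3; ring.
by field; rewrite !gt_eqF//; lra.
Qed.

(** Weighted indicator of [u < x <= u + 1/q] for [x = z.1], [q = z.2.1 > 0] and [u = z.2.2]. The
    product of two of them integrates over [u] to an overlap of translates, and the weights multiply
    to [b (b + 1) q^b]. *)
Definition overlap_factor (b : R) (z : R * (R * R)) : R :=
  Num.sqrt (b * (b + 1)) * (\1_`]0, +oo[ z.2.1 * z.2.1 `^ (b / 2)) *
  (\1_`]0, +oo[ (z.1 - z.2.2) * \1_`]-oo, 0] (z.1 - z.2.2 - z.2.1 `^ (-1))).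

Lemma measurable_overlap_factor b : measurable_fun setT (overlap_factor b).
Proof.
have m1 : measurable_fun setT (fun z : R * (R * R) => z.2.1).
  exact: (measurableT_comp measurable_fst measurable_snd).
have m2 : measurable_fun setT (fun z : R * (R * R) => z.1 - z.2.2).
  apply: measurable_funB => //.
  exact: (measurableT_comp measurable_snd measurable_snd).
apply: measurable_funM; apply: measurable_funM => //.
- apply: measurable_funM; first exact: (measurableT_comp (measurable_indic_itv _) m1).
  by apply: (measurableT_comp (f := @powR R ^~ (b / 2))).
- exact: (measurableT_comp (measurable_indic_itv _) m2).
- apply: (measurableT_comp (measurable_indic_itv _)).
  apply: measurable_funB => //.
  by apply: (measurableT_comp (f := @powR R ^~ (-1))).
Qed.

Lemma overlap_factor_ge0 b z : 0 <= overlap_factor b z.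
Proof. by rewrite !mulr_ge0// ?sqrtr_ge0// powR_ge0. Qed.

Lemma integral_indic_itv_overlap (x y q : R) : 0 < q ->
  (\int[mu]_u (\1_`]0, +oo[ (x - u) * \1_`]-oo, 0] (x - u - q) *
     (\1_`]0, +oo[ (y - u) * \1_`]-oo, 0] (y - u - q)))%:E =
   (Num.max (q - `|x - y|) 0)%:E)%E.
Proof.
move=> q0.
pose lo := Num.max x y - q; pose hi := Num.min x y.
pose J : set R := `[lo, hi[%classic.
transitivity (\int[mu]_u (\1_J u)%:E)%E.
  apply: eq_integral => u _; congr EFin; rewrite /J !indic_itvE -!natrM !mulnb.
  congr (nat_of_bool _)%:R; rewrite !in_itv/= !andbT /lo /hi.
  have [xy|xy] := leP x y; apply/idP/idP => [/andP[/andP[h1 h2] /andP[h3 h4]]|/andP[h1 h2]];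
  by [apply/andP; split; lra|apply/andP; split; apply/andP; split; lra].
rewrite integral_indic//; last exact: measurable_itv.
rewrite setIT; transitivity (mu J) => //; rewrite /J lebesgue_measure_itv/=.
have hl : hi - lo = q - `|x - y|.
  rewrite /hi /lo; have [xy|xy] := leP x y.
    by rewrite ler0_norm ?subr_le0//; ring.
  by rewrite gtr0_norm ?subr_gt0//; ring.
rewrite lte_fin; case: ifPn => h.
  by rewrite -EFinB hl (max_idPl _)// -hl subr_ge0 ltW.
by rewrite (max_idPr _)// -hl subr_le0 leNgt.
Qed.

(** Restricted to distinct points: on the diagonal the power is 0 by convention, whereas the mixture
    diverges. *)
Lemma kernel_factor_powR (b : R) : 0 < b < 1 ->
  @kernel_factor _ (measurableTypeR R) (fun z => z.1 <> z.2)
    (fun z => `|(z.1 : R) - z.2| `^ (- b)).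
Proof.
move=> b01; have /andP[b0 b1] := b01.
exists _, (measurableTypeR R * measurableTypeR R)%type, (sfprod mu mu), (overlap_factor b).
split; [exact: measurable_overlap_factor|by move=> z; exact: overlap_factor_ge0|].
move=> [x y] /= xy.
have c0 : 0 < `|x - y| by rewrite normr_gt0 subr_eq0; apply/eqP.
have m1 p : measurable_fun setT (fun w => overlap_factor b (p, w)).
  by apply: (measurableT_comp (measurable_overlap_factor b)); exact: pair1_measurable.
rewrite sfprod_tonelli; last 2 first.
- by apply/measurable_EFinP; apply: measurable_funM; exact: m1.
- by move=> w; rewrite lee_fin mulr_ge0// overlap_factor_ge0.
have bb : 0 <= b * (b + 1) by rewrite mulr_ge0//; lra.
transitivity (\int[mu]_q ((b * (b + 1))%:E *
   (\1_`]0, +oo[ q * (q `^ b * Num.max (q `^ (-1) - `|x - y|) 0))%:E))%E.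
  rewrite ge0_integralZl_EFin//; last 2 first.
  - by move=> q _; rewrite lee_fin !mulr_ge0 ?powR_ge0// le_max lexx orbT.
  - apply/measurable_EFinP; apply: measurable_funM; first exact: measurable_indic_itv.
    apply: measurable_funM; first exact: measurable_powR.
    apply: measurable_maxr => //; apply: measurable_funB => //; exact: measurable_powR.
  rewrite integral_overlap// -EFinM mulrA mulfV ?mul1r// gt_eqF// mulr_gt0//; lra.
apply: eq_integral => q _; rewrite -EFinM.
have [q0|q0] := ltP 0 q; last first.
  have i0 : \1_`]0, +oo[ q = 0 :> R.
    by rewrite indic_itvE in_itv/= andbT ltNge q0.
  rewrite i0 mul0r mulr0 -[LHS](integral0 mu setT).
  by apply: eq_integral => u _; rewrite /overlap_factor/= i0 !(mul0r, mulr0).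
have i1 : \1_`]0, +oo[ q = 1 :> R by rewrite indic_itvE in_itv/= q0.
rewrite i1 mul1r mulrA EFinM -integral_indic_itv_overlap ?powR_gt0//.
rewrite -ge0_integralZl_EFin//; last 2 first.
- have ms p : measurable_fun setT (fun u : R => p - u) by exact: measurable_funB.
  have ms2 p c : measurable_fun setT (fun u : R => p - u - c) by apply: measurable_funB.
  apply/measurable_EFinP; apply: measurable_funM; apply: measurable_funM;
  [exact: (measurableT_comp (measurable_indic_itv _) (ms x))
  |exact: (measurableT_comp (measurable_indic_itv _) (ms2 x _))
  |exact: (measurableT_comp (measurable_indic_itv _) (ms y))
  |exact: (measurableT_comp (measurable_indic_itv _) (ms2 y _))].
- by rewrite mulr_ge0// powR_ge0.
apply: eq_integral => u _; rewrite -EFinM; congr EFin.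
rewrite /overlap_factor/= i1 !mul1r.
have -> : q `^ b = q `^ (b / 2) * q `^ (b / 2) by rewrite -powRD_gt0//; congr (_ `^ _); lra.
rewrite -{1}(sqr_sqrtr bb); ring.
Qed.

End kernel_factor.

Section almost_everywhere.
Context d (T : measurableType d) (R : realType) (m : {measure set T -> \bar R}).

Lemma ae_imply (P Q : T -> Prop) : (forall x, P x -> Q x) ->
  {ae m, forall x, P x} -> {ae m, forall x, Q x}.
Proof. by move=> PQ; exact: filterS. Qed.

Lemma ae_and (P Q : T -> Prop) : {ae m, forall x, P x} -> {ae m, forall x, Q x} ->
  {ae m, forall x, P x /\ Q x}.
Proof. by apply: filterS2 => x. Qed.

Lemma ae_forall_fin (I : finType) (P : I -> T -> Prop) :
  (forall i, {ae m, forall x, P i x}) -> {ae m, forall x, forall i, P i x}.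
Proof. by move=> h; exact: filter_forall. Qed.

End almost_everywhere.

(** * Positivity of the form on space-time functions *)

Section hinner_parallelogram.
Context {R : realType} {d : nat} (H0 : R) (H : 'I_d -> R).
Hypothesis H0b : 2^-1 < H0 < 1.
Hypothesis Hb : forall i, 2^-1 < H i < 1.
Local Notation mu := (@lebesgue_measure R).
Local Notation spacetime := (measurableTypeR R * d.-tuple (measurableTypeR R))%type.
Local Notation lst := (@lebesgue_spacetime R d).
Local Notation D := (@nonneg_times R d).

Definition offdiag : set (spacetime * spacetime) :=
  [set z | z.1.1 <> z.2.1 /\ forall i, tnth z.1.2 i <> tnth z.2.2 i].

Lemma kernel_factor_hkernel :
  kernel_factor offdiag (fun z : spacetime * spacetime => hkernel H0 H z.1 z.2).
Proof.
have k0 : @kernel_factor _ _ (measurableTypeR R) (fun z => z.1 <> z.2)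
    (fun z => `|(z.1 : R) - z.2| `^ (2 * H0 - 2)).
  rewrite (_ : 2 * H0 - 2 = - (2 - 2 * H0)); last by ring.
  by apply: kernel_factor_powR; case/andP: H0b => *; apply/andP; split; lra.
have ki i : @kernel_factor R _ (measurableTypeR R) (fun z => z.1 <> z.2)
    (fun z => `|(z.1 : R) - z.2| `^ (2 * H i - 2)).
  rewrite (_ : 2 * H i - 2 = - (2 - 2 * H i)); last by ring.
  by apply: kernel_factor_powR; case/andP: (Hb i) => *; apply/andP; split; lra.
exact: (kernel_factor_prod k0 (kernel_factor_tuple ki)).
Qed.

Definition diag_indic (z : R * R) : R := \1_`[0, 0] (z.1 - z.2).

Lemma measurable_diag_indic : measurable_fun setT diag_indic.
Proof. by apply: (measurableT_comp (measurable_indic_itv _)); exact: measurable_funB. Qed.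

Lemma integral2_diag_indic : (\int[mu]_u \int[mu]_v (diag_indic (u, v))%:E = 0)%E.
Proof.
apply: integral0_eq => u _.
transitivity (\int[mu]_v (\1_[set u] v)%:E)%E.
  apply: eq_integral => v _; congr EFin; rewrite /diag_indic indic_itvE in_itv/= indicE.
  congr (nat_of_bool _)%:R; apply/idP/idP => [/andP[h1 h2]|]; rewrite inE /=.
    by apply/eqP; rewrite eq_le; apply/andP; split; lra.
  by move=> ->; rewrite subrr lexx.
rewrite integral_indic// setIT.
exact: lebesgue_measure_set1.
Qed.

(** Each coordinate diagonal is null: Tonelli is applied to the product of [diag_indic] in that
    coordinate and 1 in all others, where [0 * oo = 0] takes care of the infinite factors. *)
Lemma offdiag_ae : {ae sfprod lst lst, forall z, offdiag z}.
Proof.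
have one (f0 : R * R -> R) (f : 'I_d -> R * R -> R) :
  measurable_fun setT f0 -> (forall i, measurable_fun setT (f i)) ->
  (forall z, 0 <= f0 z) -> (forall i z, 0 <= f i z) ->
  ((\int[mu]_u \int[mu]_v (f0 (u, v))%:E) *
    \prod_(i < d) \int[mu]_u \int[mu]_v (f i (u, v))%:E = 0)%E ->
  {ae sfprod lst lst, forall z, f0 (z.1.1, z.2.1) * \prod_(i < d) f i (tnth z.1.2 i, tnth z.2.2 i) = 0}.
  move=> mf0 mf f00 f0i I0.
  have mF := measurable_spacetime_pair mf0 mf.
  have F0 z : 0 <= f0 (z.1.1, z.2.1) * \prod_(i < d) f i (tnth z.1.2 i, tnth z.2.2 i).
    by rewrite mulr_ge0// prodr_ge0.
  have I : (\int[sfprod lst lst]_z `|(f0 (z.1.1, z.2.1) * \prod_(i < d) f i (tnth z.1.2 i, tnth z.2.2 i))%:E| = 0)%E.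
    under eq_integral do rewrite gee0_abs ?lee_fin//.
    rewrite sfprod_tonelli//; last by exact/measurable_EFinP.
    by rewrite integral2_lebesgue_spacetime.
  have := (ae_eq_integral_abs (sfprod lst lst) measurableT _).1 I.
  move=> /(_ ((measurable_EFinP _ _).2 mF)).
  by move=> ae1; apply: filterS ae1 => z /(_ Logic.I) [].
have h0 : {ae sfprod lst lst, forall z, z.1.1 <> z.2.1}.
  have := one diag_indic (fun i _ => 1) measurable_diag_indic.
  move=> /(_ (fun=> measurable_cst _) (fun z => ltac:(by rewrite /diag_indic)) (fun _ _ => ler01)).
  rewrite integral2_diag_indic mul0e => /(_ erefl).
  apply: ae_imply => z; rewrite big1// mulr1 /diag_indic indic_itvE in_itv/= => /eqP.
  by rewrite pnatr_eq0 eqb0 => /negP h e; apply: h; rewrite e subrr lexx.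
have hi : {ae sfprod lst lst, forall z, forall i, tnth z.1.2 i <> tnth z.2.2 i}.
  apply: ae_forall_fin => i.
  have := one (fun=> 1) (fun j => if j == i then diag_indic else fun=> 1) (measurable_cst _).
  have mj j : measurable_fun setT (if j == i then diag_indic else fun=> 1).
    by case: eqP => // _; exact: measurable_diag_indic.
  have j0 j z : 0 <= (if j == i then diag_indic else fun=> 1) z :> R.
    by case: eqP => // _; rewrite /diag_indic.
  move=> /(_ mj (fun=> ler01) j0).
  rewrite [X in (_ * X)%E](bigD1 i)//= eqxx integral2_diag_indic mul0e mule0 => /(_ erefl).
  apply: ae_imply => z; rewrite mul1r (bigD1 i)//= eqxx big1 ?mulr1 => [|j /negbTE->//].
  rewrite /diag_indic indic_itvE in_itv/= => /eqP.
  by rewrite pnatr_eq0 eqb0 => /negP h e; apply: h; rewrite e subrr lexx.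
exact: ae_and h0 hi.
Qed.

Lemma hinner_restrict (f g : spacetime -> R) : hinner H0 H f g =
  ((alphaH H0 H)%:E * \int[sfprod lst lst]_z
    ((f \_ D) z.1 * (g \_ D) z.2 * hkernel H0 H z.1 z.2)%:E)%E.
Proof.
rewrite /hinner; congr (_ * _)%E; rewrite integral_mkcond; apply: eq_integral => z _.
rewrite !patchE; case: ifPn => [|/negP].
  by rewrite inE /= => -[h1 h2]; rewrite !mem_set.
rewrite inE /= => nD; have [h1|h1] := pselect (D z.1); last by rewrite memNset// !mul0r.
have h2 : ~ D z.2 by move=> h2; apply: nD.
by rewrite [X in _ * (if X then _ else _)]memNset// mulr0 mul0r.
Qed.

Lemma alphaH_gt0 : 0 < alphaH H0 H.
Proof.
have aux (h : R) : 2^-1 < h < 1 -> 0 < h * (2 * h - 1).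
  by move=> /andP[h1 h2]; rewrite mulr_gt0//; lra.
by rewrite /alphaH mulr_gt0// ?aux// prodr_gt0// => i _; rewrite aux.
Qed.

Lemma hinner_kernel_finite (f : spacetime -> R) :
  measurable_fun D f -> (hinner H0 H (fun p => `|f p|%R) (fun p => `|f p|%R) < +oo)%E ->
  kernel_finite lst (fun z => hkernel H0 H z.1 z.2) (f \_ D).
Proof.
move=> mf hf; split.
  by apply/(measurable_restrictT _ _).1 => //; exact: measurable_nonneg_times.
move: hf; rewrite hinner_restrict.
have -> : (fun p => `|f p|%R) \_ D = (fun p => `|(f \_ D) p|%R).
  by apply/funext => p; rewrite !patchE; case: ifP => //; rewrite normr0.
move=> h; rewrite ltey; apply/eqP => e; move: h; rewrite e.
by rewrite gt0_muley ?lte_fin ?alphaH_gt0.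
Qed.

(** Bounds the norm of an approximating step function, the variance of its integral, by the error
    and the norm of the integrand. *)
Lemma hinner_parallelogram (f h : spacetime -> R) :
  measurable_fun D f -> (hinner H0 H (fun p => `|f p|%R) (fun p => `|f p|%R) < +oo)%E ->
  measurable_fun D h -> (hinner H0 H (fun p => `|h p|%R) (fun p => `|h p|%R) < +oo)%E ->
  (hinner H0 H f f <= 2%:E * hinner H0 H (fun p => (f p - h p)%R) (fun p => (f p - h p)%R) +
   2%:E * hinner H0 H h h)%E.
Proof.
move=> mf ff mh fh.
have [dZ [Z [mz [g [mg g0 Kg]]]]] := kernel_factor_hkernel.
have KE : {ae sfprod lst lst, forall z : spacetime * spacetime,
    (hkernel H0 H z.1 z.2)%:E = \int[mz]_w (g (z.1, w) * g (z.2, w))%:E}%E.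
  by apply: filterS offdiag_ae => z; exact: Kg.
have := kernel_form_parallelogram (measurable_hkernel H0 H) (fun z => hkernel_ge0 H0 H z.1 z.2)
  mg g0 KE (hinner_kernel_finite mf ff) (hinner_kernel_finite mh fh).
rewrite !hinner_restrict.
have -> : (fun p => (f p - h p)%R) \_ D = (fun p => (f \_ D) p - (h \_ D) p).
  by apply/funext => p; rewrite !patchE; case: ifP => //; rewrite subr0.
have a0 : (0 <= (alphaH H0 H)%:E)%E by rewrite lee_fin ltW// alphaH_gt0.
(* Finiteness of this term allows [alphaH] to be distributed over the sum. *)
have If : (2%:E * \int[sfprod lst lst]_z
    ((h \_ D) z.1 * (h \_ D) z.2 * hkernel H0 H z.1 z.2)%:E)%E \is a fin_num.
  rewrite fin_numM//; apply: integrable_fin_num => //.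
  apply: (kernel_finite_integrable (measurable_hkernel H0 H) (fun z => hkernel_ge0 H0 H z.1 z.2)
     mg g0 KE); exact: hinner_kernel_finite.
move=> /(lee_wpmul2l a0); rewrite (muleDr _ (fin_num_adde_defl _ If))//.
by rewrite muleCA [X in (_ <= _ + X)%E]muleCA.
Qed.

End hinner_parallelogram.

(** * Gaussian exponential moments *)

Section density.
Local Open Scope ereal_scope.
Context d d' (W : measurableType d) (T : measurableType d') (R : realType).
Variables (nu : {measure set W -> \bar R}) (mu : {measure set T -> \bar R}).
Variables (phi : W -> T) (p : T -> R).
Hypothesis mphi : measurable_fun setT phi.
Hypothesis mp : measurable_fun setT p.
Hypothesis p0 : forall x, (0 <= p x)%R.
Hypothesis nuE : forall A, measurable A ->
  nu (phi @^-1` A) = \int[mu]_(x in A) (p x)%:E.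

Import HBNNSimple.

Let integral_density_nnsfun (h : {nnsfun T >-> R}) :
  \int[nu]_w (h (phi w))%:E = \int[mu]_x ((h x)%:E * (p x)%:E).
Proof.
under [LHS]eq_integral do rewrite fimfunE -fsumEFin//.
have mphiA A : measurable A -> measurable (phi @^-1` A).
  by move=> mA; rewrite -[X in measurable X]setTI; exact: mphi.
rewrite [LHS]ge0_integral_fsum//; last 2 first.
  - move=> r; apply/measurable_EFinP; apply: measurable_funM => //.
    by apply: (measurableT_comp (f := \1_(h @^-1` [set r]) : T -> R)).
  - by move=> n x _; rewrite EFinM nnfun_muleindic_ge0.
under [RHS]eq_integral.
  move=> x xD; rewrite fimfunE -fsumEFin// ge0_mule_fsuml; last first.
    by move=> r; rewrite EFinM nnfun_muleindic_ge0.
  over.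
rewrite [RHS]ge0_integral_fsum//; last 2 first.
  - move=> r; apply: emeasurable_funM; last exact/measurable_EFinP.
    by apply/measurable_EFinP; apply: measurable_funM.
  - by move=> n x _; apply: mule_ge0; [rewrite EFinM nnfun_muleindic_ge0|rewrite lee_fin].
apply: eq_fsbigr => r rh.
have r0 : (0 <= r)%R by move: rh; rewrite inE => -[x _ <-].
under [LHS]eq_integral do rewrite EFinM.
rewrite ge0_integralZl//; last first.
  - apply/measurable_EFinP.
    by apply: (measurableT_comp (f := \1_(h @^-1` [set r]) : T -> R)).
under [RHS]eq_integral do rewrite EFinM -muleA.
rewrite ge0_integralZl//; last 2 first.
  - by apply: emeasurable_funM; exact/measurable_EFinP.
  - by move=> x _; rewrite mule_ge0// lee_fin.
congr (_ * _); rewrite integral_indic_mull -nuE//.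
by rewrite -(setIT (phi @^-1` _)) -integral_indic//; exact: mphiA.
Qed.

(** The law is known on sets only; the formula passes through simple functions and monotone
    limits. *)
Lemma ge0_integral_density (f : T -> \bar R) : measurable_fun setT f ->
  (forall x, 0 <= f x) ->
  \int[nu]_w f (phi w) = \int[mu]_x (f x * (p x)%:E).
Proof.
move=> mf f0; pose f_ := nnsfun_approx measurableT mf.
have mf_ n : measurable_fun setT (fun x => (f_ n x)%:E) by exact/measurable_EFinP.
transitivity (limn (fun n => \int[nu]_w (f_ n (phi w))%:E)).
  rewrite -monotone_convergence//=.
  - by apply: eq_integral => x _; apply/esym/cvg_lim => //=; exact: cvg_nnsfun_approx.
  - by move=> n; exact: (measurableT_comp (mf_ n)).
  - by move=> n x _; rewrite lee_fin.
  - by move=> x _ a b ab; rewrite lee_fin//; exact/lefP/nd_nnsfun_approx.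
have -> : \int[mu]_x (f x * (p x)%:E) = limn (fun n => \int[mu]_x ((f_ n x)%:E * (p x)%:E)).
  rewrite -monotone_convergence//=.
  - apply: eq_integral => x _; apply/esym/cvg_lim => //.
    by apply: cvgeZr => //; exact: cvg_nnsfun_approx.
  - by move=> n; apply: emeasurable_funM => //; exact/measurable_EFinP.
  - by move=> n x _; rewrite mule_ge0// lee_fin.
  - move=> x _ a b ab; rewrite lee_wpmul2r ?lee_fin//; exact/lefP/nd_nnsfun_approx.
by congr (limn _); apply/funext => n /=; rewrite integral_density_nnsfun.
Qed.

End density.

Section gaussian_moments.
Context {disp} {Omega : measurableType disp} {R : realType} (P : probability Omega R).
Local Notation mu := (@lebesgue_measure R).

Lemma integral_prob_cst (r : R) : (\int[P]_w r%:E = r%:E)%E.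
Proof. by have := expectation_cst P r; rewrite unlock. Qed.

Lemma ge0_integral_normal (X : Omega -> R) (m s : R) (f : R -> \bar R) :
  measurable_fun setT X ->
  (forall Y : set R, measurable Y -> P (X @^-1` Y) = normal_prob m s Y) ->
  measurable_fun setT f -> (forall x, 0 <= f x)%E ->
  (\int[P]_w f (X w) = \int[mu]_x (f x * (normal_pdf m s x)%:E))%E.
Proof.
move=> mX PX mf f0; apply: (ge0_integral_density (nu := P) (mu := mu) mX) => //.
- exact: measurable_normal_pdf.
- by move=> x; exact: normal_pdf_ge0.
Qed.

(** Completing the square: the factor [expR (l x)] shifts the mean of the density to [m + l s^2]. *)
Lemma normal_mgf (X : Omega -> R) (m s l : R) : measurable_fun setT X -> s != 0 ->
  (forall Y : set R, measurable Y -> P (X @^-1` Y) = normal_prob m s Y) ->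
  (\int[P]_w (expR (l * X w))%:E = (expR (l * m + (l * s) ^+ 2 / 2))%:E)%E.
Proof.
move=> mX s0 PX; rewrite (ge0_integral_normal (f := fun x => (expR (l * x))%:E) mX PX); last 2 first.
- by apply/measurable_EFinP; apply: (measurableT_comp (@measurable_expR R)); exact: measurable_funM.
- by move=> x; rewrite lee_fin expR_ge0.
transitivity (\int[mu]_x ((expR (l * m + (l * s) ^+ 2 / 2))%:E * (normal_pdf (m + l * s ^+ 2) s x)%:E))%E.
  apply: eq_integral => x _; rewrite -!EFinM; congr EFin.
  rewrite !normal_pdfE// /normal_fun mulrCA [RHS]mulrCA; congr (_ * _).
  rewrite -!expRD; congr expR; field; exact: s0.
rewrite ge0_integralZl_EFin ?expR_ge0//.
- by rewrite integral_normal_pdf mule1.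
- by move=> x _; rewrite lee_fin normal_pdf_ge0.
- by apply/measurable_EFinP; exact: measurable_normal_pdf.
Qed.

(** The parameters of the law have to be tied to the two moments. The mean is 0 because
    [1 + k X <= expR (k X)] for every [k]; and [s^2 <= 8 q] because the density is too flat for [X]
    to lie within [s/2] of 0 with probability above 1/2. Hence [l^2 s^2 / 2 <= 4 l^2 q]. *)
Lemma gaussian_mgf_le (X : Omega -> R) (q l : R) : measurable_fun setT X ->
  gaussian_rv P X -> ('E_P[X] = 0)%E -> ('E_P[fun w => (X w ^+ 2)%R] = q%:E)%E ->
  (\int[P]_w (expR (l * X w))%:E <= (expR (4 * l ^+ 2 * q))%:E)%E.
Proof.
move=> mX [m [s [s0 PX]]]; rewrite unlock => EX EX2.
have q0 : 0 <= q.
  by rewrite -lee_fin -EX2; apply: integral_ge0 => w _; rewrite lee_fin sqr_ge0.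
have iX : P.-integrable setT (EFin \o X).
  apply/integrableP; split; first exact/measurable_EFinP.
  apply: (@le_lt_trans _ _ (\int[P]_w (1 + (X w ^+ 2)%R)%:E)%E).
    apply: ge0_le_integralT => // w.
    rewrite /= lee_fin -[X in _ + X]real_normK ?num_real//.
    by have := sqr_ge0 (`|X w| - 1); rewrite !expr2; have := normr_ge0 (X w); nra.
  under eq_integral do rewrite EFinD.
  rewrite ge0_integralD//; last 2 first.
  - by move=> w _; rewrite lee_fin sqr_ge0.
  - by apply/measurable_EFinP; exact: measurable_funX.
  by rewrite EX2 integral_prob_cst -EFinD ltry.
move: s0 PX; rewrite le_eqVlt => /predU1P[<-|s0] PX.
  have XE : {ae P, forall w, X w = m}.
    exists (X @^-1` ~` [set m]); split.
    - by rewrite -[X in measurable X]setTI; apply: mX => //; exact: measurableC.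
    - rewrite PX; last exact: measurableC.
      by rewrite /gaussian_law eqxx diracE memNset//= => /(_ erefl).
    - by move=> w /=.
  have m0 : m = 0.
    have := EX; rewrite (ae_eq_integral (cst m%:E))//.
    - by rewrite integral_prob_cst => -[].
    - exact/measurable_EFinP.
    - by apply: ae_imply XE => w /= ->.
  rewrite (ae_eq_integral (cst 1%E))//.
  - rewrite integral_prob_cst lee_fin -[leLHS]expR0 ler_expR.
    by apply: mulr_ge0 => //; rewrite mulr_ge0// sqr_ge0.
  - apply/measurable_EFinP; apply: (measurableT_comp (@measurable_expR R)).
    exact: measurable_funM.
  - by apply: ae_imply XE => w /= -> _; rewrite m0 mulr0 expR0.
have sn0 : s != 0 by rewrite gt_eqF.
have {}PX (Y : set R) : measurable Y -> P (X @^-1` Y) = normal_prob m s Y.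
  by move=> mY; rewrite PX// /gaussian_law (negbTE sn0).
have jensen k : 0 <= k * m + (k * s) ^+ 2 / 2.
  have mk : measurable_fun setT (fun w => k * X w) by exact: measurable_funM.
  have mek : measurable_fun setT (fun w => (expR (k * X w))%:E).
    by apply/measurable_EFinP; exact: (measurableT_comp (@measurable_expR R)).
  have ikX : P.-integrable setT (fun w => (k * X w)%:E).
    by under eq_fun do rewrite EFinM; exact: integrableZl.
  have i1 : P.-integrable setT (cst (1 : R)%:E) by exact: finite_measure_integrable_cst.
  rewrite -ler_expR expR0 -lee_fin -(normal_mgf k mX sn0 PX).
  have -> : (1%:E : \bar R) = (\int[P]_w (1 + k * X w)%:E)%E.
    under eq_integral do rewrite EFinD.
    rewrite integralD// integral_prob_cst.
    under eq_integral do rewrite EFinM.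
    by rewrite integralZl// EX mule0 adde0.
  apply: le_integral => //.
  - by under eq_fun do rewrite EFinD; exact: integrableD.
  - apply/integrableP; split => //.
    under eq_integral do rewrite gee0_abs ?lee_fin ?expR_ge0//.
    by rewrite (normal_mgf k mX sn0 PX) ltry.
  - by move=> w _; rewrite lee_fin expR_ge1Dx.
have m0 : m = 0.
  (* The minimizer of the quadratic [k m + k^2 s^2 / 2]. *)
  have := jensen (- (m / s ^+ 2)).
  have -> : - (m / s ^+ 2) * m + (- (m / s ^+ 2) * s) ^+ 2 / 2 = - ((m / s) ^+ 2 / 2).
    by field.
  rewrite oppr_ge0 pmulr_lle0// => h.
  have : (m / s) ^+ 2 == 0 by rewrite eq_le h sqr_ge0.
  by rewrite sqrf_eq0 mulf_eq0 invr_eq0 (negbTE sn0) orbF => /eqP.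
pose I : set R := `]- (s / 2), s / 2[%classic.
have mI : measurable I by exact: measurable_itv.
have mXI : measurable (X @^-1` I).
  by rewrite -[X in measurable X]setTI; exact: mX.
(* The density is at most [normal_peak s] and [I] has length [s]; [pi >= 2] gives
   [s / sqrt (2 pi s^2) <= 1/2]. *)
have PI : (P (X @^-1` I) <= (2^-1)%:E)%E.
  rewrite PX// /normal_prob.
  apply: (@le_trans _ _ (\int[mu]_(x in I) (normal_peak s)%:E)%E).
    by apply: ge0_le_integral_in => x _; rewrite lee_fin ?normal_pdf_ge0 ?normal_pdf_ub.
  rewrite integral_cst//= /I lebesgue_measure_itv/= lte_fin ifT; last by lra.
  rewrite -EFinB -EFinM lee_fin opprK.
  have -> : s / 2 + s / 2 = s by lra.
  rewrite /normal_peak mulrC ler_pdivrMr; last first.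
    by rewrite sqrtr_gt0 mulrn_wgt0// mulr_gt0 ?pi_gt0// exprn_gt0.
  have -> : s = 2^-1 * Num.sqrt ((2 * s) ^+ 2).
    by rewrite sqrtr_sqr gtr0_norm ?mulr_gt0// mulrA mulVf ?mul1r.
  rewrite ler_pM2l// ler_sqrt ?sqrtr_sqr; last first.
    by rewrite mulrn_wge0// mulr_ge0 ?pi_ge0 ?sqr_ge0.
  have := @pi_ge2 R; rewrite gtr0_norm; last by rewrite !mulr_gt0.
  have ss : 0 <= s ^+ 2 by exact: sqr_ge0.
  move=> p2; have := ler_wpM2l ss p2; rewrite exprMn -mulr_natr; lra.
have sq : s ^+ 2 <= 8 * q.
  (* Integrates the pointwise bound of [s^2/4] by [X^2] plus [s^2/4] times the indicator of [I]. *)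
  have h : ((s ^+ 2 / 4)%:E <= q%:E + (s ^+ 2 / 4)%:E * P (X @^-1` I))%E.
    have -> : P (X @^-1` I) = (\int[P]_w (\1_(X @^-1` I) w)%:E)%E.
      by rewrite integral_indic// setIT.
    have s4 : 0 <= s ^+ 2 / 4 by rewrite divr_ge0// sqr_ge0.
    have mi : measurable_fun setT (fun w => (\1_(X @^-1` I) w)%:E : \bar R).
      by apply/measurable_EFinP.
    rewrite -EX2 -ge0_integralZl_EFin// -ge0_integralD//; last 4 first.
    - by move=> w _; rewrite lee_fin sqr_ge0.
    - by apply/measurable_EFinP; exact: measurable_funX.
    - by move=> w _; rewrite -EFinM lee_fin mulr_ge0.
    - by apply: emeasurable_funM.
    rewrite -[leLHS](integral_prob_cst (s ^+ 2 / 4)); apply: ge0_le_integralT => // w.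
    rewrite -EFinM -EFinD lee_fin indicE.
    have [Iw|Iw] := pselect ((X @^-1` I) w).
      by rewrite mem_set// mulr1 lerDr sqr_ge0.
    rewrite memNset// mulr0 addr0.
    have : s / 2 <= `|X w|.
      rewrite leNgt ltr_norml; apply/negP => h; apply: Iw.
      by rewrite /I/= in_itv.
    rewrite -(real_normK (num_real (X w))) => h.
    have -> : s ^+ 2 / 4 = (s / 2) ^+ 2 by field.
    by rewrite ler_sqr ?nnegrE//; lra.
  have := le_trans h (leeD2l _ (lee_wpmul2l _ PI)).
  by rewrite -EFinM -EFinD lee_fin lee_fin => /(_ ltac:(by rewrite divr_ge0// sqr_ge0)); lra.
rewrite (normal_mgf l mX sn0 PX) m0 mulr0 add0r lee_fin ler_expR exprMn.
by have := ler_wpM2l (sqr_ge0 l) sq; lra.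
Qed.

(** With [m] the truncated value, [expR (l v) >= m expR (l (v - u)) >= m (1 + l (v - u))], and
    [m <= M]. *)
Lemma exp_min_lipschitz (l M u v : R) : 0 < M ->
  Num.min (expR (l * u)) M <= expR (l * v) + `|l| * M * `|v - u|.
Proof.
move=> M0; set m := Num.min _ _.
have m1 : m <= expR (l * u) by rewrite ge_min lexx.
have m2 : m <= M by rewrite ge_min lexx orbT.
have m0 : 0 <= m by rewrite le_min expR_ge0 ltW.
have h1 : m * expR (l * (v - u)) <= expR (l * v).
  have -> : l * v = l * u + l * (v - u) by ring.
  by rewrite expRD ler_wpM2r// expR_ge0.
have h2 := ler_wpM2l m0 (expR_ge1Dx (l * (v - u))).
have h3 : - (l * (v - u)) <= `|l| * `|v - u| by rewrite -normrM -normrN ler_norm.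
have h4 := ler_wpM2l m0 h3.
have h5 : m * (`|l| * `|v - u|) <= M * (`|l| * `|v - u|) by rewrite ler_wpM2r// mulr_ge0.
lra.
Qed.

(* Truncation turns L2 approximation into convergence of the (Lipschitz)
   truncated exponential moments, so no almost surely convergent subsequence is
   needed. *)
Lemma exp_moment_L2_closure (X : Omega -> R) (l C : R) : measurable_fun setT X ->
  (forall eta : R, 0 < eta -> exists X' : Omega -> R,
    [/\ measurable_fun setT X',
      (\int[P]_w ((X' w - X w) ^+ 2)%:E <= eta%:E)%E &
      (\int[P]_w (expR (l * X' w))%:E <= C%:E)%E]) ->
  (\int[P]_w (expR (l * X w))%:E <= C%:E)%E.
Proof.
move=> mX approx.
have mexp (Y : Omega -> R) : measurable_fun setT Y -> measurable_fun setT (fun w => (expR (l * Y w))%:E).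
  move=> mY; apply/measurable_EFinP; apply: (measurableT_comp (@measurable_expR R)).
  exact: measurable_funM.
have mmin (M : R) : measurable_fun setT (fun w => Num.min (expR (l * X w)) M).
  by apply: measurable_minr => //; apply/measurable_EFinP; exact: mexp.
have key (M : R) : 0 < M -> (\int[P]_w (Num.min (expR (l * X w)) M)%:E <= C%:E)%E.
  move=> M0; apply/lee_addgt0Pr => e e0.
  pose k := `|l| * M; have k0 : 0 <= k by rewrite mulr_ge0// ltW.
  (* As [|X' - X| <= a + (X' - X)^2 / a], a squared L2 error [a^2] costs at most [2 k a], which is
     at most [e] by this choice. *)
  pose a := e / (2 * (k + 1)); have a0 : 0 < a by rewrite divr_gt0// mulr_gt0//; lra.
  have [X' [mX' X'X X'C]] := approx (a * a) (mulr_gt0 a0 a0).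
  have msq : measurable_fun setT (fun w => (X' w - X w) ^+ 2).
    by apply: measurable_funX; exact: measurable_funB.
  have ka : 0 <= k / a by rewrite divr_ge0// ltW.
  have ka2 : 0 <= k * a by rewrite mulr_ge0// ltW.
  apply: (@le_trans _ _ (\int[P]_w ((expR (l * X' w))%:E + ((k * a)%:E + (k / a)%:E * ((X' w - X w) ^+ 2)%:E)))%E).
    apply: ge0_le_integralT => w; first by rewrite lee_fin le_min expR_ge0 ltW.
    rewrite -EFinM -!EFinD lee_fin.
    rewrite (le_trans (exp_min_lipschitz l (X w) (X' w) M0))// lerD2l -/k.
    have -> : k * a + k / a * (X' w - X w) ^+ 2 = k * (a + (X' w - X w) ^+ 2 / a) by ring.
    rewrite ler_wpM2l//.
    have -> : a + (X' w - X w) ^+ 2 / a = (a ^+ 2 + (X' w - X w) ^+ 2) / a.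
      by field; rewrite gt_eqF.
    rewrite ler_pdivlMr// -(real_normK (num_real (X' w - X w))).
    by have := sqr_ge0 (`|X' w - X w| - a); have := normr_ge0 (X' w - X w); nra.
  rewrite ge0_integralD//; last 3 first.
  - exact: mexp.
  - by move=> w _; rewrite -EFinM -EFinD lee_fin addr_ge0// mulr_ge0// sqr_ge0.
  - by apply: emeasurable_funD => //; apply: emeasurable_funM => //; exact/measurable_EFinP.
  apply: leeD => //.
  rewrite ge0_integralD//; last 2 first.
  - by move=> w _; rewrite -EFinM lee_fin mulr_ge0// sqr_ge0.
  - by apply: emeasurable_funM => //; exact/measurable_EFinP.
  rewrite integral_prob_cst ge0_integralZl_EFin//; last 2 first.
  - by move=> w _; rewrite lee_fin sqr_ge0.
  - exact/measurable_EFinP.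
  apply: (@le_trans _ _ ((k * a)%:E + (k / a)%:E * (a * a)%:E)%E).
    by rewrite leeD2l// lee_wpmul2l.
  rewrite -EFinM -EFinD lee_fin.
  have -> : k * a + k / a * (a * a) = 2 * k * a by field; rewrite gt_eqF.
  rewrite /a mulrA ler_pdivrMr; last by rewrite mulr_gt0//; lra.
  by rewrite mulrC ler_wpM2l ?ltW//; lra.
have -> : (\int[P]_w (expR (l * X w))%:E =
    limn (fun n : nat => \int[P]_w (Num.min (expR (l * X w)) n.+1%:R)%:E))%E.
  rewrite -monotone_convergence//.
  - apply: eq_integral => w _; apply/esym/cvg_lim => //.
    apply: cvg_EFin; first by near=> n.
    apply: cvg_near_cst; near=> n; apply/min_idPl.
    have : (Num.truncn (expR (l * X w)) <= n)%N by near: n; exact: nbhs_infty_ge.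
    by move=> h; rewrite ltW// (lt_le_trans (truncnS_gt _))// ler_nat.
  - by move=> n; exact/measurable_EFinP.
  - move=> w _ a b ab; rewrite lee_fin le_min ge_min lexx /= ge_min orbC.
    by rewrite ler_nat ltnS ab.
apply: lime_le; last by near=> n; exact: key.
apply: ereal_nondecreasing_is_cvgn => a b ab; apply: ge0_le_integralT => w.
  by rewrite lee_fin le_min expR_ge0 ler0n.
by rewrite lee_fin le_min ge_min lexx /= ge_min orbC ler_nat ltnS ab.
Unshelve. all: by end_near. Qed.

End gaussian_moments.

(** * Exponential moments of Wiener integrals *)

Lemma ereal_cvg0_le {R : realType} (T : Type) (F : set_system T) {FF : Filter F}
    (u : T -> \bar R) (e : R) : 0 < e -> u x @[x --> F] --> 0%E ->
  \forall x \near F, (u x <= e%:E)%E.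
Proof.
move=> e0 uF; have e0' : (0%R%:E < e%:E)%E by rewrite lte_fin.
have h : \forall x \near F, (u x < e%:E)%E := uF _ (open_ereal_lt' e0').
by near=> x; apply/ltW; near: x.
Unshelve. all: by end_near. Qed.

Section wiener_exponential.
Context {R : realType} {d : nat} (H0 : R) (H : 'I_d -> R).
Hypothesis H0b : 2^-1 < H0 < 1.
Hypothesis Hb : forall i, 2^-1 < H i < 1.
Context {disp} {Omega : measurableType disp} (P : probability Omega R).
Variable W : R -> d.-tuple R -> {RV P >-> R}.
Hypothesis sheetW : fractional_brownian_sheet H0 H W.

Let covW (s u : R) (x y : d.-tuple R) : R :=
  fbm_cov H0 s u * \prod_(i < d) fbm_cov (H i) (tnth x i) (tnth y i).

Let EWW s u x y : 0 <= s -> 0 <= u ->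
  (\int[P]_w (W u x w * W s y w)%:E = (covW s u x y)%:E)%E.
Proof. by case: sheetW => _ _ h s0 u0; have := h s u x y s0 u0; rewrite unlock. Qed.

Let iWW s u x y : 0 <= s -> 0 <= u ->
  P.-integrable setT (fun w => (W u x w * W s y w)%:E).
Proof.
move=> s0 u0; apply/integrableP; split.
  by apply/measurable_EFinP; exact: measurable_funM.
apply: (@le_lt_trans _ _ (\int[P]_w ((W u x w * W u x w)%:E + (W s y w * W s y w)%:E))%E).
  apply: ge0_le_integralT => // w.
  rewrite -EFinD lee_fin normrM.
  have := sqr_ge0 (`|W u x w| - `|W s y w|).
  have e1 : W u x w * W u x w = `|W u x w| ^+ 2 by rewrite real_normK ?num_real// expr2.
  have e2 : W s y w * W s y w = `|W s y w| ^+ 2 by rewrite real_normK ?num_real// expr2.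
  have : 0 <= `|W u x w| * `|W s y w| by rewrite mulr_ge0.
  rewrite e1 e2 !expr2; lra.
rewrite ge0_integralD//; last 4 first.
- by move=> w _; rewrite lee_fin -expr2 sqr_ge0.
- by apply/measurable_EFinP; exact: measurable_funM.
- by move=> w _; rewrite lee_fin -expr2 sqr_ge0.
- by apply/measurable_EFinP; exact: measurable_funM.
by rewrite !EWW// -EFinD ltry.
Qed.

Let iW u x : 0 <= u -> P.-integrable setT (EFin \o W u x).
Proof.
move=> u0; apply/integrableP; split; first exact/measurable_EFinP.
apply: (@le_lt_trans _ _ (\int[P]_w (1%:E + (W u x w * W u x w)%:E))%E).
  apply: ge0_le_integralT => // w.
  rewrite -EFinD /= lee_fin.
  have := sqr_ge0 (`|W u x w| - 1).
  have e1 : W u x w * W u x w = `|W u x w| ^+ 2 by rewrite real_normK ?num_real// expr2.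
  have : 0 <= `|W u x w| by [].
  rewrite e1 !expr2; lra.
rewrite ge0_integralD//; last 2 first.
- by move=> w _; rewrite lee_fin -expr2 sqr_ge0.
- by apply/measurable_EFinP; exact: measurable_funM.
by rewrite EWW// integral_prob_cst -EFinD ltry.
Qed.

Section combination.
Variables (I : finType) (a : I -> R) (tau : I -> R) (xi : I -> d.-tuple R).
Hypothesis tau0 : forall i, 0 <= tau i.

Let Y (w : Omega) : R := \sum_(i : I) a i * W (tau i) (xi i) w.

Lemma sheet_combination_measurable : measurable_fun setT Y.
Proof. by apply: measurable_sum => i; exact: measurable_funM. Qed.

Lemma sheet_combination_gaussian : gaussian_rv P Y.
Proof.
case: sheetW => h _ _.
have := h #|I| (fun k => a (enum_val k)) (fun k => tau (enum_val k))
  (fun k => xi (enum_val k)) (fun k => tau0 _).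
rewrite (_ : (fun w => _) = Y)//; apply/funext => w.
rewrite /Y (reindex (@enum_val I I))//=; last first.
  by exists enum_rank => i _; rewrite ?enum_valK ?enum_rankK.
Qed.

Lemma sheet_combination_mean : (\int[P]_w (Y w)%:E = 0)%E.
Proof.
rewrite /Y; under eq_integral do rewrite -sumEFin.
rewrite integral_sum//.
  rewrite big1// => i _; under eq_integral do rewrite EFinM.
  rewrite integralZl//; last exact: iW.
  case: sheetW => _ h _; have := h (tau i) (xi i) (tau0 i); rewrite unlock => ->.
  by rewrite mule0.
by move=> i; under eq_fun do rewrite EFinM; apply: integrableZl => //; exact: iW.
Qed.

Lemma sheet_combination_variance :
  (\int[P]_w ((Y w) ^+ 2)%:E =
   (\sum_i \sum_j a i * a j * covW (tau j) (tau i) (xi i) (xi j))%:E)%E.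
Proof.
have iaW i j : P.-integrable setT (fun w => (a i * a j * (W (tau i) (xi i) w * W (tau j) (xi j) w))%:E).
  by under eq_fun do rewrite EFinM; apply: integrableZl => //; exact: iWW.
transitivity (\int[P]_w (\sum_i \sum_j
    (a i * a j * (W (tau i) (xi i) w * W (tau j) (xi j) w))%:E))%E.
  apply: eq_integral => w _; under eq_bigr do rewrite sumEFin; rewrite sumEFin.
  congr EFin; rewrite expr2 /Y big_distrlr/=; apply: eq_bigr => i _.
  by apply: eq_bigr => j _; ring.
rewrite integral_sum//; last by move=> i; exact: integrable_sum.
rewrite -sumEFin; apply: eq_bigr => i _.
rewrite integral_sum// -sumEFin; apply: eq_bigr => j _.
under eq_integral do rewrite EFinM.
by rewrite integralZl ?EWW ?EFinM//; exact: iWW.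
Qed.

End combination.

(** Expansion of the product over the choice, in each coordinate, of the upper or the lower value;
    [S] collects the upper ones. *)
Lemma sum_corner (F : 'I_d -> R -> R) (x y : d.-tuple R) :
  \sum_(S : {set 'I_d}) (-1) ^+ #|~: S| * \prod_(i < d) F i (tnth (corner x y S) i) =
  \prod_(i < d) (F i (tnth y i) - F i (tnth x i)).
Proof.
rewrite (bigA_distr _ _ (fun i => F i (tnth y i)) (fun i => - F i (tnth x i))).
apply: eq_bigr => S _.
have -> : (-1) ^+ #|~: S| = \prod_(i < d) (if i \in S then 1 else -1) :> R.
  rewrite -prodr_const big_mkcond/=; apply: eq_bigr => i _.
  by rewrite inE; case: (i \in S).
rewrite -big_split/=; apply: eq_bigr => i _.
by rewrite /corner tnth_mktuple; case: ifP; rewrite ?mul1r ?mulN1r.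
Qed.

Let sgnb (b : bool) : R := if b then 1 else -1.

Section step.
Variable f : @step R d.

(** Indexes the values of the sheet in a step integral: rectangle, spatial corner, upper or lower
    time. *)
Let I : finType := ('I_(step_size f) * ({set 'I_d} * bool))%type.
Let ca (i : I) : R := step_coef i.1 * ((-1) ^+ #|~: i.2.1| * sgnb i.2.2).
Let ct (i : I) : R := if i.2.2 then time_hi (step_rect i.1) else time_lo (step_rect i.1).
Let cx (i : I) : d.-tuple R := corner (space_lo (step_rect i.1)) (space_hi (step_rect i.1)) i.2.1.

Let sumI (F : I -> R) : \sum_(i : I) F i =
  \sum_(k < step_size f) \sum_(S : {set 'I_d}) (F (k, (S, true)) + F (k, (S, false))).
Proof.
under [RHS]eq_bigr => k _.
  under eq_bigr => S _ do rewrite -(big_bool _ (fun b => F (k, (S, b)))).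
  rewrite (pair_bigA _ (fun S b => F (k, (S, b)))).
  over.
rewrite (pair_bigA _ (fun k p => F (k, (p.1, p.2)))).
by apply: eq_bigr => -[k [S b]].
Qed.

Let step_integralE w : step_integral W f w = \sum_(i : I) ca i * W (ct i) (cx i) w.
Proof.
rewrite sumI; apply: eq_bigr => k _; rewrite /increment mulr_sumr; apply: eq_bigr => S _.
by rewrite /ca /ct /cx /=; ring.
Qed.

(** Used once for each of the two arguments of the covariance, to turn covariances of corner values
    into covariances of increments. *)
Let sum_step (G0 : R -> R) (G : 'I_d -> R -> R) :
  \sum_(i : I) ca i * (G0 (ct i) * \prod_(j < d) G j (tnth (cx i) j)) =
  \sum_(k < step_size f) step_coef k *
    ((G0 (time_hi (step_rect k)) - G0 (time_lo (step_rect k))) *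
     \prod_(j < d) (G j (tnth (space_hi (step_rect k)) j) - G j (tnth (space_lo (step_rect k)) j))).
Proof.
rewrite sumI; apply: eq_bigr => k _.
rewrite -sum_corner !mulr_sumr; apply: eq_bigr => S _.
by rewrite /ca /ct /cx /sgnb /=; ring.
Qed.

Let ct0 i : 0 <= ct i.
Proof.
rewrite /ct; case: ifP => _; last exact: time_lo_ge0.
exact: le_trans (time_lo_ge0 _) (time_le _).
Qed.

Let step_integral_fun : step_integral W f = (fun w => \sum_(i : I) ca i * W (ct i) (cx i) w).
Proof. exact/funext/step_integralE. Qed.

Lemma measurable_step_integral : measurable_fun setT (step_integral W f).
Proof. by rewrite step_integral_fun; exact: sheet_combination_measurable. Qed.

Lemma gaussian_step_integral : gaussian_rv P (step_integral W f).
Proof. by rewrite step_integral_fun; exact: sheet_combination_gaussian. Qed.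

Lemma step_integral_mean : (\int[P]_w (step_integral W f w)%:E = 0)%E.
Proof. by rewrite step_integral_fun; exact: sheet_combination_mean. Qed.

Let fbm_covC h (s u : R) : fbm_cov h s u = fbm_cov h u s.
Proof. by rewrite /fbm_cov distrC [X in X - _]addrC. Qed.

(** Both sides are the same quadratic form in the covariances of rectangle increments: the left by
    collapsing the corner sums, the right by [hinner_step]. *)
Lemma step_integral_variance :
  (\int[P]_w ((step_integral W f w) ^+ 2)%:E = hinner H0 H (step_fun f) (step_fun f))%E.
Proof.
rewrite step_integral_fun sheet_combination_variance// hinner_step//; congr EFin.
transitivity (\sum_(i : I) \sum_(l < step_size f) ca i * step_coef l *
   ((fbm_cov H0 (time_hi (step_rect l)) (ct i) - fbm_cov H0 (time_lo (step_rect l)) (ct i)) *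
    \prod_(j < d) (fbm_cov (H j) (tnth (cx i) j) (tnth (space_hi (step_rect l)) j) -
                   fbm_cov (H j) (tnth (cx i) j) (tnth (space_lo (step_rect l)) j)))).
  apply: eq_bigr => i _.
  have := sum_step (fun u => fbm_cov H0 u (ct i)) (fun j u => fbm_cov (H j) (tnth (cx i) j) u).
  move=> /(congr1 (fun x => ca i * x)); rewrite !mulr_sumr => e.
  transitivity (\sum_(j : I) ca i * (ca j * (fbm_cov H0 (ct j) (ct i) *
     \prod_(j0 < d) fbm_cov (H j0) (tnth (cx i) j0) (tnth (cx j) j0)))).
    by apply: eq_bigr => j _; rewrite /covW -mulrA.
  by rewrite e; apply: eq_bigr => l _; rewrite mulrA.
rewrite exchange_big [RHS]exchange_big /=; apply: eq_bigr => l _.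
transitivity (step_coef l * \sum_(i : I) ca i *
   ((fbm_cov H0 (time_hi (step_rect l)) (ct i) - fbm_cov H0 (time_lo (step_rect l)) (ct i)) *
    \prod_(j < d) (fbm_cov (H j) (tnth (cx i) j) (tnth (space_hi (step_rect l)) j) -
                   fbm_cov (H j) (tnth (cx i) j) (tnth (space_lo (step_rect l)) j)))).
  by rewrite mulr_sumr; apply: eq_bigr => i _; ring.
rewrite (sum_step (fun u => fbm_cov H0 (time_hi (step_rect l)) u - fbm_cov H0 (time_lo (step_rect l)) u)
  (fun j u => fbm_cov (H j) u (tnth (space_hi (step_rect l)) j) -
              fbm_cov (H j) u (tnth (space_lo (step_rect l)) j))).
rewrite mulr_sumr; apply: eq_bigr => k _; rewrite /rect_incr /fbm_incr.
rewrite !(fbm_covC H0 (time_hi (step_rect l))) !(fbm_covC H0 (time_lo (step_rect l))).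
ring.
Qed.

End step.

Definition abs_step (f : @step R d) : @step R d :=
  @Step R d (step_size f) (fun k => `|step_coef k|) (@step_rect _ _ f).

Lemma measurable_indic_rect (r : @rect R d) : measurable_fun setT (\1_(rect_set r) : _ -> R).
Proof.
rewrite (funext (indic_rectE r)); apply: measurable_funM.
  exact: (measurableT_comp (measurable_indic_itv _)).
apply: measurable_prod => i _.
apply: (measurableT_comp (measurable_indic_itv _)).
apply: (measurableT_comp (f := (@tnth d _)^~ i)) => //; exact: measurable_tnth.
Qed.

Lemma measurable_step_fun (f : @step R d) : measurable_fun setT (step_fun f).
Proof.
apply: measurable_sum => k; apply: measurable_funM => //.
exact: measurable_indic_rect.
Qed.

(** The rectangles may overlap, so [|f|] cannot be read off from the coefficients; it is dominated
    by the step function with absolute coefficients, whose norm is finite by [hinner_step]. *)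
Lemma step_finite (f : @step R d) :
  (hinner H0 H (fun p => `|step_fun f p|%R) (fun p => `|step_fun f p|%R) < +oo)%E.
Proof.
apply: (@le_lt_trans _ _ (hinner H0 H (step_fun (abs_step f)) (step_fun (abs_step f)))); last first.
  by rewrite hinner_step// ltry.
have abs_le p : `|step_fun f p| <= step_fun (abs_step f) p.
  rewrite /step_fun (le_trans (ler_norm_sum _ _ _))//; apply: ler_sum => k _.
  by rewrite normrM (ger0_norm (_ : 0 <= \1_(rect_set (step_rect k)) p)).
rewrite /hinner lee_wpmul2l//; first by rewrite lee_fin ltW// alphaH_gt0.
apply: ge0_le_integral_in => z _.
- by rewrite lee_fin mulr_ge0 ?hkernel_ge0// mulr_ge0.
- by rewrite lee_fin ler_wpM2r ?hkernel_ge0//; apply: ler_pM.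
Qed.

(** Approximants within squared distance 1 of [phi] have squared norm at most [2 + 2 q] by the
    parallelogram bound; the Gaussian estimate for their integrals survives the L2 limit. *)
Lemma wiener_exponential_le (phi : measurableTypeR R * d.-tuple (measurableTypeR R) -> R)
    (X : Omega -> R) (q l : R) :
  wiener_integral H0 H W phi X -> (hinner H0 H phi phi <= q%:E)%E ->
  (\int[P]_w (expR (l * X w))%:E <= (expR (4 * l ^+ 2 * (2 + 2 * q)))%:E)%E.
Proof.
move=> [mphi phi_fin mX [f [f1 f2]]] phiq.
apply: exp_moment_L2_closure => // eta eta0.
have [n [n1 n2]] : exists n, (hinner H0 H (fun p => step_fun (f n) p - phi p)%R
    (fun p => step_fun (f n) p - phi p)%R <= 1%:E)%E /\
    ('E_P[fun w => ((step_integral W (f n) w - X w) ^+ 2)%R] <= eta%:E)%E.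
  have a1 : \forall n \near \oo, (hinner H0 H (fun p => step_fun (f n) p - phi p)%R
    (fun p => step_fun (f n) p - phi p)%R <= 1%:E)%E.
    exact: ereal_cvg0_le f1.
  have a2 : \forall n \near \oo,
      ('E_P[fun w => ((step_integral W (f n) w - X w) ^+ 2)%R] <= eta%:E)%E.
    exact: ereal_cvg0_le f2.
  by have [n _ /(_ n (leqnn n)) h] : \forall n \near \oo, _ /\ _ := filterI a1 a2; exists n.
exists (step_integral W (f n)); split.
- exact: measurable_step_integral.
- by move: n2; rewrite unlock.
have sq : (hinner H0 H (step_fun (f n)) (step_fun (f n)) <= (2 + 2 * q)%:E)%E.
  apply: (le_trans (hinner_parallelogram H0b Hb _ (step_finite (f n)) mphi phi_fin)).
    by apply: measurable_funTS; exact: measurable_step_fun.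
  rewrite [leRHS]EFinD; apply: leeD.
    by rewrite -[leRHS]mule1 lee_wpmul2l.
  by rewrite EFinM lee_wpmul2l.
have := step_integral_variance (f n); rewrite hinner_step// in sq *.
set q' := (\sum_(k < _) _) in sq * => v.
apply: (@le_trans _ _ (expR (4 * l ^+ 2 * q'))%:E).
  apply: gaussian_mgf_le.
  - exact: measurable_step_integral.
  - exact: gaussian_step_integral.
  - by rewrite unlock; exact: step_integral_mean.
  - by rewrite unlock.
by rewrite lee_fin ler_expR ler_wpM2l//; apply: mulr_ge0 => //; exact: sqr_ge0.
Qed.

End wiener_exponential.

(** * Independence *)

Section independence.
Context {disp} {Omega : measurableType disp} {R : realType} (P : probability Omega R).
Local Open Scope ereal_scope.

(** Independence identifies the law of the pair with the product of the laws; Tonelli then freezes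
    [V]. *)
Lemma indep_joint_integral d1 d2 (T1 : measurableType d1) (T2 : measurableType d2)
    (U : Omega -> T1) (V : Omega -> T2) (f : T1 * T2 -> \bar R) :
  measurable_fun setT U -> measurable_fun setT V ->
  (forall A B, measurable A -> measurable B ->
    P (U @^-1` A `&` V @^-1` B) = P (U @^-1` A) * P (V @^-1` B)) ->
  measurable_fun setT f -> (forall z, 0 <= f z) ->
  \int[P]_w f (U w, V w) = \int[P]_w \int[P]_w' f (U w', V w).
Proof.
move=> mU mV UV mf f0.
pose U' : {mfun Omega >-> T1} := HB.pack U (isMeasurableFun.Build _ _ _ _ _ mU).
pose V' : {mfun Omega >-> T2} := HB.pack V (isMeasurableFun.Build _ _ _ _ _ mV).
have mUV : measurable_fun setT (fun w => (U w, V w)) by exact: measurable_fun_pair.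
pose UV' : {mfun Omega >-> (T1 * T2)%type} := HB.pack (fun w => (U w, V w))
  (isMeasurableFun.Build _ _ _ _ _ mUV).
have -> : \int[P]_w f (U w, V w) = \int[distribution P UV']_z f z.
  by rewrite ge0_integral_pushforward.
transitivity (\int[distribution P U' \x distribution P V']_z f z).
  apply: eq_measure_integral => A mA _; apply/esym.
  by apply: product_measure_unique => // B C mB mC; rewrite -[RHS]UV.
rewrite fubini_tonelli2//=.
have mF : measurable_fun setT (fun y => \int[distribution P U']_x f (x, y)).
  exact: measurable_fun_fubini_tonelli_G.
rewrite /distribution ge0_integral_pushforward//=; last first.
  by move=> y _; exact: integral_ge0.
apply: eq_integral => w _.
rewrite /fubini_G ge0_integral_pushforward//.
exact: (measurableT_comp mf (measurable_pair2 _)).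
Qed.

(** Seen through identity maps into [Omega] with the two coarser sigma-algebras, the two copies of
    the sample point are independent, and [F] is jointly measurable for these structures. So the
    diagonal value [F w w] integrates like [F w' w]. *)
Lemma product_system_integral (I1 I2 : Type) (D1 : set I1) (D2 : set I2)
    (X1 : I1 -> Omega -> R) (X2 : I2 -> Omega -> R) (F : Omega -> Omega -> R)
    (f : R -> \bar R) :
  (forall i, D1 i -> measurable_fun setT (X1 i)) ->
  (forall i, D2 i -> measurable_fun setT (X2 i)) ->
  independent_systems P (sigma_generated D1 X1) (sigma_generated D2 X2) ->
  (forall Y : set R, measurable Y ->
     product_system (sigma_generated D1 X1) (sigma_generated D2 X2)
       ((fun ww => F ww.1 ww.2) @^-1` Y)) ->
  measurable_fun setT f -> (forall x, 0 <= f x) ->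
  [/\ measurable_fun setT (fun w => f (F w w)),
    measurable_fun setT (fun w => \int[P]_w' f (F w' w)) &
    \int[P]_w f (F w w) = \int[P]_w \int[P]_w' f (F w' w)].
Proof.
move=> mX1 mX2 ind mF mf f0.
pose T1 := g_sigma_algebraType (\bigcup_(i in D1) preimage_set_system setT (X1 i) measurable).
pose T2 := g_sigma_algebraType (\bigcup_(i in D2) preimage_set_system setT (X2 i) measurable).
have sub (I : Type) (D : set I) (X : I -> Omega -> R) :
    (forall i, D i -> measurable_fun setT (X i)) -> sigma_generated D X `<=` measurable.
  move=> mX; apply: smallest_sub; first exact: sigma_algebra_measurable.
  by move=> _ [i Di [Y mY <-]]; exact: mX.
have mF' : measurable_fun setT ((fun ww => F ww.1 ww.2) : T1 * T2 -> R).
  move=> _ Y mY; rewrite setTI measurable_prod_measurableType; exact: mF.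
have mfF : measurable_fun setT (fun z : T1 * T2 => f (F z.1 z.2)).
  exact: (measurableT_comp mf mF').
have mid1 : measurable_fun setT (idfun : Omega -> T1).
  by move=> _ A mA; rewrite setTI; exact: sub mA.
have mid2 : measurable_fun setT (idfun : Omega -> T2).
  by move=> _ A mA; rewrite setTI; exact: sub mA.
have h : measurable_fun setT (fun z : Omega * Omega => f (F z.1 z.2)).
  rewrite (_ : (fun z => _) = (fun z : T1 * T2 => f (F z.1 z.2)) \o
    (fun z : Omega * Omega => (idfun z.1 : T1, idfun z.2 : T2)))//.
  apply: (measurableT_comp mfF); apply: measurable_fun_pair.
    exact: (measurableT_comp mid1).
  exact: (measurableT_comp mid2).
split.
- exact: (measurableT_comp h (measurable_fun_pair (@measurable_id _ _ setT) (@measurable_id _ _ setT))).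
- exact: (measurable_fun_fubini_tonelli_G (m1 := P) _ h).
- exact: (@indep_joint_integral _ _ T1 T2 idfun idfun (fun z => f (F z.1 z.2))).
Qed.

(** Cylinders over the indices in [D] are stable under intersection and generate a sigma-algebra
    containing [A]. On them the restriction of [P] to the event of [X i] and the scaled [P] agree,
    hence also at [A] by uniqueness of measures. *)
Lemma indep_sigma_generated (I : finType) (X : I -> Omega -> R) (D : set I) (i : I)
    (A : set Omega) (Y : set R) :
  (forall j, measurable_fun setT (X j)) -> mutually_independent P X ->
  ~ D i -> sigma_generated D X A -> measurable Y ->
  P (A `&` X i @^-1` Y) = P A * P (X i @^-1` Y).
Proof.
move=> mX indX nDi DA mY.
pose cyl (Z : I -> set R) := \bigcap_(j in [set: I]) (X j @^-1` Z j).
pose G : set (set Omega) := [set C | exists Z : I -> set R,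
  [/\ forall j, measurable (Z j), forall j, ~ D j -> Z j = setT & C = cyl Z]].
have mpre j Z : measurable Z -> measurable (X j @^-1` Z).
  by move=> mZ; rewrite -[X in measurable X]setTI; exact: mX.
have mcyl Z : (forall j, measurable (Z j)) -> measurable (cyl Z).
  move=> mZ; apply: fin_bigcap_measurable => [|j _]; first exact: finite_finset.
  exact: mpre.
have mG : G `<=` measurable by move=> _ [Z [mZ _ ->]]; exact: mcyl.
have GI : setI_closed G.
  move=> _ _ [Z1 [mZ1 Z1T ->]] [Z2 [mZ2 Z2T ->]].
  exists (fun j => Z1 j `&` Z2 j); split.
  - by move=> j; exact: measurableI.
  - by move=> j Dj; rewrite Z1T// Z2T// setTI.
  - by rewrite /cyl -bigcapI; apply: eq_bigcapr => j _; rewrite preimage_setI.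
have GT : G setT.
  exists (fun=> setT); split => //.
  by rewrite /cyl; apply/esym/seteqP; split => w.
have GA : <<s G >> A.
  apply: DA; split; first exact: smallest_sigma_algebra.
  move=> _ [j Dj [Z mZ <-]]; rewrite setTI; apply: sub_sigma_algebra.
  exists (fun k => if k == j then Z else setT); split.
  - by move=> k; case: ifP.
  - by move=> k nDk; case: eqP => // kj; case: nDk; rewrite kj.
  - apply/seteqP; split => w /=.
      by move=> Zw k _; case: eqP => // ->.
    by move=> /(_ j Logic.I) /=; rewrite eqxx.
have mYi := mpre i Y mY.
have PYi : (0 <= fine (P (X i @^-1` Y)))%R by rewrite fine_ge0.
pose m1 := mrestr P mYi.
pose m2 := mscale (NngNum PYi) P.
have m2E C : m2 C = P C * P (X i @^-1` Y).
  by rewrite muleC /m2 /mscale /= fineK// fin_num_measure.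
have E : m1 A = m2 A.
  apply: (@g_sigma_algebra_measure_unique _ _ _ G mG (fun=> setT)) => //.
  - by rewrite bigcup_const//; exists 0%N.
  - move=> _ [Z [mZ ZT ->]]; rewrite [RHS]m2E /m1 /= /mrestr.
    pose Z' j := if j == i then Y else Z j.
    have -> : cyl Z `&` X i @^-1` Y = cyl Z'.
      apply/seteqP; split => w /=.
        by move=> [Zw Yw] j _; rewrite /Z'/=; case: eqP => [->//|_]; exact: Zw.
      move=> Z'w; split => [j _|].
        have := Z'w j Logic.I; rewrite /Z'/=; case: eqP => [->|//].
        by rewrite ZT.
      by have := Z'w i Logic.I; rewrite /Z'/= eqxx.
    rewrite !indX//; last by move=> j; rewrite /Z'; case: ifP.
    rewrite (bigD1 i)//= [in RHS](bigD1 i)//= {1}/Z' eqxx ZT// preimage_setT probability_setT mul1e muleC.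
    by congr (_ * _); apply: eq_bigr => j ji; rewrite /Z' (negbTE ji).
  - by move=> _; rewrite /= /mrestr setTI ltey_eq fin_num_measure.
by rewrite -m2E -E.
Qed.

End independence.

(** * The norm of the mollified integrand *)

Lemma lee_prode (R : realType) (I : finType) (f g : I -> \bar R) :
  (forall i, 0 <= f i <= g i)%E -> (\prod_i f i <= \prod_i g i)%E.
Proof.
move=> fg; suff /andP[] : (0 <= \prod_i f i <= \prod_i g i)%E by [].
elim/big_ind2 : _ => [|x1 x2 y1 y2 /andP[x10 x12] /andP[y10 y12]|i _] //.
  by rewrite lexx lee01.
by rewrite mule_ge0//= lee_pmul.
Qed.

Lemma measurable_max_powR d (T : measurableType d) (R : realType) (g : T -> R) (e a : R) :
  measurable_fun setT g -> measurable_fun setT (fun z => Num.max `|g z| e `^ a).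
Proof.
move=> mg; apply: (measurableT_comp (f := @powR R ^~ a)) => //.
by apply: measurable_maxr => //; exact: (measurableT_comp (f := @Num.norm R R)).
Qed.

Section mollification.
Context {R : realType}.
Local Notation mu := (@lebesgue_measure R).

Section swap.
Local Open Scope ereal_scope.
Context dT (T : measurableType dT) (m : {sigma_finite_measure set T -> \bar R}).
Variables (k : measurableTypeR R * T -> R) (K : T * T -> R) (phi : T -> R).
Hypotheses (mk : measurable_fun setT k) (k0 : forall z, (0 <= k z)%R).
Hypotheses (mK : measurable_fun setT K) (K0 : forall z, (0 <= K z)%R).
Hypothesis phi0 : forall p, (0 <= phi p)%R.
Hypothesis phi_le : forall p, (phi p)%:E <= \int[mu]_s (k (s, p))%:E.

Let k4 (x : ((T * T) * measurableTypeR R) * measurableTypeR R) : \bar R :=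
  (k (x.1.2, x.1.1.1) * (k (x.2, x.1.1.2) * K x.1.1))%:E.

Let mk4 : measurable_fun setT k4.
Proof.
apply/measurable_EFinP; apply: measurable_funM; [|apply: measurable_funM].
- apply: (measurableT_comp mk); apply: measurable_fun_pair.
    exact: (measurableT_comp measurable_snd).
  by do 2!apply: (measurableT_comp measurable_fst).
- apply: (measurableT_comp mk); apply: measurable_fun_pair => //.
  by apply: (measurableT_comp measurable_snd); apply: (measurableT_comp measurable_fst).
- by apply: (measurableT_comp mK); apply: (measurableT_comp measurable_fst).
Qed.

Let k4_ge0 x : 0 <= k4 x.
Proof. by rewrite lee_fin !mulr_ge0. Qed.

(** Each [phi] is replaced by a time integral of [k] and the time integrals are moved outside; in
    the application [k] is, at fixed times, a product of one-dimensional densities. *)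
Lemma integral_mollified :
  \int[sfprod m m]_z (phi z.1 * phi z.2 * K z)%:E <=
  \int[mu]_s \int[mu]_s' \int[m]_p \int[m]_q
    (k (s, p) * (k (s', q) * K (p, q)))%:E.
Proof.
have mks p : measurable_fun setT (fun s => (k (s, p))%:E).
  by apply/measurable_EFinP; exact: (measurableT_comp mk (measurable_pair2 _)).
have m3 : measurable_fun setT (fun x : (T * T) * measurableTypeR R => \int[mu]_s' k4 (x, s')).
  exact: measurable_integral_snd.
apply: (@le_trans _ _ (\int[sfprod m m]_z \int[mu]_s \int[mu]_s' k4 ((z, s), s'))).
  apply: ge0_le_integralT => z; first by rewrite lee_fin !mulr_ge0.
  rewrite /k4 /=.
  under eq_integral => s _.
    under eq_integral => s' _ do rewrite EFinM [X in _ * X]EFinM.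
    rewrite ge0_integralZl//; last 3 first.
    - by apply: emeasurable_funM.
    - by move=> s' _; rewrite mule_ge0 ?lee_fin.
    - by rewrite lee_fin.
    rewrite ge0_integralZr//; last 2 first.
    - by move=> s' _; rewrite lee_fin.
    - by rewrite lee_fin.
    over.
  rewrite ge0_integralZr//; last 2 first.
  - by move=> s _; rewrite lee_fin.
  - by rewrite mule_ge0 ?lee_fin// integral_ge0// => s _; rewrite lee_fin.
  rewrite -mulrA !EFinM; apply: lee_pmul => //; rewrite ?mule_ge0 ?lee_fin//.
  by apply: lee_pmul; rewrite ?lee_fin.
rewrite (fubini_tonelli (m1 := sfprod m m) (m2 := mu) _ m3); last first.
  by move=> x; exact: integral_ge0.
rewrite le_eqVlt; apply/orP; left; apply/eqP; apply: eq_integral => s _.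
have m2 : measurable_fun setT (fun x : (T * T) * measurableTypeR R => k4 ((x.1, s), x.2)).
  apply: (measurableT_comp mk4); apply: measurable_fun_pair => //.
  by apply: measurable_fun_pair.
rewrite (fubini_tonelli (m1 := sfprod m m) (m2 := mu) _ m2)//.
apply: eq_integral => s' _; rewrite sfprod_tonelli//=.
exact: (measurableT_comp m2 (measurable_pair2 s')).
Qed.

End swap.

(** Smoothing in [v] leaves [max(|x' - u|, eta)^(-b)], which is bounded by the bare singularity
    [|x' - u|^(-b)] so that smoothing applies again in [u]; hence the squared constant. *)
Lemma smoothing2 (b eta x x' : R) (rho rho' : R -> R) : 0 < b < 1 -> 0 < eta ->
  measurable_fun setT rho -> (forall r, 0 <= rho r) ->
  (\int[mu]_r (rho r)%:E <= 1)%E ->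
  (forall r, rho r * `|r - x| <= 1) -> (forall r, rho r * eta <= 1) ->
  measurable_fun setT rho' -> (forall r, 0 <= rho' r) ->
  (\int[mu]_r (rho' r)%:E <= 1)%E ->
  (forall r, rho' r * `|r - x'| <= 1) -> (forall r, rho' r * eta <= 1) ->
  (\int[mu]_u \int[mu]_v (rho u * rho' v * `|u - v| `^ (- b))%:E <=
   (smooth_const b ^+ 2 * Num.max `|x - x'| eta `^ (- b))%:E)%E.
Proof.
move=> b01 eta0 mrho rho0 irho rho1 rho2 mrho' rho'0 irho' rho'1 rho'2.
have c0 : 0 <= smooth_const b.
  by case/andP: b01 => _ /smooth_const_gt0 /ltW.
have mk : measurable_fun setT (fun z : R * R => (rho z.1 * rho' z.2 * `|z.1 - z.2| `^ (- b))%:E).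
  apply/measurable_EFinP; apply: measurable_funM; last exact: measurable_powR_dist2.
  by apply: measurable_funM; [exact: (measurableT_comp mrho)|exact: (measurableT_comp mrho')].
have mrb (y : R) : measurable_fun setT (fun v : R => (rho v * `|v - y| `^ (- b))%:E).
  by apply/measurable_EFinP; apply: measurable_funM => //; exact: measurable_powR_dist.
have mrb' (y : R) : measurable_fun setT (fun v : R => (rho' v * `|v - y| `^ (- b))%:E).
  by apply/measurable_EFinP; apply: measurable_funM => //; exact: measurable_powR_dist.
apply: (@le_trans _ _ (\int[mu]_u ((smooth_const b)%:E * (rho u * `|u - x'| `^ (- b))%:E))%E).
  apply: ae_ge0_le_integral => //.
  - by move=> u _; apply: integral_ge0 => v _; rewrite lee_fin !mulr_ge0// powR_ge0.
  - apply: (measurable_integral_snd mu mk) => z.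
    by rewrite lee_fin !mulr_ge0// powR_ge0.
  - by move=> u _; rewrite mule_ge0// lee_fin// mulr_ge0// powR_ge0.
  - by apply: emeasurable_funM => //; exact: mrb.
  (* At [u = x'] the bare power is 0 by convention and the bound may fail; a single point is
     null. *)
  - exists [set x']; split => //.
      exact: lebesgue_measure_set1.
    move=> u /= h; apply: contrapT => ux; apply: h => _.
    have dux : 0 < `|x' - u| by rewrite normr_gt0 subr_eq0; apply/eqP => e; apply: ux.
    under eq_integral => v _ do rewrite -mulrA EFinM distrC.
    rewrite ge0_integralZl//; last 3 first.
    - exact: mrb'.
    - by move=> v _; rewrite lee_fin mulr_ge0// powR_ge0.
    - by rewrite lee_fin.
    rewrite -EFinM mulrCA EFinM lee_wpmul2l ?lee_fin//.
    have sm := smoothing u b01 eta0 mrho' rho'0 irho' rho'1 rho'2.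
    apply: (le_trans sm).
    rewrite lee_fin ler_wpM2l// [in leRHS]distrC.
    by apply: powR_le_neg => //; [case/andP: b01; lra|rewrite le_max lexx].
rewrite ge0_integralZl//; last 2 first.
- exact: mrb.
- by move=> v _; rewrite lee_fin mulr_ge0// powR_ge0.
rewrite expr2 -mulrA [leRHS]EFinM lee_wpmul2l ?lee_fin//.
exact: (smoothing x' b01 eta0 mrho rho0 irho rho1 rho2).
Qed.

Lemma normal_pdf_shift (m s y : R) : s != 0 -> normal_pdf 0 s (m - y) = normal_pdf m s y.
Proof.
move=> s0; rewrite (normal_pdfE 0 s0) (normal_pdfE m s0) /normal_fun.
by rewrite subr0 -(opprB y m) sqrrN.
Qed.

Let peak_scale (s : R) : 0 < s -> normal_peak s * s <= 1.
Proof.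
move=> s0; have s1 : s != 0 by rewrite gt_eqF.
have p0 : 0 < s ^+ 2 * pi *+ 2 by rewrite mulrn_wgt0// mulr_gt0 ?pi_gt0// exprn_gt0.
rewrite /normal_peak mulrC ler_pdivrMr ?sqrtr_gt0// mul1r.
rewrite -[leLHS](gtr0_norm s0) -sqrtr_sqr ler_sqrt; last exact: ltW.
have := @pi_ge2 R; have ss : 0 <= s ^+ 2 by exact: sqr_ge0.
by move=> p2; have := ler_wpM2l ss p2; rewrite -mulr_natr; lra.
Qed.

Lemma normal_pdf_scale (m s y : R) : 0 < s -> normal_pdf m s y * s <= 1.
Proof.
move=> s0; apply: (le_trans _ (peak_scale s0)).
by rewrite ler_wpM2r ?(ltW s0)// normal_pdf_ub// gt_eqF.
Qed.

(** For [z = |y - m| / s], [z <= 1 + z^2 / 2 <= expR (z^2 / 2)]; the remaining factor is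
    [peak_scale]. *)
Lemma normal_pdf_dist (m s y : R) : 0 < s -> normal_pdf m s y * `|y - m| <= 1.
Proof.
move=> s0; rewrite normal_pdfE ?gt_eqF//.
set r := `|y - m|; have r0 : 0 <= r / s by apply: divr_ge0; [exact: normr_ge0|exact: ltW].
have -> : normal_fun m s y = expR (- ((r / s) ^+ 2 / 2)).
  rewrite /normal_fun -(real_normK (num_real (y - m))) -/r; congr expR.
  by field; rewrite gt_eqF.
have h : expR (- ((r / s) ^+ 2 / 2)) * (r / s) <= 1.
  rewrite expRN mulrC ler_pdivrMr ?expR_gt0// mul1r.
  apply: le_trans (expR_ge1Dx _).
  by have := sqr_ge0 (r / s - 1); rewrite !expr2; lra.
have -> : normal_peak s * expR (- ((r / s) ^+ 2 / 2)) * r =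
    (normal_peak s * s) * (expR (- ((r / s) ^+ 2 / 2)) * (r / s)).
  by field; rewrite gt_eqF.
by rewrite -[leRHS]mulr1; apply: ler_pM => //;
  rewrite ?peak_scale// mulr_ge0 ?expR_ge0 ?normal_peak_ge0// ltW.
Qed.

Lemma heat_kernelE d (eps : R) (z : d.-tuple R) : 0 < eps ->
  heat_kernel eps z = \prod_(i < d) normal_pdf 0 (Num.sqrt eps) (tnth z i).
Proof.
move=> e0; have se0 : Num.sqrt eps != 0 by rewrite gt_eqF// sqrtr_gt0.
under eq_bigr do rewrite normal_pdfE//.
rewrite big_split/= /heat_kernel; congr (_ * _).
  rewrite prodr_const card_ord /normal_peak sqr_sqrtr ?(ltW e0)//.
  have p0 : 0 < 2 * pi * eps by rewrite !mulr_gt0// pi_gt0.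
  have -> : eps * pi *+ 2 = 2 * pi * eps by rewrite -mulr_natr; ring.
  rewrite exprVn powRN; congr (_^-1).
  by rewrite -powR12_sqrt ?(ltW p0)// -powR_mulrn ?powR_ge0// -powRrM [2^-1 * _]mulrC.
rewrite /normal_fun -expR_sum; congr expR.
rewrite -sumrN mulr_suml; apply: eq_bigr => i _.
by rewrite subr0 sqr_sqrtr ?(ltW e0)// -[eps *+ 2]mulr_natl.
Qed.

Lemma box_kernelE (delta a r : R) :
  box_kernel delta (a - r) = delta^-1 * \1_`[a - delta, a] r.
Proof.
rewrite /box_kernel !indic_itvE; congr (_ * _%:R).
by rewrite !in_itv/= subr_ge0 lerBlDr -lerBlDl andbC.
Qed.

Lemma integral_box_kernel (delta a : R) : 0 < delta ->
  (\int[mu]_r (box_kernel delta (a - r))%:E = 1)%E.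
Proof.
move=> d0; under eq_integral do rewrite box_kernelE EFinM.
have mI : measurable (`[a - delta, a]%classic : set R) by exact: measurable_itv.
rewrite ge0_integralZl//; last 2 first.
- by apply/measurable_EFinP; exact: measurable_indic_itv.
- by rewrite lee_fin invr_ge0 ltW.
transitivity ((delta^-1)%:E * mu `[(a - delta)%R, a])%E.
  by rewrite integral_indic// setIT.
rewrite lebesgue_measure_itv/= lte_fin ifT; last by lra.
by rewrite -EFinB -EFinM subKr mulVf// gt_eqF.
Qed.


Context (d : nat) (H0 : R) (H : 'I_d -> R).
Hypothesis H0b : 2^-1 < H0 < 1.
Hypothesis Hb : forall i, 2^-1 < H i < 1.

(* The covariance kernel of the white noise seen along a path, smoothed at the
   scales of the mollifiers. *)
Definition path_kernel (eps delta : R) (s : R) (y : 'I_d -> R) : R :=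
  Num.max `|s| delta `^ (- (2 - 2 * H0)) *
  \prod_(i < d) Num.max `|y i| (Num.sqrt eps) `^ (- (2 - 2 * H i)).

Lemma path_kernel_ge0 (eps delta s : R) (y : 'I_d -> R) : 0 <= path_kernel eps delta s y.
Proof. by rewrite mulr_ge0 ?powR_ge0// prodr_ge0// => i _; exact: powR_ge0. Qed.

Lemma path_kernel_le0 (eps delta s : R) (y : 'I_d -> R) : 0 < eps -> 0 < delta ->
  path_kernel eps delta s y <= path_kernel eps delta 0 (fun=> 0).
Proof.
move=> e0 d0; have H0' : 0 <= 2 - 2 * H0 by have := H0b; lra.
have pw (z c b : R) : 0 < c -> 0 <= b -> Num.max `|z| c `^ (- b) <= Num.max `|0| c `^ (- b).
  move=> c0 b0; rewrite normr0 [in leRHS](max_idPr (ltW c0)).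
  by apply: powR_le_neg => //; rewrite le_max lexx orbT.
apply: ler_pM; rewrite ?powR_ge0//; [|exact: pw|].
  by rewrite prodr_ge0// => i _; exact: powR_ge0.
apply: ler_prod => i _; rewrite powR_ge0/= pw ?sqrtr_gt0//.
by have := Hb i; lra.
Qed.

Lemma measurable_path_kernel dT (T : measurableType dT) (eps delta : R) (s : T -> R)
    (y : T -> 'I_d -> R) : measurable_fun setT s ->
  (forall i, measurable_fun setT (y ^~ i)) ->
  measurable_fun setT (fun z => path_kernel eps delta (s z) (y z)).
Proof.
move=> ms my; apply: measurable_funM; first exact: measurable_max_powR.
by apply: measurable_prod => i _; exact: measurable_max_powR.
Qed.

Definition mollified_const : R :=
  alphaH H0 H * (smooth_const (2 - 2 * H0) ^+ 2 *
    \prod_(i < d) smooth_const (2 - 2 * H i) ^+ 2).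

Section path.
Variables (t eps delta : R) (x : d.-tuple R) (b : 'I_d -> R -> R).
Hypotheses (eps0 : 0 < eps) (delta0 : 0 < delta).
Hypothesis mb : forall i, measurable_fun setT (b i).

Local Notation spacetime := (measurableTypeR R * d.-tuple (measurableTypeR R))%type.

Let A (p : spacetime) : R := \1_(`[0, t]) (p.1 : R) *
  \int[@lebesgue_measure R]_(s in `[0, t])
    (box_kernel delta (t - s - p.1) *
     heat_kernel eps [tuple b i s + tnth x i - tnth p.2 i | i < d]).

Let rho0 (s u : R) : R := box_kernel delta (t - s - u).
Let rho (i : 'I_d) (s u : R) : R := normal_pdf (b i s + tnth x i) (Num.sqrt eps) u.

(** Apart from the indicator, at a fixed time [z.1] this is a product of one-dimensional densities,
    uniform in time and Gaussian in space. *)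
Let k (z : measurableTypeR R * spacetime) : R :=
  \1_(`[0, t]) (z.1 : R) * (rho0 z.1 z.2.1 * \prod_(i < d) rho i z.1 (tnth z.2.2 i)).

Let heatE s y : heat_kernel eps [tuple b i s + tnth x i - tnth y i | i < d] =
  \prod_(i < d) rho i s (tnth y i).
Proof.
rewrite heat_kernelE//; apply: eq_bigr => i _; rewrite tnth_mktuple normal_pdf_shift//.
by rewrite gt_eqF// sqrtr_gt0.
Qed.

Let rho0_ge0 s u : 0 <= rho0 s u.
Proof. by rewrite /rho0 /box_kernel mulr_ge0// invr_ge0 ltW. Qed.

Let rho_ge0 i s u : 0 <= rho i s u.
Proof. exact: normal_pdf_ge0. Qed.

Let mbox : measurable_fun setT (box_kernel delta : R -> R).
Proof. by apply: measurable_funM => //; exact: measurable_indic_itv. Qed.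

Let mrho0 : measurable_fun setT (fun z : measurableTypeR R * spacetime => rho0 z.1 z.2.1).
Proof.
apply: (measurableT_comp mbox); apply: measurable_funB; first exact: measurable_funB.
exact: (measurableT_comp measurable_fst).
Qed.

Let mrho i : measurable_fun setT
  (fun z : measurableTypeR R * spacetime => rho i z.1 (tnth z.2.2 i)).
Proof.
rewrite (_ : (fun z => _) = (fun z : measurableTypeR R * spacetime =>
  normal_pdf 0 (Num.sqrt eps) (b i z.1 + tnth x i - tnth z.2.2 i))); last first.
  by apply/funext => z; rewrite normal_pdf_shift// gt_eqF// sqrtr_gt0.
apply: (measurableT_comp (measurable_normal_pdf _ _)).
apply: measurable_funB; first by apply: measurable_funD => //; exact: (measurableT_comp (mb i)).
apply: (measurableT_comp (f := (@tnth d _)^~ i)); first exact: measurable_tnth.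
exact: (measurableT_comp measurable_snd).
Qed.

Let mk : measurable_fun setT k.
Proof.
apply: measurable_funM; first exact: (measurableT_comp (measurable_indic_itv _)).
by apply: measurable_funM => //; apply: measurable_prod => i _.
Qed.

Let k_ge0 z : 0 <= k z.
Proof.
apply: mulr_ge0 => //; apply: mulr_ge0; first exact: rho0_ge0.
by apply: prodr_ge0 => i _; exact: rho_ge0.
Qed.

Let ik_ge0 p : (0 <= \int[mu]_s (k (s, p))%:E)%E.
Proof. by apply: integral_ge0 => s _; rewrite lee_fin; exact: k_ge0. Qed.

Let iA p : (\int[mu]_s (k (s, p))%:E)%E =
  (\int[mu]_(s in `[0%R, t]) (rho0 s p.1 * \prod_(i < d) rho i s (tnth p.2 i))%:E)%E.
Proof.
rewrite -[RHS]integral_mulr_indic; apply: eq_integral => s _.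
by rewrite /k /= mulrC.
Qed.

Let AE p : A p = \1_(`[0, t]) (p.1 : R) * fine (\int[mu]_s (k (s, p))%:E)%E.
Proof.
rewrite iA /A; congr (_ * fine _); apply: eq_integral => s _.
by rewrite heatE.
Qed.

Let A_ge0 p : 0 <= A p.
Proof. by rewrite AE; apply: mulr_ge0 => //; exact: fine_ge0. Qed.

(** Only an inequality: [fine] sends an infinite integral to 0, and the time indicator is at most
    1. *)
Let A_le p : ((A p)%:E <= \int[mu]_s (k (s, p))%:E)%E.
Proof.
have i0 := ik_ge0 p.
apply: (@le_trans _ _ (fine (\int[mu]_s (k (s, p))%:E))%:E).
  by rewrite AE lee_fin ler_piMl ?fine_ge0// indicE lern1 leq_b1.
by case: (\int[mu]_s _)%E i0 => //= _; rewrite leey.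
Qed.

Let beta (h : R) (h01 : 2^-1 < h < 1) : 0 < 2 - 2 * h < 1.
Proof. by lra. Qed.

Let f0 (s s' : R) (z : measurableTypeR R * measurableTypeR R) : R :=
  rho0 s z.1 * rho0 s' z.2 * `|(z.1 : R) - z.2| `^ (2 * H0 - 2).

Let f (s s' : R) (i : 'I_d) (z : measurableTypeR R * measurableTypeR R) : R :=
  rho i s z.1 * rho i s' z.2 * `|(z.1 : R) - z.2| `^ (2 * H i - 2).

Let kkE s s' p q : k (s, p) * (k (s', q) * hkernel H0 H p q) =
  \1_(`[0, t]) s * \1_(`[0, t]) s' *
  (f0 s s' (p.1, q.1) * \prod_(i < d) f s s' i (tnth p.2 i, tnth q.2 i)).
Proof.
rewrite /k /f0 /f /hkernel /= !big_split/=; ring.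
Qed.

Let mrho1 i s : measurable_fun setT (rho i s).
Proof. exact: measurable_normal_pdf. Qed.

Let mrho01 s : measurable_fun setT (rho0 s).
Proof. by apply: (measurableT_comp mbox); exact: measurable_funB. Qed.

Let s0 : 0 < Num.sqrt eps. Proof. by rewrite sqrtr_gt0. Qed.

Let f0_ge0 s s' z : 0 <= f0 s s' z.
Proof. by apply: mulr_ge0; [apply: mulr_ge0; exact: rho0_ge0|exact: powR_ge0]. Qed.

Let f_ge0 s s' i z : 0 <= f s s' i z.
Proof. by apply: mulr_ge0; [apply: mulr_ge0; exact: rho_ge0|exact: powR_ge0]. Qed.

(** At fixed times the form factors over coordinates and [smoothing2] bounds each factor. The
    densities sit at [t - s] and at [b i s + tnth x i], so [t] and [x] drop out of the
    differences. *)
Let int_kk s s' :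
  (\int[lebesgue_spacetime]_p \int[@lebesgue_spacetime R d]_q
    (f0 s s' (p.1, q.1) * \prod_(i < d) f s s' i (tnth p.2 i, tnth q.2 i))%:E <=
   (smooth_const (2 - 2 * H0) ^+ 2 * \prod_(i < d) smooth_const (2 - 2 * H i) ^+ 2 *
    path_kernel eps delta (s - s') (fun i => b i s - b i s')%R)%:E)%E.
Proof.
have mf (g g' : R -> R) a : measurable_fun setT g -> measurable_fun setT g' ->
    measurable_fun setT (fun z : measurableTypeR R * measurableTypeR R =>
      g z.1 * g' z.2 * `|(z.1 : R) - z.2| `^ a).
  move=> mg mg'; apply: measurable_funM; last exact: measurable_powR_dist2.
  by apply: measurable_funM; [exact: (measurableT_comp mg)|exact: (measurableT_comp mg')].
rewrite integral2_lebesgue_spacetime//; last 2 first.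
- exact: mf.
- by move=> i; exact: mf.
rewrite /path_kernel mulrACA -big_split/= EFinM; apply: lee_pmul.
- by apply: integral_ge0 => u _; apply: integral_ge0 => v _; rewrite lee_fin; exact: f0_ge0.
- apply: prode_ge0 => i _.
  by apply: integral_ge0 => u _; apply: integral_ge0 => v _; rewrite lee_fin; exact: f_ge0.
- have -> : `|s - s'| = `|(t - s) - (t - s')| by rewrite distrC; congr (`|_|); ring.
  rewrite /f0 (_ : 2 * H0 - 2 = - (2 - 2 * H0)); last by rewrite opprB.
  have h1 s1 : (\int[mu]_r (rho0 s1 r)%:E <= 1)%E by rewrite integral_box_kernel.
  have h2 s1 r : rho0 s1 r * `|r - (t - s1)| <= 1.
    rewrite /rho0 box_kernelE indic_itvE.
    have [|_] := boolP (r \in _); last by rewrite mulr0 mul0r.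
    rewrite in_itv/= mulr1 ler_pdivrMl// mulr1 => /andP[? ?].
    by rewrite ler_norml; lra.
  have h3 s1 r : rho0 s1 r * delta <= 1.
    rewrite /rho0 box_kernelE indic_itvE.
    have [|_] := boolP (r \in _); last by rewrite mulr0 mul0r.
    by rewrite mulr1 mulVf// gt_eqF.
  exact: (smoothing2 (beta H0b) delta0 (mrho01 s) (rho0_ge0 s) (h1 s) (h2 s) (h3 s)
    (mrho01 s') (rho0_ge0 s') (h1 s') (h2 s') (h3 s')).
rewrite -prodEFin; apply: lee_prode => i; apply/andP; split.
  by apply: integral_ge0 => u _; apply: integral_ge0 => v _; rewrite lee_fin; exact: f_ge0.
have -> : b i s - b i s' = (b i s + tnth x i) - (b i s' + tnth x i) by ring.
rewrite /f (_ : 2 * H i - 2 = - (2 - 2 * H i)); last by rewrite opprB.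
have h1 s1 : (\int[mu]_r (rho i s1 r)%:E <= 1)%E by rewrite integral_normal_pdf.
have h2 s1 r : rho i s1 r * `|r - (b i s1 + tnth x i)| <= 1 by exact: normal_pdf_dist.
have h3 s1 r : rho i s1 r * Num.sqrt eps <= 1 by exact: normal_pdf_scale.
exact: (smoothing2 (beta (Hb i)) s0 (mrho1 i s) (rho_ge0 i s) (h1 s) (h2 s) (h3 s)
  (mrho1 i s') (rho_ge0 i s') (h1 s') (h2 s') (h3 s')).
Qed.

Lemma hinner_mollified_le :
  (hinner H0 H A A <= mollified_const%:E *
    \int[mu]_(s in `[0%R, t]) \int[mu]_(s' in `[0%R, t])
      (path_kernel eps delta (s - s') (fun i => b i s - b i s')%R)%:E)%E.
Proof.
have cc0 : 0 <= smooth_const (2 - 2 * H0) ^+ 2 * \prod_(i < d) smooth_const (2 - 2 * H i) ^+ 2.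
  by rewrite mulr_ge0 ?sqr_ge0// prodr_ge0// => i _; rewrite sqr_ge0.
have pk0 s s' : 0 <= path_kernel eps delta (s - s') (fun i => b i s - b i s').
  exact: path_kernel_ge0.
have mpk : measurable_fun setT (fun z : measurableTypeR R * measurableTypeR R =>
    path_kernel eps delta ((z.1 : R) - z.2) (fun i => b i z.1 - b i z.2)).
  apply: measurable_path_kernel => [|i]; first exact: measurable_funB.
  by apply: measurable_funB; exact: (measurableT_comp (mb i)).
have mK : measurable_fun setT (fun z : spacetime * spacetime => hkernel H0 H z.1 z.2).
  exact: measurable_hkernel.
rewrite /mollified_const EFinM -muleA /hinner; apply: lee_wpmul2l.
  by rewrite lee_fin ltW// alphaH_gt0.
apply: (@le_trans _ _ (\int[sfprod lebesgue_spacetime lebesgue_spacetime]_z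
    (A z.1 * A z.2 * hkernel H0 H z.1 z.2)%:E)%E).
  have AAK z : (0 <= (A z.1 * A z.2 * hkernel H0 H z.1 z.2)%:E)%E.
    by rewrite lee_fin; apply: mulr_ge0; [apply: mulr_ge0; exact: A_ge0|exact: hkernel_ge0].
  rewrite integral_mkcond; by apply: ge0_le_integralT => z; rewrite patchE; case: ifP.
have K_ge0 (z : spacetime * spacetime) : 0 <= hkernel H0 H z.1 z.2 by exact: hkernel_ge0.
apply: (le_trans (integral_mollified lebesgue_spacetime mk k_ge0 mK K_ge0 A_ge0 A_le)).
have mpkD : measurable_fun setT (fun s : measurableTypeR R => \int[mu]_(s' in `[0%R, t])
    (path_kernel eps delta (s - s') (fun i => b i s - b i s')%R)%:E)%E.
  under eq_fun do rewrite -integral_mulr_indic.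
  apply: (measurable_integral_snd mu (f := fun z : measurableTypeR R * measurableTypeR R =>
    (path_kernel eps delta ((z.1 : R) - z.2) (fun i => b i z.1 - b i z.2) *
     \1_(`[0, t]) (z.2 : R))%:E)) => [|z].
    apply/measurable_EFinP; apply: measurable_funM => //.
    exact: (measurableT_comp (measurable_indic_itv _) measurable_snd).
  by rewrite lee_fin; exact: mulr_ge0.
have kk0 s s' p q : (0 <= (k (s, p) * (k (s', q) * hkernel H0 H p q))%:E)%E.
  rewrite lee_fin; apply: mulr_ge0; first exact: k_ge0.
  by apply: mulr_ge0; [exact: k_ge0|exact: hkernel_ge0].
have k_out (s : R) p : s \notin (`[0, t]%classic : set R) -> k (s, p) = 0.
  by move=> st; rewrite /k /= indicE (negbTE st) mul0r.
rewrite -ge0_integralZl//; last 2 first.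
- exact: measurable_funTS.
- by move=> s _; apply: integral_ge0 => s' _; rewrite lee_fin; exact: pk0.
rewrite [leRHS]integral_mkcond; apply: ge0_le_integralT => s.
  by do 3!(apply: integral_ge0 => ? _).
rewrite patchE; case: ifPn => sI; last first.
  under eq_integral do under eq_integral do under eq_integral do
    rewrite k_out ?mul0r//.
  by rewrite !integral0_eq// => *; rewrite ?integral0_eq// => *; rewrite ?integral0_eq.
rewrite -ge0_integralZl//; last 2 first.
- apply: measurable_funTS; apply/measurable_EFinP.
  exact: (measurableT_comp mpk (measurable_pair1 s)).
- by move=> s' _; rewrite lee_fin; exact: pk0.
rewrite [leRHS]integral_mkcond; apply: ge0_le_integralT => s'.
  by do 2!(apply: integral_ge0 => ? _).
rewrite patchE; case: ifPn => s'I; last first.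
  rewrite integral0_eq// => p _; rewrite integral0_eq// => q _.
  by rewrite (k_out s') ?mul0r ?mulr0//; move: s'I; rewrite mem_setE.
rewrite -EFinM; apply: le_trans (int_kk s s').
rewrite le_eqVlt; apply/orP; left; apply/eqP.
apply: eq_integral => p _; apply: eq_integral => q _; rewrite kkE !indicE sI s'I.
by rewrite !mul1r.
Qed.

End path.
End mollification.

(** * Exponential functionals of random walks *)

Section adapted.
Context {disp} {Omega : measurableType disp} {R : realType} (P : probability Omega R).

Definition adapted (I : Type) (D : set I) (X : I -> Omega -> R) (f : Omega -> R) : Prop :=
  measurable_fun setT (f : g_sigma_algebraType
    (\bigcup_(i in D) preimage_set_system setT (X i) measurable) -> R).

Lemma adapted_sub (I1 I2 : Type) (D1 : set I1) (D2 : set I2)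
    (X1 : I1 -> Omega -> R) (X2 : I2 -> Omega -> R) (f : Omega -> R) :
  (forall i, D1 i -> adapted D2 X2 (X1 i)) -> adapted D1 X1 f -> adapted D2 X2 f.
Proof.
move=> X12 mf mT Y mY; have := mf measurableT Y mY; apply: smallest_sub.
  exact: smallest_sigma_algebra.
by move=> _ [i Di [Z mZ <-]]; exact: (X12 i Di).
Qed.

Lemma adapted_gen (I : Type) (D : set I) (X : I -> Omega -> R) i :
  D i -> adapted D X (X i).
Proof. by move=> Di mT Y mY; apply: sub_sigma_algebra; exists i => //; exists Y. Qed.

Lemma adaptedS (I : Type) (D D' : set I) (X : I -> Omega -> R) (f : Omega -> R) :
  D `<=` D' -> adapted D X f -> adapted D' X f.
Proof. by move=> DD; apply: adapted_sub => i Di; apply: adapted_gen; exact: DD. Qed.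

Lemma measurable_adapted (I : Type) (D : set I) (X : I -> Omega -> R) (f : Omega -> R) :
  (forall i, D i -> measurable_fun setT (X i)) -> adapted D X f -> measurable_fun setT f.
Proof.
move=> mX mf mT Y mY; have := mf measurableT Y mY; apply: smallest_sub.
  exact: sigma_algebra_measurable.
by move=> _ [i Di [Z mZ <-]]; exact: (mX i Di).
Qed.

Section increments.
Variables (I : finType) (X : I -> Omega -> R).
Hypotheses (mX : forall i, measurable_fun setT (X i)) (indX : mutually_independent P X).

(** Given the variables indexed by [D], [Z] is a constant shift of [X i]; a bound uniform in the
    shift plays the part of a bound on a conditional expectation. *)
Lemma integral_indep_step (D : set I) (i : I) (psi Z : Omega -> R) (q : R -> R) (M : R) :
  ~ D i -> adapted D X psi -> (forall w, 0 <= psi w) -> adapted D X Z ->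
  measurable_fun setT q -> (forall y, 0 <= q y) ->
  (forall a, \int[P]_w (q (a + X i w))%:E <= M%:E)%E ->
  (\int[P]_w (psi w * q (Z w + X i w))%:E <= M%:E * \int[P]_w (psi w)%:E)%E.
Proof.
move=> Di mpsi psi0 mZ mq q0 qM.
pose T := g_sigma_algebraType (\bigcup_(i in D) preimage_set_system setT (X i) measurable).
have M0 : 0 <= M.
  by rewrite -lee_fin (le_trans _ (qM 0))// integral_ge0// => w _; rewrite lee_fin.
have mpsi' : measurable_fun setT psi by apply: measurable_adapted mpsi.
have mid : measurable_fun setT (idfun : Omega -> T).
  move=> _ A mA; rewrite setTI; move: mA; apply: smallest_sub.
    exact: sigma_algebra_measurable.
  by move=> _ [j Dj [Y mY <-]]; exact: mX.
have mf : measurable_fun setT (fun z : R * T => (psi z.2 * q (Z z.2 + z.1))%:E).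
  apply/measurable_EFinP; apply: measurable_funM; first exact: (measurableT_comp mpsi).
  apply: (measurableT_comp mq); apply: measurable_funD => //.
  exact: (measurableT_comp mZ).
have := @indep_joint_integral _ _ _ P _ _ _ T (X i) idfun _ (mX i) mid _ mf.
move=> ->; last 2 first.
- move=> A C mA mC; rewrite setIC muleC.
  exact: (indep_sigma_generated mX indX Di mC mA).
- by move=> z; rewrite lee_fin mulr_ge0.
rewrite -ge0_integralZl//; last 2 first.
- exact/measurable_EFinP.
- by move=> w _; rewrite lee_fin.
apply: ge0_le_integralT => w.
  by apply: integral_ge0 => w' _; rewrite lee_fin mulr_ge0.
under eq_integral do rewrite /= EFinM.
rewrite ge0_integralZl//=; last 3 first.
- apply/measurable_EFinP; apply: (measurableT_comp mq); exact: measurable_funD.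
- by move=> w' _; rewrite lee_fin.
- by rewrite lee_fin.
by rewrite muleC lee_wpmul2r ?lee_fin.
Qed.

(** The last factor is integrated out first: each earlier factor joins the test function [psi], and
    its index joins [D]. *)
Lemma integral_indep_steps (s : seq I) (D : set I) (psi : Omega -> R)
    (Z : I -> Omega -> R) (q : I -> R -> R) (M : I -> R) :
  uniq s -> (forall i, i \in s -> ~ D i) ->
  adapted D X psi -> (forall w, 0 <= psi w) -> (forall i, adapted D X (Z i)) ->
  (forall i, measurable_fun setT (q i)) -> (forall i y, 0 <= q i y) ->
  (forall i a, i \in s -> \int[P]_w (q i (a + X i w))%:E <= (M i)%:E)%E ->
  (\int[P]_w (psi w * \prod_(i <- s) q i (Z i w + X i w))%:E <=
   (\prod_(i <- s) M i)%:E * \int[P]_w (psi w)%:E)%E.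
Proof.
move=> us sD mpsi psi0 mZ mq q0 qM.
elim: s D psi us sD mpsi psi0 mZ qM => [|i s IH] D psi /=.
  move=> _ _ _ _ _ _; rewrite big_nil mul1e.
  by under eq_integral do rewrite big_nil mulr1.
move=> /andP[iNs us] sD mpsi psi0 mZ qM.
under eq_integral do rewrite big_cons mulrA.
have Di : ~ D i by apply: sD; rewrite mem_head.
have q1 a : (\int[P]_w (q i (a + X i w))%:E <= (M i)%:E)%E by apply: qM; rewrite mem_head.
pose D' := D `|` [set i].
have DD' : D `<=` D' by exact: subsetUl.
have M0 j : j \in i :: s -> 0 <= M j.
  move=> js; rewrite -lee_fin (le_trans _ (qM j 0 js))// integral_ge0// => w _.
  by rewrite lee_fin.
apply: (le_trans (IH D' (fun w => psi w * q i (Z i w + X i w)) us _ _ _ _ _)).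
- move=> j js [Dj|/= ji]; first by apply: sD Dj; rewrite in_cons js orbT.
  by move: iNs; rewrite -ji js.
- apply: measurable_funM; first exact: adaptedS mpsi.
  apply: (measurableT_comp (mq i)); apply: measurable_funD; first exact: adaptedS (mZ i).
  by apply: adapted_gen; right.
- by move=> w; exact: mulr_ge0.
- by move=> j; exact: adaptedS (mZ j).
- by move=> j a js; apply: qM; rewrite in_cons js orbT.
rewrite big_cons [in leRHS]mulrC EFinM -muleA lee_wpmul2l//.
  by rewrite lee_fin big_seq prodr_ge0// => j js; apply: M0; rewrite in_cons js orbT.
exact: (integral_indep_step Di mpsi psi0 (mZ i) (mq i) (q0 i) q1).
Qed.

End increments.

(** Telescoping: [expR (a + r) - expR r <= 3 a expR r] for [0 <= a <= 1], where the term of index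
    [j] keeps the exponential of the later terms only. *)
Lemma expR_sum_le (a : nat -> R) (k n : nat) : (k <= n)%N ->
  (forall j, 0 <= a j <= 1) ->
  expR (\sum_(k.+1 <= j < n.+1) a j) <=
  1 + \sum_(k.+1 <= j < n.+1) 3 * a j * expR (\sum_(j.+1 <= l < n.+1) a l).
Proof.
move=> kn a01; have [m nk] : exists m, (n - k)%N = m by exists (n - k)%N.
elim: m k kn nk => [|m IH] k kn nk.
  have -> : k = n by lia.
  by rewrite !big_geq// expR0 addr0.
have lt : (k.+1 < n.+1)%N by lia.
rewrite !(big_ltn lt) addrCA expRD.
have h := IH k.+1 ltac:(lia) ltac:(lia).
set e := expR (\sum_(k.+2 <= j < n.+1) a j) in h *.
have e0 : 0 <= e by rewrite expR_ge0.
(* From [(1 - a/2)^2 <= expR (- a)] and [(1 - a/2)^2 (1 + 3a) >= 1] on [[0, 1]]. *)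
have ea : expR (a k.+1) <= 1 + 3 * a k.+1.
  have /andP[a0 a1] := a01 k.+1.
  have h1 := expR_ge1Dx (- (a k.+1 / 2)).
  have h2 : expR (- (a k.+1 / 2)) ^+ 2 = (expR (a k.+1))^-1.
    by rewrite -expRM_natl -expRN; congr expR; lra.
  have h3 : (1 - a k.+1 / 2) ^+ 2 <= (expR (a k.+1))^-1.
    rewrite -h2 ler_sqr ?nnegrE ?expR_ge0//; lra.
  have E0 := expR_gt0 (a k.+1).
  have h4 : (1 - a k.+1 / 2) ^+ 2 * expR (a k.+1) <= 1.
    by rewrite -[leRHS](mulVf (lt0r_neq0 E0)) ler_wpM2r// ltW.
  have h5 : 1 <= (1 - a k.+1 / 2) ^+ 2 * (1 + 3 * a k.+1).
    have : 0 <= a k.+1 * ((1 - a k.+1) * (2 - 3 / 4 * a k.+1)) by rewrite !mulr_ge0//; lra.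
    by rewrite expr2; lra.
  have q0 : 0 < (1 - a k.+1 / 2) ^+ 2 by rewrite exprn_gt0//; lra.
  by rewrite -(ler_pM2l q0) (le_trans h4 h5).
have := ler_wpM2r e0 ea; lra.
Qed.

(* [C k] plays the role of the nonnegative functions of the past up to step k:
   bounding [E (psi * _)] for all of them replaces conditional expectations. *)
Lemma backward_induction (n : nat) (g : nat -> Omega -> R)
    (C : nat -> (Omega -> R) -> Prop) (c T : nat -> R) :
  (forall j, measurable_fun setT (g j)) -> (forall j w, 0 <= g j w <= 1) ->
  (forall k psi, C k psi -> measurable_fun setT psi /\ forall w, 0 <= psi w) ->
  (forall k j psi, (k < j <= n)%N -> C k psi -> C j (fun w => psi w * g j w)) ->
  (forall k j psi, (k < j <= n)%N -> C k psi ->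
    \int[P]_w (psi w * g j w)%:E <= (c (j - k)%N)%:E * \int[P]_w (psi w)%:E)%E ->
  (forall m, 0 <= c m) -> (forall m, 1 <= T m) ->
  (forall k, (k <= n)%N ->
     \sum_(k.+1 <= j < n.+1) 6 * c (j - k)%N * T (n - j)%N <= T (n - k)%N) ->
  forall k psi, (k <= n)%N -> C k psi ->
    (\int[P]_w (psi w * expR (\sum_(k.+1 <= j < n.+1) g j w))%:E <=
     (2 * T (n - k)%N)%:E * \int[P]_w (psi w)%:E)%E.
Proof.
move=> mg g01 Cm Cg Cc c0 T1 cT k psi kn.
have me j : measurable_fun setT (fun w => expR (\sum_(j.+1 <= l < n.+1) g l w)).
  by apply: (measurableT_comp (@measurable_expR R)); exact: measurable_sum.
have [N] := ubnP (n - k)%N; elim: N k kn psi => [//|N IH] k kn psi nkN Cpsi.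
have [mpsi psi0] := Cm _ _ Cpsi.
have ipsi0 : (0 <= \int[P]_w (psi w)%:E)%E by apply: integral_ge0 => w _; rewrite lee_fin.
pose r := index_iota k.+1 n.+1.
have t0 j w : 0 <= psi w * g j w * expR (\sum_(j.+1 <= l < n.+1) g l w).
  by rewrite !mulr_ge0 ?expR_ge0//; have /andP[] := g01 j w.
have mt j : measurable_fun setT (fun w => (3 * (psi w * g j w * expR (\sum_(j.+1 <= l < n.+1) g l w)))%:E).
  apply/measurable_EFinP; apply: measurable_funM => //; apply: measurable_funM => //.
  exact: measurable_funM.
apply: (@le_trans _ _ (\int[P]_w ((psi w)%:E + \sum_(j <- r)
    (3 * (psi w * g j w * expR (\sum_(j.+1 <= l < n.+1) g l w)))%:E))%E).
  apply: ge0_le_integralT => w; first by rewrite lee_fin mulr_ge0// expR_ge0.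
  rewrite sumEFin -EFinD lee_fin.
  have := ler_wpM2l (psi0 w) (expR_sum_le kn (fun j => g01 j w)).
  rewrite mulrDr mulr1 mulr_sumr /r => /le_trans; apply; rewrite lerD2l.
  by apply: ler_sum => j _; rewrite le_eqVlt; apply/orP; left; apply/eqP; ring.
rewrite ge0_integralD//; last 4 first.
- by move=> w _; rewrite lee_fin.
- exact/measurable_EFinP.
- by move=> w _; apply: sume_ge0 => j _; rewrite lee_fin mulr_ge0.
- exact: emeasurable_sum.
rewrite ge0_integral_sum//; last by move=> j w _; rewrite lee_fin mulr_ge0.
(* The 6 is the 3 of [expR_sum_le] times the 2 in the bound at the later step [j]. *)
apply: (@le_trans _ _ (\int[P]_w (psi w)%:E + \sum_(j <- r)
    (6 * c (j - k)%N * T (n - j)%N)%:E * \int[P]_w (psi w)%:E)%E).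
  rewrite leeD2l// /r [leLHS]big_seq_cond [leRHS]big_seq_cond; apply: lee_sum => j.
  rewrite mem_index_iota andbT => /andP[kj jn].
  under eq_integral do rewrite EFinM.
  rewrite ge0_integralZl//; last 2 first.
  - by apply/measurable_EFinP; apply: measurable_funM => //; exact: measurable_funM.
  - by move=> w _; rewrite lee_fin.
  have kjn : (k < j <= n)%N by lia.
  have h := IH j ltac:(lia) _ ltac:(lia) (Cg _ _ _ kjn Cpsi).
  have h2 := Cc _ _ _ kjn Cpsi.
  apply: (@le_trans _ _ (3%:E * ((2 * T (n - j)%N)%:E * ((c (j - k)%N)%:E * \int[P]_w (psi w)%:E)))%E).
    apply: lee_wpmul2l => //; apply: (le_trans h); apply: lee_wpmul2l => //.
    by rewrite lee_fin mulr_ge0// (le_trans ler01).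
  rewrite !muleA -!EFinM; apply: lee_wpmul2r => //; rewrite lee_fin.
  by rewrite le_eqVlt; apply/orP; left; apply/eqP; ring.
rewrite -ge0_sume_distrl; last first.
  by move=> j _; rewrite lee_fin !mulr_ge0// (le_trans ler01).
rewrite -[X in (X + _)%E]mul1e -ge0_muleDl//; last first.
  by apply: sume_ge0 => j _; rewrite lee_fin !mulr_ge0// (le_trans ler01).
apply: lee_wpmul2r => //; rewrite sumEFin -EFinD lee_fin.
(* The sum is at most [T (n - k)] and so is the leading 1, whence the factor 2. *)
have := cT k kn; have := T1 (n - k)%N; rewrite /r; lra.
Qed.

End adapted.

(** * Brownian motion on a time grid *)

Section walk.
Context {disp} {Omega : measurableType disp} {R : realType} (P : probability Omega R).
Local Notation mu := (@lebesgue_measure R).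

(** Smoothing by a centred Gaussian of scale [s] gives [max(|a|, s)^(-b)]; bounding this by [s^(-b)]
    makes the estimate uniform in the shift. *)
Lemma normal_negative_moment (X : Omega -> R) (s b e a : R) : 0 < s -> 0 < b < 1 -> 0 < e ->
  measurable_fun setT X ->
  (forall Y : set R, measurable Y -> P (X @^-1` Y) = normal_prob 0 s Y) ->
  (\int[P]_w (Num.max `|a + X w| e `^ (- b))%:E <= (smooth_const b * s `^ (- b))%:E)%E.
Proof.
move=> s0 b01 e0 mX PX; have b0 : 0 <= b by case/andP: b01 => /ltW.
have sn0 : s != 0 by rewrite gt_eqF.
have mq : measurable_fun setT (fun x : R => Num.max `|a + x| e `^ (- b)).
  by apply: measurable_max_powR; exact: measurable_funD.
rewrite (ge0_integral_normal (f := fun x => (Num.max `|a + x| e `^ (- b))%:E) mX PX); last 2 first.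
- exact/measurable_EFinP.
- by move=> x; rewrite lee_fin powR_ge0.
have mpdf := measurable_normal_pdf 0 s.
apply: (@le_trans _ _ (\int[mu]_x (normal_pdf 0 s x * `|x - - a| `^ (- b))%:E)%E).
  apply: ae_ge0_le_integral => //.
  - by move=> x _; rewrite mule_ge0// lee_fin ?powR_ge0 ?normal_pdf_ge0.
  - by apply: emeasurable_funM; exact/measurable_EFinP.
  - by move=> x _; rewrite lee_fin mulr_ge0 ?powR_ge0 ?normal_pdf_ge0.
  - apply/measurable_EFinP; apply: measurable_funM => //; exact: measurable_powR_dist.
  (* Removing the truncation raises the power except at [x = - a], where the bare power is 0. *)
  - exists [set - a]; split => //.
      exact: lebesgue_measure_set1.
    move=> x /= h; apply: contrapT => xa; apply: h => _.
    rewrite -EFinM lee_fin mulrC ler_wpM2l ?normal_pdf_ge0//.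
    rewrite opprK [a + x]addrC; apply: powR_le_neg => //; last by rewrite le_max lexx.
    by rewrite normr_gt0 addr_eq0; apply/eqP.
apply: (le_trans (smoothing (- a) (x := 0) (eta := s) b01 s0 mpdf _ _ _ _)).
- by move=> r; exact: normal_pdf_ge0.
- by rewrite integral_normal_pdf.
- by move=> r; exact: normal_pdf_dist.
- by move=> r; exact: normal_pdf_scale.
rewrite lee_fin ler_wpM2l//.
  by case/andP: b01 => _ /smooth_const_gt0 /ltW.
by apply: powR_le_neg => //; rewrite le_max lexx orbT.
Qed.

Context (d : nat) (H0 : R) (H : 'I_d -> R).
Hypothesis H0b : 2^-1 < H0 < 1.
Hypothesis Hb : forall i, 2^-1 < H i < 1.
Variable B : 'I_d -> R -> {RV P >-> R}.
Hypothesis bmB : brownian_motion B.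

Section grid.
Variables (a h : R).
Hypotheses (a0 : 0 <= a) (h0 : 0 < h).

Let u (m : nat) : R := a + m%:R * h.

Definition walk (p : 'I_d * nat) (w : Omega) : R :=
  B p.1 (u p.2) w - B p.1 (u 0%N) w.

Definition walk_past (k : nat) : set ('I_d * nat) := [set p | (p.2 <= k)%N].

Lemma measurable_walk p : measurable_fun setT (walk p).
Proof. exact: measurable_funB. Qed.

Lemma adapted_walk p k : (p.2 <= k)%N -> adapted (walk_past k) walk (walk p).
Proof. by move=> pk; exact: (adapted_gen (i := p)). Qed.

Section step.
Variables (k j : nat).
Hypothesis kj : (k < j)%N.

(** The grid up to step [k], then one jump to step [j]: [X (i, ord_max)] is the increment of [B]
    over [[u k, u j]], independent of the earlier ones, from which the walk up to [k] is
    recovered. *)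
Let v (m : nat) : R := if (m <= k)%N then u m else u j.
Let I : finType := ('I_d * 'I_k.+1)%type.
Let X (p : I) (w : Omega) : R := B p.1 (v p.2.+1) w - B p.1 (v p.2) w.
Let D : set I := [set p : I | (p.2 < k)%N].

Let u_le m m' : (m <= m')%N -> u m <= u m'.
Proof. by move=> mm; rewrite /u lerD2l ler_pM2r// ler_nat. Qed.

Let u_ge0 m : 0 <= u m.
Proof. by rewrite /u addr_ge0// mulr_ge0// ltW. Qed.

Let indX : mutually_independent P X.
Proof.
case: bmB => _ _ _ indB; apply: (indB k.+1 v).
  by rewrite /v /=; exact: u_ge0.
move=> m m' mm; rewrite /v; case: ifPn => mk; case: ifPn => m'k //.
- exact: u_le.
- by apply: u_le; lia.
- by lia.
Qed.

Let mX p : measurable_fun setT (X p).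
Proof. exact: measurable_funB. Qed.

Let walkS i m : (m < k)%N -> walk (i, m.+1) = (fun w => walk (i, m) w + X (i, inord m) w).
Proof.
move=> mk; apply/funext => w; rewrite /walk /X /= inordK; last by lia.
by rewrite /v mk (ltnW mk) /=; ring.
Qed.

Let past_adapted p : walk_past k p -> adapted D X (walk p).
Proof.
case: p => i m; rewrite /walk_past /=; elim: m => [_|m IH mk].
  rewrite /adapted (_ : walk (i, 0%N) = cst 0); first exact: measurable_cst.
  by apply/funext => w; rewrite /walk /= subrr.
rewrite walkS//; apply: measurable_funD; first by apply: IH; exact: ltnW.
by apply: adapted_gen; rewrite /D /= inordK//; lia.
Qed.

Let lawX i (Y : set R) : measurable Y ->
  P (X (i, ord_max) @^-1` Y) = normal_prob 0 (Num.sqrt ((j - k)%N%:R * h)) Y.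
Proof.
move=> mY; case: bmB => _ _ lawB _.
have e : (j - k)%N%:R * h = u j - u k by rewrite natrB ?(ltnW kj)// /u; ring.
rewrite e -(lawB i)//.
  by rewrite /X /v /= ltnn leqnn.
by rewrite -subr_gt0 -e mulr_gt0// ltr0n subn_gt0.
Qed.

(** [walk (i, j)] is [walk (i, k)], known from the past, plus an independent Gaussian increment of
    variance [(j - k) h]; the negative moments, uniform in the shift, multiply over the
    coordinates. *)
Lemma integral_walk_step (psi : Omega -> R) (eps : R) : 0 < eps ->
  adapted (walk_past k) walk psi -> (forall w, 0 <= psi w) ->
  (\int[P]_w (psi w * \prod_(i < d) Num.max `|walk (i, j) w| (Num.sqrt eps) `^ (- (2 - 2 * H i)))%:E <=
   (\prod_(i < d) (smooth_const (2 - 2 * H i) *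
      Num.sqrt ((j - k)%N%:R * h) `^ (- (2 - 2 * H i))))%:E * \int[P]_w (psi w)%:E)%E.
Proof.
move=> eps0 mpsi psi0.
have jk0 : 0 < (j - k)%N%:R * h by rewrite mulr_gt0// ltr0n subn_gt0.
pose s : seq I := [seq (i, ord_max) | i <- enum 'I_d].
pose q (p : I) (y : R) : R := Num.max `|y| (Num.sqrt eps) `^ (- (2 - 2 * H p.1)).
pose Z (p : I) := walk (p.1, k).
pose M (p : I) := smooth_const (2 - 2 * H p.1) *
  Num.sqrt ((j - k)%N%:R * h) `^ (- (2 - 2 * H p.1)).
have prodE (F : I -> R) : \prod_(p <- s) F p = \prod_(i < d) F (i, ord_max).
  by rewrite big_map big_enum.
rewrite -(prodE M).
have -> : (fun w => (psi w * \prod_(i < d) Num.max `|walk (i, j) w| (Num.sqrt eps) `^ (- (2 - 2 * H i)))%:E) =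
    (fun w => (psi w * \prod_(p <- s) q p (Z p w + X p w))%:E).
  apply/funext => w; rewrite prodE; congr ((_ * _)%:E); apply: eq_bigr => i _.
  rewrite /q /Z /X /walk /v /= ltnn leqnn; congr (Num.max `|_| _ `^ _); ring.
apply: (integral_indep_steps mX indX (D := D)) => //.
- by rewrite map_inj_uniq ?enum_uniq// => x y [].
- by move=> p /mapP[i _ ->]; rewrite /D /= ltnn.
- exact: adapted_sub mpsi.
- by move=> p; apply: past_adapted; rewrite /walk_past /=.
- by move=> p; exact: measurable_max_powR.
- by move=> p y; exact: powR_ge0.
- move=> p b /mapP[i _ ->]; apply: normal_negative_moment => //=.
  + by rewrite sqrtr_gt0.
  + by have := Hb i; lra.
  + by rewrite sqrtr_gt0.
  + exact: lawX.
Qed.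

End step.
End grid.

Hypothesis subcritical : d%:R + 1 < 2 * H0 + \sum_(i < d) H i.

(** The spatial exponents are halved because [sqrt(s)^(-(2 - 2 H i)) = s^(-(1 - H i))]; [gam < 1] is
    [subcritical] rearranged. *)
Let gam : R := 2 - 2 * H0 + \sum_(i < d) (1 - H i).

Let gam01 : 0 < gam < 1.
Proof.
rewrite /gam sumrB big_const_ord iter_addr_0 -[1 *+ d]/(d%:R).
have : 0 <= d%:R - \sum_(i < d) H i.
  rewrite -[d%:R]/(1 *+ d) -[1 *+ d]iter_addr_0 -(big_const_ord) -sumrB sumr_ge0// => i _.
  by have := Hb i; lra.
by have := H0b; have := subcritical; lra.
Qed.

(** [K] is uniform in the base point, the mesh and the mollifiers. As the kernel is largest at 0,
    the last premise makes every summand at most 1, as [expR_sum_le] requires. *)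
Lemma walk_exp_moment (t c0 : R) : 0 < t -> 0 < c0 ->
  exists K : R, forall (a h eps delta : R) (n : nat),
    0 <= a -> 0 < h -> 0 < eps -> 0 < delta -> n%:R * h <= t ->
    h * (c0 * path_kernel H0 H eps delta 0 (fun=> 0)) <= 1 ->
    (\int[P]_w (expR (\sum_(1 <= j < n.+1) h * (c0 * path_kernel H0 H eps delta
       (j%:R * h) (fun i => B i (a + j%:R * h) w - B i a w))))%:E <= K%:E)%E.
Proof.
move=> t0 c00.
have sc0 i : 0 < smooth_const (2 - 2 * H i).
  by apply: smooth_const_gt0; have := Hb i; lra.
pose c1 := c0 * \prod_(i < d) smooth_const (2 - 2 * H i).
have c10 : 0 < c1 by rewrite mulr_gt0// prodr_gt0.
(* The target [(6 c1)^-1] absorbs the 6 of [backward_induction] and the constant in [c] below. *)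
have [m m0 mK] := sum_powR_expR_le (k := (6 * c1)^-1) gam01 t0 ltac:(by rewrite invr_gt0 mulr_gt0).
exists (2 * expR (m * t)) => a h eps delta n a0 h0 eps0 delta0 nh hD.
pose g (j : nat) (w : Omega) := h * (c0 * path_kernel H0 H eps delta (j%:R * h)
  (fun i => walk a h (i, j) w)).
have -> : (fun w => (expR (\sum_(1 <= j < n.+1) h * (c0 * path_kernel H0 H eps delta
     (j%:R * h) (fun i => B i (a + j%:R * h) w - B i a w))))%:E) =
   (fun w => (1 * expR (\sum_(1 <= j < n.+1) g j w))%:E).
  apply/funext => w; rewrite mul1r; congr ((expR _)%:E); apply: eq_bigr => j _.
  rewrite /g /walk /=; congr (_ * (_ * path_kernel _ _ _ _ _ _)).
  by apply/funext => i; rewrite mul0r addr0.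
pose C (k : nat) (psi : Omega -> R) :=
  adapted (walk_past k) (walk a h) psi /\ (forall w, 0 <= psi w).
(* [c (j - k)] bounds the conditional mean of [g j] given step [k]; [T] is the exponential weight in
   the remaining time. *)
pose c (j : nat) := h * c1 * (j%:R * h) `^ (- gam).
pose T (j : nat) := expR (m * (j%:R * h)).
have g0 j w : 0 <= g j w.
  by apply: mulr_ge0; [exact: ltW|apply: mulr_ge0; [exact: ltW|exact: path_kernel_ge0]].
have adg k j : (j <= k)%N -> adapted (walk_past k) (walk a h) (g j).
  move=> jk; apply: measurable_funM => //; apply: measurable_funM => //.
  by apply: measurable_path_kernel => // i; exact: adapted_walk.
have mw k p : walk_past k p -> measurable_fun setT (walk a h p).
  by move=> _; exact: measurable_walk.
have ip : (\int[P]_w (1 : R)%:E = 1)%E by exact: integral_prob_cst.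
have n1 : T (n - 0)%N <= expR (m * t) by rewrite ler_expR subn0 ler_wpM2l// ltW.
have -> : (2 * expR (m * t))%:E = ((2 * expR (m * t))%:E * \int[P]_w (1 : R)%:E)%E.
  by rewrite ip mule1.
apply: (@le_trans _ _ ((2 * T (n - 0)%N)%:E * \int[P]_w (1 : R)%:E)%E); last first.
  by rewrite ip !mule1 lee_fin ler_wpM2l.
apply: (backward_induction (C := C) (c := c)) => //.
- by move=> j; exact: (measurable_adapted (mw j) (adg _ _ (leqnn j))).
- move=> j w; rewrite g0 /= (le_trans _ hD)// /g ler_pM2l// ler_pM2l//.
  exact: path_kernel_le0.
- by move=> k psi [mpsi psi0]; split => //; exact: (measurable_adapted (mw k) mpsi).
- move=> k j psi /andP[kj _] [mpsi psi0]; split; last by move=> w; exact: mulr_ge0.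
  apply: measurable_funM; last exact: adg.
  by apply: adaptedS mpsi => p /=; rewrite /walk_past /= => /leq_trans; apply; exact: ltnW.
- move=> k j psi /andP[kj jn] [mpsi psi0].
  have mpsi' := measurable_adapted (mw k) mpsi.
  pose pj w := \prod_(i < d) Num.max `|walk a h (i, j) w| (Num.sqrt eps) `^ (- (2 - 2 * H i)).
  have pj0 w : 0 <= pj w by rewrite prodr_ge0// => i _; exact: powR_ge0.
  pose e := h * (c0 * Num.max `|j%:R * h| delta `^ (- (2 - 2 * H0))).
  have e0 : 0 <= e by rewrite /e !mulr_ge0 ?powR_ge0// ltW.
  have -> : (fun w => (psi w * g j w)%:E) = (fun w => e%:E * (psi w * pj w)%:E)%E.
    by apply/funext => w; rewrite -EFinM /g /path_kernel /e /pj; congr EFin; ring.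
  have mpj : measurable_fun setT pj.
    by apply: measurable_prod => i _; apply: measurable_max_powR; exact: measurable_walk.
  rewrite ge0_integralZl//; last 2 first.
  + by apply/measurable_EFinP; exact: measurable_funM.
  + by move=> w _; rewrite lee_fin mulr_ge0.
  apply: (le_trans (lee_wpmul2l _ (integral_walk_step a0 h0 kj eps0 mpsi psi0))).
    by rewrite lee_fin.
  rewrite muleA -EFinM; apply: lee_wpmul2r.
    by apply: integral_ge0 => w _; rewrite lee_fin.
  rewrite lee_fin big_split/= /e /c /c1 -!mulrA ler_pM2l// ler_pM2l//.
  rewrite mulrCA ler_pM2l ?prodr_gt0//.
  have jk0 : 0 < (j - k)%N%:R * h by rewrite mulr_gt0// ltr0n subn_gt0.
  have -> : \prod_(i < d) Num.sqrt ((j - k)%N%:R * h) `^ (- (2 - 2 * H i)) =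
      ((j - k)%N%:R * h) `^ (- \sum_(i < d) (1 - H i)).
    transitivity (\prod_(i < d) ((j - k)%N%:R * h) `^ (- (1 - H i))).
      apply: eq_bigr => i _; rewrite -powR12_sqrt ?ltW// -powRrM; congr (_ `^ _); lra.
    rewrite -sumrN; elim/big_rec2 : _ => [|i y1 y2 _ ->]; first by rewrite powRr0.
    by rewrite powRD_gt0.
  have -> : - gam = - (2 - 2 * H0) - \sum_(i < d) (1 - H i) by rewrite /gam opprD.
  rewrite powRD_gt0// ler_wpM2r ?powR_ge0//.
  (* The time factor is taken at [j h], which is at least the lag [(j - k) h], so it joins the
     spatial factors as a power of the lag. *)
  apply: powR_le_neg => //; first by have := H0b; lra.
  rewrite le_max ger0_norm; last by rewrite mulr_ge0// ltW.
  by rewrite ler_pM2r// ler_nat leq_subr.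
- by move=> j; apply: mulr_ge0; [apply: mulr_ge0; exact: ltW|exact: powR_ge0].
- by move=> j; rewrite /T -expR0 ler_expR !mulr_ge0// ltW.
- move=> k kn.
  have := mK h (n - k)%N h0; rewrite (le_trans _ nh); last by rewrite ler_pM2r// ler_nat leq_subr.
  move=> /(_ isT) h1.
  (* As [T (n - j) = T (n - k) expR (- m (j - k) h)], the condition reduces to a discounted sum over
     lags, which [m] was chosen to control. *)
  have E : \sum_(k.+1 <= j < n.+1) 6 * c (j - k)%N * T (n - j)%N =
     T (n - k)%N * (6 * c1 * \sum_(1 <= j < (n - k).+1)
        h * ((j%:R * h) `^ (- gam) * expR (- (m * (j%:R * h))))).
    rewrite -(add1n k) big_addn subSn// !mulr_sumr !big_nat; apply: eq_bigr => j /andP[j1 jn].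
    have -> : T (n - k)%N = T (n - (j + k))%N * expR (m * (j%:R * h)).
      have nE : (n - k)%N = (n - (j + k) + j)%N by clear -kn jn; lia.
      by rewrite /T nE natrD mulrDl mulrDr expRD.
    rewrite addnK /c expRN; field; by rewrite gt_eqF// expR_gt0.
  rewrite E -[leRHS]mulr1 ler_wpM2l ?expR_ge0//.
  by have := ler_wpM2l (ltW (mulr_gt0 (ltr0n R 6) c10)) h1; rewrite mulfV ?gt_eqF// mulr_gt0.
- by split => //; exact: measurable_cst.
Qed.

End walk.

(** * Riemann sums *)

Section riemann.
Context {R : realType}.
Local Notation mu := (@lebesgue_measure R).

Definition grid_floor (h s : R) : R := (Num.truncn (s / h))%:R * h.

Lemma grid_floorE (h s : R) (j : nat) : 0 < h -> j%:R * h <= s < j.+1%:R * h ->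
  grid_floor h s = j%:R * h.
Proof.
move=> h0 /andP[js sj]; rewrite /grid_floor; congr (_%:R * _).
by apply: truncn_def; rewrite ler_pdivlMr// ltr_pdivrMr// js.
Qed.

Lemma grid_floor_itv (h s : R) : 0 < h -> 0 <= s -> s - h <= grid_floor h s <= s.
Proof.
move=> h0 s0; have /truncn_itv /andP[h1 h2] : 0 <= s / h by rewrite divr_ge0// ltW.
rewrite /grid_floor -ler_pdivlMr// h1 andbT.
have := h2; rewrite ltr_pdivrMr// -natr1 mulrDl mul1r; lra.
Qed.

Lemma measurable_grid_floor (h : R) : 0 < h -> measurable_fun setT (grid_floor h).
Proof.
move=> h0; apply: nondecreasing_measurable => // x y xy.
rewrite /grid_floor ler_pM2r// ler_nat; apply: le_truncn.
by rewrite ler_pM2r// invr_gt0.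
Qed.

(** Writes a Riemann sum as an integral, so that its convergence becomes a matter of dominated
    convergence. *)
Lemma integral_grid_floor (g : R -> \bar R) (h : R) (n : nat) : 0 < h ->
  measurable_fun setT g -> (forall s, 0 <= g s)%E ->
  (\int[mu]_(s in `[0%R, (n%:R * h)%R[) g (grid_floor h s) =
   \sum_(0 <= j < n) h%:E * g (j%:R * h)%R)%E.
Proof.
move=> h0 mg g0; have mgf : measurable_fun setT (fun s => g (grid_floor h s)).
  by apply: (measurableT_comp mg); exact: measurable_grid_floor.
elim: n => [|n IH].
  by rewrite big_geq// mul0r set_itvco0 integral_set0.
have h1 : n%:R * h <= n.+1%:R * h by rewrite ler_pM2r// ler_nat.
have -> : `[0, n.+1%:R * h[%classic = `[0, n%:R * h[ `|` `[n%:R * h, n.+1%:R * h[ :> set R.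
  by rewrite -itv_bndbnd_setU// bnd_simp// mulr_ge0// ltW.
rewrite ge0_integral_setU//; last 2 first.
- exact: measurable_funTS.
- apply/disj_setPS => x /= []; rewrite !in_itv/= => /andP[_ ?] /andP[? _]; lra.
rewrite IH big_nat_recr//=; congr (_ + _)%E.
have mI : measurable (`[n%:R * h, n.+1%:R * h[%classic : set R) by exact: measurable_itv.
rewrite (eq_integral (cst (g (n%:R * h)%R))); last first.
  move=> s; rewrite inE/= in_itv/= => sn.
  by rewrite (grid_floorE h0 sn).
transitivity (g (n%:R * h)%R * mu `[(n%:R * h)%R, (n.+1%:R * h)%R[)%E.
  exact: integral_cst.
rewrite lebesgue_measure_itv/= lte_fin ltr_pM2r// ltr_nat leqnn -EFinB muleC.
by congr (_%:E * _)%E; rewrite -natr1; ring.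
Qed.

Lemma cvg_grid_floor (h : nat -> R) (s : R) : (forall n, 0 < h n) -> h @ \oo --> 0 ->
  0 <= s -> grid_floor (h n) s @[n --> \oo] --> s.
Proof.
move=> h0 hc s0; apply: (@squeeze_cvgr _ _ _ _ (fun n => s - h n) (cst s)).
- by apply: nearW => n; exact: grid_floor_itv.
- by rewrite -[X in _ --> X]subr0; apply: cvgB => //; exact: cvg_cst.
- exact: cvg_cst.
Qed.

(** Continuity gives pointwise convergence at the grid points and [D] the domination, in the inner
    integral and then, with [D t], in the outer one. *)
Lemma cvg_riemann_sum2 (f : R -> R -> R) (t D : R) : 0 < t ->
  measurable_fun setT (fun z : R * R => f z.1 z.2) ->
  continuous (fun z : R * R => f z.1 z.2) -> (forall u v, 0 <= f u v <= D) ->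
  (fun n : nat => (\sum_(0 <= j < n.+1) t / n.+1%:R * \sum_(0 <= k < n.+1)
     t / n.+1%:R * f (j%:R * (t / n.+1%:R)) (k%:R * (t / n.+1%:R)))%:E) @ \oo -->
  (\int[mu]_(s in `[0%R, t[) \int[mu]_(s' in `[0%R, t[) (f s s')%:E)%E.
Proof.
move=> t0 mf cf f0D.
pose h (n : nat) := t / n.+1%:R.
have h0 n : 0 < h n by rewrite divr_gt0.
have hc : h @ \oo --> 0.
  rewrite -[X in _ --> X](mulr0 t); apply: cvgM; first exact: cvg_cst.
  exact: cvg_harmonic.
have nh n : n.+1%:R * h n = t by rewrite /h mulrCA mulfV ?mulr1.
have f_ge0 u v : 0 <= f u v by have /andP[] := f0D u v.
have D0 : 0 <= D by have /andP[] := f0D 0 0; exact: le_trans.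
have mfu u : measurable_fun setT (f u) by exact: (measurableT_comp mf (measurable_pair1 u)).
have mfv v : measurable_fun setT (f ^~ v) by exact: (measurableT_comp mf (measurable_pair2 v)).
have mI : measurable (`[0, t[%classic : set R) by exact: measurable_itv.
have muI : mu `[0%R, t[ = t%:E by rewrite lebesgue_measure_itv/= lte_fin t0 oppr0 adde0.
pose fn n s s' := f (grid_floor (h n) s) (grid_floor (h n) s').
have sumE n : ((\sum_(0 <= j < n.+1) t / n.+1%:R * \sum_(0 <= k < n.+1)
     t / n.+1%:R * f (j%:R * (t / n.+1%:R)) (k%:R * (t / n.+1%:R)))%:E =
    \int[mu]_(s in `[0%R, t[) \int[mu]_(s' in `[0%R, t[) (fn n s s')%:E)%E.
  rewrite -/(h n).
  pose g u := (\sum_(0 <= k < n.+1) (h n * f u (k%:R * h n))%:E)%E.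
  have gE u : (\int[mu]_(s' in `[0%R, t[) (f u (grid_floor (h n) s'))%:E = g u)%E.
    rewrite -(nh n) (integral_grid_floor (g := fun v => (f u v)%:E)) ?nh//.
    - exact/measurable_EFinP.
    - by move=> v; rewrite lee_fin.
  under eq_integral do rewrite gE.
  rewrite -(nh n) (integral_grid_floor (g := g)) ?nh//.
  - rewrite -sumEFin; apply: eq_bigr => j _; rewrite EFinM; congr (_ * _)%E.
    by rewrite -sumEFin.
  - apply: emeasurable_sum => k; apply/measurable_EFinP; exact: measurable_funM.
  - by move=> u; apply: sume_ge0 => k _; rewrite lee_fin mulr_ge0// ltW.
under eq_fun do rewrite sumE.
have mfn n : measurable_fun setT (fun z : R * R => fn n z.1 z.2).
  rewrite (_ : (fun z => _) = (fun z : R * R => f z.1 z.2) \o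
    (fun z : R * R => (grid_floor (h n) z.1, grid_floor (h n) z.2)))//.
  apply: (measurableT_comp mf); apply: measurable_fun_pair.
    exact: (measurableT_comp (measurable_grid_floor (h0 n))).
  exact: (measurableT_comp (measurable_grid_floor (h0 n))).
have fnc s s' : `[0, t[%classic s -> `[0, t[%classic s' -> fn n s s' @[n --> \oo] --> f s s'.
  rewrite /= !in_itv/= => /andP[s0 _] /andP[s'0 _].
  apply: (cvg_comp (fun n => (grid_floor (h n) s, grid_floor (h n) s'))
    (fun z : R * R => f z.1 z.2)); last exact: (cf (s, s')).
  exact: (cvg_pair (cvg_grid_floor h0 hc s0) (cvg_grid_floor h0 hc s'0)).
have icst (c : R) : mu.-integrable `[0%R, t[ (cst c%:E).
  apply/integrableP; split => //.
  by rewrite integral_cst//= muI -EFinM ltry.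
have inner s : `[0, t[%classic s ->
    ((\int[mu]_(s' in `[0%R, t[) (fn n s s')%:E)%E @[n --> \oo] -->
     \int[mu]_(s' in `[0%R, t[) (f s s')%:E)%E.
  move=> sI.
  have h1 n : measurable_fun `[0, t[ (fun s' => (fn n s s')%:E).
    apply: measurable_funTS; apply/measurable_EFinP.
    exact: (measurableT_comp (mfn n) (measurable_pair1 s)).
  have h2 : measurable_fun `[0, t[ (fun s' => (f s s')%:E).
    by apply: measurable_funTS; exact/measurable_EFinP.
  have h3 : {ae mu, forall s', `[0, t[%classic s' -> (fn n s s')%:E @[n --> \oo] --> (f s s')%:E}.
    by apply: aeW => s' s'I; apply: cvg_EFin; [exact: nearW|exact: fnc].
  have h4 : {ae mu, forall s' n, `[0, t[%classic s' -> (`|(fn n s s')%:E| <= D%:E)%E}.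
    by apply: aeW => s' n _; rewrite gee0_abs ?lee_fin//; have /andP[] :=
      f0D (grid_floor (h n) s) (grid_floor (h n) s').
  by have [_ _] := @dominated_convergence _ _ _ mu _ mI _ _ _ h1 h2 h3 (icst D) h4.
have mint (g : R -> R -> R) : measurable_fun setT (fun z : R * R => g z.1 z.2) ->
    (forall u v, 0 <= g u v) ->
    measurable_fun setT (fun s : R => \int[mu]_(s' in `[0%R, t[) (g s s')%:E)%E.
  move=> mg g0; under eq_fun do rewrite -integral_mulr_indic.
  apply: (measurable_integral_snd mu (f := fun z : R * R =>
    (g z.1 z.2 * \1_(`[0, t[) (z.2 : R))%:E)) => [|z].
    apply/measurable_EFinP; apply: measurable_funM => //.
    exact: (measurableT_comp (measurable_indic_itv _) measurable_snd).
  by rewrite lee_fin; exact: mulr_ge0.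
have h1 n : measurable_fun `[0, t[ (fun s => \int[mu]_(s' in `[0%R, t[) (fn n s s')%:E)%E.
  by apply: measurable_funTS; apply: mint => // u v; exact: f_ge0.
have h2 : measurable_fun `[0, t[ (fun s => \int[mu]_(s' in `[0%R, t[) (f s s')%:E)%E.
  by apply: measurable_funTS; exact: mint.
have h3 : {ae mu, forall s, `[0, t[%classic s ->
    ((\int[mu]_(s' in `[0%R, t[) (fn n s s')%:E)%E @[n --> \oo] -->
     \int[mu]_(s' in `[0%R, t[) (f s s')%:E)%E}.
  by apply: aeW => s sI; exact: inner.
have h4 : {ae mu, forall s n, `[0, t[%classic s ->
    (`|\int[mu]_(s' in `[0%R, t[) (fn n s s')%:E| <= (D * t)%:E)%E}.
  apply: aeW => s n _; rewrite gee0_abs; last by apply: integral_ge0 => s' _; rewrite lee_fin; exact: f_ge0.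
  rewrite EFinM -muI -integral_cst//; apply: ge0_le_integral_in => s' _.
  - by rewrite lee_fin; exact: f_ge0.
  - by rewrite lee_fin; have /andP[] := f0D (grid_floor (h n) s) (grid_floor (h n) s').
by have [_ _] := @dominated_convergence _ _ _ mu _ mI _ _ _ h1 h2 h3 (icst (D * t)) h4.
Qed.

End riemann.

(** * Convexity and symmetrization of double sums *)

Section jensen.
Context {R : realType}.

(** Jensen by the tangent of [expR] at the mean [m]: the linear terms [a j - m] sum to 0. *)
Lemma expR_mean_le (n : nat) (a : nat -> R) :
  expR (n.+1%:R^-1 * \sum_(0 <= j < n.+1) a j) <=
  n.+1%:R^-1 * \sum_(0 <= j < n.+1) expR (a j).
Proof.
set m := _^-1 * _.
have n0 : (n.+1%:R : R) != 0 by [].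
have E : \sum_(0 <= j < n.+1) (a j - m) = 0.
  by rewrite sumrB sumr_const_nat subn0 -mulr_natl /m mulVKf// subrr.
have -> : expR m = n.+1%:R^-1 * (n.+1%:R * expR m) by rewrite mulrA mulVf ?mul1r.
rewrite ler_wpM2l ?invr_ge0//.
apply: (@le_trans _ _ (\sum_(0 <= j < n.+1) expR m * (1 + (a j - m)))).
  rewrite -mulr_sumr big_split/= E addr0 sumr_const_nat subn0.
  by rewrite mulrC.
apply: ler_sum => j _.
rewrite -{2}(subrK m (a j)) expRD mulrC ler_wpM2r ?expR_ge0//.
exact: expR_ge1Dx.
Qed.

(** Folds the square onto the pairs [j < k], so that only increments of [B] after the base point [j]
    occur. *)
Lemma sum_symmetric (n : nat) (f : nat -> nat -> R) : (forall j k, f j k = f k j) ->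
  \sum_(0 <= j < n) \sum_(0 <= k < n) f j k =
  \sum_(0 <= j < n) (f j j + 2 * \sum_(j.+1 <= k < n) f j k).
Proof.
move=> fC; elim: n => [|n IH]; first by rewrite !big_geq.
rewrite [LHS]big_nat_recr//= [in RHS]big_nat_recr//=.
under [X in X + _ = _]eq_bigr do rewrite big_nat_recr//=.
rewrite big_split/= IH.
have -> : \sum_(0 <= j < n) (f j j + 2 * \sum_(j.+1 <= k < n.+1) f j k) =
    \sum_(0 <= j < n) (f j j + 2 * \sum_(j.+1 <= k < n) f j k) + \sum_(0 <= j < n) 2 * f j n.
  rewrite -big_split/= !big_nat; apply: eq_bigr => j /andP[_ jn].
  by rewrite (big_nat_recr n)//= mulrDr addrA.
rewrite [in RHS]big_geq// mulr0 addr0 [X in _ + X = _]big_nat_recr//=.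
under [X in _ + (X + _) = _]eq_bigr do rewrite fC.
rewrite -mulr_sumr; ring.
Qed.

End jensen.

(** * The uniform exponential moment *)

Section final.
Context {disp} {Omega : measurableType disp} {R : realType} (P : probability Omega R).
Local Notation mu := (@lebesgue_measure R).
Context (d : nat) (H0 : R) (H : 'I_d -> R).
Hypothesis H0b : 2^-1 < H0 < 1.
Hypothesis Hb : forall i, 2^-1 < H i < 1.

Definition grid_energy (eps delta t : R) (b : 'I_d -> R -> R) (n : nat) : R :=
  \sum_(0 <= j < n.+1) t / n.+1%:R * \sum_(0 <= k < n.+1) t / n.+1%:R *
    path_kernel H0 H eps delta (j%:R * (t / n.+1%:R) - k%:R * (t / n.+1%:R))
      (fun i => b i (j%:R * (t / n.+1%:R)) - b i (k%:R * (t / n.+1%:R))).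

Let path_kernelN eps delta s (y : 'I_d -> R) :
  path_kernel H0 H eps delta (- s) (fun i => - y i) = path_kernel H0 H eps delta s y.
Proof. by rewrite /path_kernel normrN; under eq_bigr do rewrite normrN. Qed.

Lemma ereal_cvg_bounded (u : nat -> R) (M : R) (a : \bar R) : (0 <= a)%E ->
  (forall n, u n <= M) -> (fun n => (u n)%:E) @ \oo --> a ->
  exists2 r : R, a = r%:E & u @ \oo --> r.
Proof.
move=> a0 uM ua.
have a_le : (a <= M%:E)%E.
  have <- : limn (fun n => (u n)%:E) = a by exact/cvg_lim.
  apply: lime_le; first by apply/cvg_ex; exists a.
  by apply: nearW => n; rewrite lee_fin.
have a_fin : a \is a fin_num by rewrite ge0_fin_numE// (le_lt_trans a_le)// ltry.
exists (fine a); first by rewrite fineK.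
by move: ua; rewrite -{1}(fineK a_fin) => /fine_cvgP[_].
Qed.

Section paths.
Variables (eps delta t : R) (b : 'I_d -> R -> R).
Hypotheses (eps0 : 0 < eps) (delta0 : 0 < delta) (t0 : 0 < t).
Hypothesis cb : forall i, continuous (b i).

Let f (u v : R) : R := path_kernel H0 H eps delta (u - v) (fun i => b i u - b i v).

Let max_powR_continuous (g : R * R -> R) (e a : R) : 0 < e -> continuous g ->
  continuous (fun z => Num.max `|g z| e `^ a).
Proof.
move=> e0 cg z.
have mx y : 0 < Num.max `|g y| e by rewrite lt_max e0 orbT.
have -> : (fun z => Num.max `|g z| e `^ a) = (fun z => expR (a * ln (Num.max `|g z| e))).
  by apply/funext => y; rewrite /powR gt_eqF.
apply: continuous_comp; last exact: continuous_expR.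
apply: cvgM; first exact: cvg_cst.
apply: (continuous_comp (f := fun z => Num.max `|g z| e) (g := @ln R)); last exact: continuous_ln.
apply: (@continuous_max _ _ (fun z => `|g z|) (cst e)); last exact: cvg_cst.
by apply: continuous_comp; [exact: cg|exact: norm_continuous].
Qed.

Let cvg_prod_seq (g : 'I_d -> R * R -> R) (z : R * R) :
  (forall i, {for z, continuous (g i)}) -> {for z, continuous (fun y => \prod_(i < d) g i y)}.
Proof.
move=> cg; have -> : (fun y => \prod_(i < d) g i y) = \prod_(i < d) g i.
  by apply/funext => y; rewrite fct_prodE.
elim/big_ind : _ => [|g1 g2 c1 c2|i _]; [exact: cvg_cst|exact: cvgM|exact: cg].
Qed.

Let cdiff (g : R -> R) : continuous g -> continuous (fun z : R * R => g z.1 - g z.2).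
Proof.
move=> cg z; apply: cvgB.
- by apply: (continuous_comp (f := fst)); [exact: cvg_fst|exact: cg].
- by apply: (continuous_comp (f := snd)); [exact: cvg_snd|exact: cg].
Qed.

Let cf : continuous (fun z : R * R => f z.1 z.2).
Proof.
move=> z; apply: cvgM.
  by apply: max_powR_continuous => //; apply: (cdiff (g := id)) => y; exact: cvg_id.
apply: (@cvg_prod_seq (fun i z => Num.max `|b i z.1 - b i z.2| (Num.sqrt eps) `^ (- (2 - 2 * H i))) z) => i.
by apply: max_powR_continuous; [rewrite sqrtr_gt0|exact: cdiff].
Qed.

Let mf : measurable_fun setT (fun z : R * R => f z.1 z.2).
Proof.
have mb i : measurable_fun setT (b i) by exact: continuous_measurable_fun.
apply: measurable_path_kernel => [|i]; first exact: measurable_funB.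
by apply: measurable_funB; exact: (measurableT_comp (mb i)).
Qed.

Let grid_energy_le n : grid_energy eps delta t b n <=
  t * (t * path_kernel H0 H eps delta 0 (fun=> 0)).
Proof.
have hn : 0 <= t / n.+1%:R by apply: divr_ge0; [exact: ltW|].
have e (x : R) : t * x = \sum_(0 <= j < n.+1) t / n.+1%:R * x.
  by rewrite sumr_const_nat subn0 -[RHS]mulr_natl mulrA [n.+1%:R * _]mulrC divfK.
rewrite [leRHS]e; apply: ler_sum => j _; apply: ler_wpM2l; first exact: hn.
rewrite [leRHS]e; apply: ler_sum => l _; apply: ler_wpM2l; first exact: hn.
exact: path_kernel_le0.
Qed.

Lemma cvg_grid_energy : exists2 r : R, (\int[mu]_(s in `[0%R, t]) \int[mu]_(s' in `[0%R, t])
     (path_kernel H0 H eps delta (s - s') (fun i => b i s - b i s')%R)%:E = r%:E)%E &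
   grid_energy eps delta t b @ \oo --> r.
Proof.
pose D := path_kernel H0 H eps delta 0 (fun=> 0).
have f0D u v : 0 <= f u v <= D by rewrite path_kernel_ge0 path_kernel_le0.
have := cvg_riemann_sum2 t0 mf cf f0D.
set a := (\int[mu]_(s in _) _)%E => ca.
have aE : (\int[mu]_(s in `[0%R, t]) \int[mu]_(s' in `[0%R, t])
     (path_kernel H0 H eps delta (s - s') (fun i => b i s - b i s')%R)%:E = a)%E.
  have mfs s : measurable_fun setT (fun s' => (f s s')%:E).
    by apply/measurable_EFinP; exact: (measurableT_comp mf (measurable_pair1 s)).
  have inn s : (\int[mu]_(s' in `[0%R, t[) (f s s')%:E = \int[mu]_(s' in `[0%R, t]) (f s s')%:E)%E.
    by rewrite integral_itv_bndo_bndc//; exact: measurable_funTS.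
  rewrite /a; under [RHS]eq_integral do rewrite inn.
  rewrite integral_itv_bndo_bndc//; apply: measurable_funTS.
  under eq_fun do rewrite -integral_mulr_indic.
  apply: (measurable_integral_snd mu (f := fun z : R * R =>
    (f z.1 z.2 * \1_(`[0, t]) (z.2 : R))%:E)) => [|z].
    apply/measurable_EFinP; apply: measurable_funM => //.
    exact: (measurableT_comp (measurable_indic_itv _) measurable_snd).
  by rewrite lee_fin; apply: mulr_ge0 => //; have /andP[] := f0D z.1 z.2.
have a0 : (0 <= a)%E.
  apply: integral_ge0 => s _; apply: integral_ge0 => s' _; rewrite lee_fin.
  by have /andP[] := f0D s s'.
have [r ar Sr] := ereal_cvg_bounded a0 (fun n => grid_energy_le n) ca.
exists r; [rewrite aE; exact: ar|exact: Sr].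
Qed.

End paths.


Section moment.
Variable B : 'I_d -> R -> {RV P >-> R}.
Hypothesis bmB : brownian_motion B.
Hypothesis subcritical : d%:R + 1 < 2 * H0 + \sum_(i < d) H i.

(** After folding, [c] times the energy is the average over base points [j] of a diagonal term plus
    the exponent of a walk started at [j h]. Jensen leaves one exponential per base point, which
    [walk_exp_moment] bounds uniformly. *)
Lemma grid_energy_exp_moment (t c : R) : 0 < t -> 0 < c ->
  exists C : R, forall eps delta : R, 0 < eps -> 0 < delta ->
    \forall n \near \oo,
      (\int[P]_w (expR (c * grid_energy eps delta t (fun i s => B i s w) n))%:E <= C%:E)%E.
Proof.
move=> t0 c0; have ct0 : 0 < 2 * c * t by rewrite !mulr_gt0.
have [K HK] := walk_exp_moment H0b Hb bmB subcritical t0 ct0.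
exists (expR 1 * K) => eps delta eps0 delta0.
pose D := path_kernel H0 H eps delta 0 (fun=> 0).
near=> n.
pose h : R := t / n.+1%:R.
have h0 : 0 < h by rewrite divr_gt0.
have nh : n.+1%:R * h = t by rewrite /h mulrCA mulfV ?mulr1.
(* The threshold on [n] depends on [eps] and [delta] through [D]. *)
have hD : h * (2 * c * t * D) <= 1.
  rewrite /h mulrAC ler_pdivrMr// mul1r (@le_trans _ _ n%:R) ?ler_nat//.
  apply/ltW/(lt_le_trans (truncnS_gt _)); rewrite ler_nat.
  by near: n; exact: nbhs_infty_ge.
pose k (w : Omega) (j l : nat) := path_kernel H0 H eps delta (j%:R * h - l%:R * h)
  (fun i => B i (j%:R * h) w - B i (l%:R * h) w).
have kC w j l : k w j l = k w l j.
  rewrite /k -path_kernelN opprB; congr (path_kernel _ _ _ _ _ _).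
  by apply/funext => i; rewrite opprB.
(* The 2 comes from the folding and the factor [t] from [h = t / n.+1], which trades one [h] for an
   average. *)
pose a (w : Omega) (j : nat) := c * t * h * D +
  \sum_(1 <= l < (n - j).+1) h * (2 * c * t * path_kernel H0 H eps delta (l%:R * h)
    (fun i => B i (j%:R * h + l%:R * h) w - B i (j%:R * h) w)).
have cE w : c * grid_energy eps delta t (fun i s => B i s w) n =
    n.+1%:R^-1 * \sum_(0 <= j < n.+1) a w j.
  have -> : grid_energy eps delta t (fun i s => B i s w) n =
      h * (h * \sum_(0 <= j < n.+1) \sum_(0 <= l < n.+1) k w j l).
    rewrite /grid_energy -/h !mulr_sumr; apply: eq_bigr => j _.
    by rewrite -/h !mulr_sumr.
  rewrite (sum_symmetric _ (kC w)) !mulr_sumr !big_nat; apply: eq_bigr => j /andP[_ jn].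
  have -> : n.+1%:R^-1 = h / t by rewrite /h mulrAC mulfV ?mul1r// gt_eqF.
  have -> : k w j j = D.
    by rewrite /k subrr; congr (path_kernel _ _ _ _ _ _); apply/funext => i; rewrite subrr.
  have -> : a w j = c * t * h * D + h * (2 * c * t) * \sum_(j.+1 <= l < n.+1) k w j l.
    rewrite /a -(add1n j) big_addn subSn// !mulr_sumr; congr (_ + _).
    apply: eq_bigr => l _; rewrite -!mulrA; do 5!congr (_ * _).
    rewrite kC /k natrD mulrDl addrK; congr (path_kernel _ _ _ _ _ _).
    by apply/funext => i; rewrite [j%:R * h + _]addrC.
  by field; rewrite gt_eqF.
have ma j : measurable_fun setT (a ^~ j).
  apply: measurable_funD => //; apply: measurable_sum => l.
  apply: measurable_funM => //; apply: measurable_funM => //.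
  by apply: measurable_path_kernel => // i; exact: measurable_funB.
have mea j : measurable_fun setT (fun w => (expR (a w j))%:E).
  by apply/measurable_EFinP; exact: (measurableT_comp (@measurable_expR R)).
have n0 : 0 <= n.+1%:R^-1 :> R by rewrite invr_ge0.
apply: (@le_trans _ _ (\int[P]_w (n.+1%:R^-1%:E * \sum_(0 <= j < n.+1) (expR (a w j))%:E))%E).
  apply: ge0_le_integralT => w; first by rewrite lee_fin expR_ge0.
  by rewrite sumEFin -EFinM lee_fin cE expR_mean_le.
rewrite ge0_integralZl//; last 2 first.
- exact: emeasurable_sum.
- by move=> w _; apply: sume_ge0 => j _; rewrite lee_fin expR_ge0.
rewrite ge0_integral_sum//.
have aK j : (j < n.+1)%N -> (\int[P]_w (expR (a w j))%:E <= (expR 1 * K)%:E)%E.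
  move=> jn; under eq_integral do rewrite /a expRD EFinM.
  have D0 : 0 <= D by rewrite /D mulr_ge0 ?powR_ge0// prodr_ge0// => i _; exact: powR_ge0.
  have HKj := HK (j%:R * h) h eps delta (n - j)%N.
  rewrite ge0_integralZl//; last first.
    apply/measurable_EFinP; apply: (measurableT_comp (@measurable_expR R)).
    apply: measurable_sum => l; apply: measurable_funM => //; apply: measurable_funM => //.
    by apply: measurable_path_kernel => // i; exact: measurable_funB.
  rewrite EFinM; apply: lee_pmul.
  - by rewrite lee_fin expR_ge0.
  - by apply: integral_ge0 => w _; rewrite lee_fin expR_ge0.
  (* By [hD] the diagonal term is at most 1/2. *)
  - rewrite lee_fin ler_expR.
    have : 0 <= c * t * h * D by rewrite mulr_ge0// ltW// !mulr_gt0.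
    move: hD; rewrite (_ : h * (2 * c * t * D) = 2 * (c * t * h * D)); last by ring.
    lra.
  - apply: HKj => //; first by rewrite mulr_ge0// ltW.
    by rewrite -nh ler_pM2r// ler_nat (leq_trans (leq_subr _ _) (leqnSn n)).
apply: (@le_trans _ _ (n.+1%:R^-1%:E * \sum_(0 <= j < n.+1) (expR 1 * K)%:E)%E).
  apply: lee_wpmul2l; first by rewrite lee_fin.
  by rewrite !big_nat; apply: lee_sum => j /andP[_ jn]; exact: aK.
by rewrite sumEFin sumr_const_nat subn0 -EFinM lee_fin -[(expR 1 * K) *+ _]mulr_natl mulKf.
Unshelve. all: by end_near. Qed.


(** The path frozen at its initial value for negative times: continuity of [B] is given on [[0,
    +oo[] only, and the Riemann sums are handled for paths continuous on the whole line. *)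
Let bpath (w : Omega) (i : 'I_d) (s : R) : R := B i (Num.max 0 s) w.

Lemma continuous_bpath w : (forall i, {within `[0, +oo[, continuous (fun s => B i s w)}) ->
  forall i, continuous (bpath w i).
Proof.
move=> cB i s; pose A := `[(0 : R), +oo[%classic.
have As y : A (Num.max 0 y) by rewrite /A /= in_itv/= andbT le_max lexx.
have := (subspace_continuousP _ _).1 (cB i) _ (As s).
move=> h; apply: (cvg_comp (fun y => Num.max 0 y) (fun y => B i y w)); last exact: h.
move=> U hU; have cm : {for s, continuous (fun y : R => Num.max 0 y)}.
  by apply: (@continuous_max _ _ (cst 0) id); [exact: cvg_cst|exact: cvg_id].
have hU' : nbhs (Num.max 0 s) [set y : R | A y -> U y] := hU.
have hs : \forall y \near s, A (Num.max 0 y) -> U (Num.max 0 y) := cm _ hU'.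
change (\forall y \near s, U (Num.max 0 y)).
by apply: filterS hs => y; apply; exact: As.
Qed.

Variable W : R -> d.-tuple R -> {RV P >-> R}.
Hypothesis sheetW : fractional_brownian_sheet H0 H W.
Hypothesis indWB : independent_systems P (sigma_sheet W) (sigma_motion B).

Lemma grid_energy_bpath eps delta t w n : 0 < t ->
  grid_energy eps delta t (fun i s => B i s w) n = grid_energy eps delta t (bpath w) n.
Proof.
move=> t0; have gt0 (j : nat) : Num.max 0 (j%:R * (t / n.+1%:R)) = j%:R * (t / n.+1%:R).
  by apply/max_idPr; rewrite mulr_ge0// divr_ge0// ltW.
rewrite /grid_energy /bpath; apply: eq_bigr => j _; congr (_ * _); apply: eq_bigr => k _.
by congr (_ * path_kernel _ _ _ _ _ _); apply/funext => i; rewrite !gt0.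
Qed.

(** The exponent is [4 l^2 (2 + 2 q)] of [wiener_exponential_le] at [q = mollified_const r]. The
    extra [+ 1] is harmless as [r >= 0], and keeps the coefficient of [r] positive when [l = 0], as
    [grid_energy_exp_moment] requires. *)
Lemma wiener_mollified_exp_le (t eps delta l : R) (x : d.-tuple R) (X : Omega -> R) w :
  0 < t -> 0 < eps -> 0 < delta ->
  (forall i, {within `[0, +oo[, continuous (fun s => B i s w)}) ->
  wiener_integral H0 H W (fun p => \1_(`[0, t]) (p.1 : R) *
    mollified_delta B t x eps delta w p.1 p.2) X ->
  exists2 r : R, grid_energy eps delta t (fun i s => B i s w) @ \oo --> r &
    (\int[P]_w' (expR (l * X w'))%:E <=
     (expR (8 * l ^+ 2 + (8 * l ^+ 2 * mollified_const H0 H + 1) * r))%:E)%E.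
Proof.
move=> t0 eps0 delta0 cB wX.
have cb := continuous_bpath cB.
have mb i : measurable_fun setT (bpath w i) by exact: continuous_measurable_fun.
have [r rE rc] := cvg_grid_energy eps0 delta0 t0 cb.
exists r.
  rewrite (_ : grid_energy _ _ _ _ = grid_energy eps delta t (bpath w))//.
  by apply/funext => n; exact: grid_energy_bpath.
have r0 : 0 <= r.
  rewrite -lee_fin -rE; apply: integral_ge0 => s _; apply: integral_ge0 => s' _.
  by rewrite lee_fin path_kernel_ge0.
have mollE r' y : mollified_delta B t x eps delta w r' y =
    \int[@lebesgue_measure R]_(s in `[0, t]) (box_kernel delta (t - s - r') *
     heat_kernel eps [tuple bpath w i s + tnth x i - tnth y i | i < d]).
  apply: eq_Rintegral => s; rewrite inE/= in_itv/= => /andP[s0 _].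
  by rewrite /bpath; rewrite (max_idPr s0).
have := hinner_mollified_le H0b Hb t x eps0 delta0 mb.
rewrite rE -EFinM.
under [X in hinner _ _ X _]eq_fun do rewrite -mollE.
under [X in hinner _ _ _ X]eq_fun do rewrite -mollE.
move=> hq; apply: (le_trans (wiener_exponential_le H0b Hb sheetW l wX hq)).
rewrite lee_fin ler_expR; lra.
Qed.

(** Given [B], the moment is at most a limit of exponentials of grid energies; Fatou's lemma carries
    over their uniform bound, even though it holds only from an index depending on [eps] and
    [delta]. *)
Lemma regularized_exp_moment (t l : R) (x : d.-tuple R) : 0 < t ->
  exists C : R, forall (eps delta : R) (X : Omega -> R), 0 < eps -> 0 < delta ->
    measurable_fun setT X -> regularized_integral H0 H W B t x eps delta X ->
    (\int[P]_w (expR (l * X w))%:E <= C%:E)%E.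
Proof.
move=> t0; pose c := 8 * l ^+ 2 * mollified_const H0 H + 1.
have c0 : 0 < c.
  apply: ltr_pwDr => //; apply: mulr_ge0; first by apply: mulr_ge0 => //; exact: sqr_ge0.
  apply: mulr_ge0; first by apply: ltW; exact: alphaH_gt0.
  by apply: mulr_ge0; [exact: sqr_ge0|apply: prodr_ge0 => i _; exact: sqr_ge0].
have [C HC] := grid_energy_exp_moment t0 c0.
exists (expR (8 * l ^+ 2) * C) => eps delta X eps0 delta0 mX [F [mF wF XF]].
pose f (y : R) : \bar R := (expR (l * y))%:E.
have mf : measurable_fun setT f.
  by apply/measurable_EFinP; apply: (measurableT_comp (@measurable_expR R)); exact: measurable_funM.
have f0 y : (0 <= f y)%E by rewrite lee_fin expR_ge0.
have mW (p : R * d.-tuple R) : 0 <= p.1 -> measurable_fun setT (W p.1 p.2 : Omega -> R) by [].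
have mB (p : 'I_d * R) : 0 <= p.2 -> measurable_fun setT (B p.1 p.2 : Omega -> R) by [].
have [m1 m2 E] := product_system_integral mW mB indWB mF mf f0.
have -> : (\int[P]_w (expR (l * X w))%:E = \int[P]_w f (F w w))%E.
  apply: ae_eq_integral => //.
  - exact: (measurableT_comp mf mX).
  - by apply: ae_imply XF => w /= -> _.
rewrite E.
pose G n w := grid_energy eps delta t (fun i s => B i s w) n.
pose g n w := (expR (8 * l ^+ 2 + c * G n w))%:E : \bar R.
have mG n : measurable_fun setT (G n).
  apply: measurable_sum => j; apply: measurable_funM => //; apply: measurable_sum => k.
  apply: measurable_funM => //; apply: measurable_path_kernel => // i.
  exact: measurable_funB.
have mg n : measurable_fun setT (g n).
  apply/measurable_EFinP; apply: (measurableT_comp (@measurable_expR R)).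
  by apply: measurable_funD => //; exact: measurable_funM.
(* The limit is known for almost every path only; the lower limit is defined and measurable
   everywhere. *)
apply: (@le_trans _ _ (\int[P]_w limn_einf (g ^~ w))%E).
  apply: ae_ge0_le_integral => //.
  - by move=> w _; apply: integral_ge0 => w' _.
  - move=> w _; rewrite limn_einf_lim; apply: lime_ge; first exact: is_cvg_einfs.
    by apply: nearW => n; apply: le_ereal_inf_tmp => _ [m _ <-]; rewrite lee_fin expR_ge0.
  - under eq_fun do rewrite limn_einf_lim.
    apply: (emeasurable_fun_cvg (fun n w => einfs (g ^~ w) n)) => [n|w _].
      exact: measurable_fun_einfs.
    exact: is_cvg_einfs.
  - case: bmB => _ cB _ _; apply: ae_imply (ae_and cB wF) => w [cw Fw] _.
    have [r rc Xr] := wiener_mollified_exp_le l t0 eps0 delta0 cw Fw.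
    have gc : g n w @[n --> \oo] --> (expR (8 * l ^+ 2 + c * r))%:E; last first.
      by rewrite (cvg_limn_einf_sup gc).1.
    apply: cvg_EFin; first exact: nearW.
    apply: (cvg_comp _ expR); last exact: continuous_expR.
    by apply: cvgD; [exact: cvg_cst|apply: cvgM => //; exact: cvg_cst].
apply: (le_trans (fatou P measurableT mg _)).
  by move=> n w _; rewrite lee_fin expR_ge0.
rewrite limn_einf_lim; apply: lime_le; first exact: is_cvg_einfs.
have := HC eps delta eps0 delta0; apply: filterS => n hn.
apply: (@le_trans _ _ (\int[P]_w g n w)%E).
  by apply: ereal_inf_lbound; exists n => //=.
rewrite /g; under eq_integral do rewrite expRD EFinM.
rewrite ge0_integralZl//; last first.
  apply/measurable_EFinP; apply: (measurableT_comp (@measurable_expR R)).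
  exact: measurable_funM.
by rewrite EFinM; apply: lee_wpmul2l => //; rewrite lee_fin expR_ge0.
Qed.

End moment.
End final.

Theorem theorem3p3 (R : realType) (d : nat) (H0 : R) (H : 'I_d -> R)
    (disp : measure_display) (Omega : measurableType disp)
    (P : probability Omega R)
    (W : R -> d.-tuple R -> {RV P >-> R}) (B : 'I_d -> R -> {RV P >-> R})
    (t : R) (x : d.-tuple R) (V : {RV P >-> R}) :
  (1 <= d)%N ->
  2^-1 < H0 < 1 ->
  (forall i, 2^-1 < H i < 1) ->
  d%:R + 1 < 2 * H0 + \sum_(i < d) H i ->
  0 < t ->
  fractional_brownian_sheet H0 H W ->
  brownian_motion B ->
  independent_systems P (sigma_sheet W) (sigma_motion B) ->
  delta_integral H0 H W B t x V ->
  forall lambda : R, ('E_P[fun w => expR (lambda * V w)%R] < +oo)%E.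
Proof.
move=> _ H0b Hb subcritical t0 sheetW bmB indWB [Veps [regV convV]] lambda.
(* [C] is uniform in the mollifiers, so for each tolerance one regularized integral close to [V] in
   L2 suffices. *)
have [C HC] := regularized_exp_moment H0b Hb bmB subcritical sheetW indWB lambda x t0.
rewrite unlock; apply: (@le_lt_trans _ _ C%:E); last exact: ltry.
apply: exp_moment_L2_closure => [|eta eta0]; first exact: measurable_funP.
have near_eta : \forall ed \near filter_prod (0 : R)^'+ (0 : R)^'+,
    ('E_P[fun w => ((Veps ed.1 ed.2 w - V w) ^+ 2)%R] <= eta%:E)%E.
  exact: ereal_cvg0_le eta0 convV.
have near_pos : \forall ed \near filter_prod (0 : R)^'+ (0 : R)^'+, 0 < ed.1 /\ 0 < ed.2.
  by exists ([set e | 0 < e], [set e | 0 < e]) => //=; split; exact: nbhs_right_gt.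
have [[eps delta] [/= Veta [eps0 delta0]]] := filter_ex (filterI near_eta near_pos).
exists (Veps eps delta); split.
- exact: measurable_funP.
- by move: Veta; rewrite unlock.
- by apply: (HC eps delta) => //; exact: regV.
Qed.
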